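(* Let $k_f\in(0,1]$. There exist constants $K,c>0$ such that for all $\nu>0$, all $\gamma\ge K\nu^2$ and all $k_1,k_3\in\mathbb{Z}$ with $\beta^2=(k_1^2+k_3^2)/k_f^2>1$, $$\Psi(\mathcal{L}'_{k_1,k_3})\ge c|k_1\gamma|^{1/2}(1-\beta^{-2}).$$
   Context: $\mathbb{T}_{2\pi}=\mathbb{R}/2\pi\mathbb{Z}$. With $\beta^2=(k_1^2+k_3^2)/k_f^2$, $\beta>0$, the operator $$\mathcal{L}'_{k_1,k_3}=-\nu k_f^2\partial_y^2+\frac{ik_1}{k_f^2}\frac{\gamma}{\nu}\sin y\,\big(1-(\beta^2-\partial_y^2)^{-1}\big)$$ acts on $X=L^2(\mathbb{T}_{2\pi})$ endowed with the norm $\|f\|_*=\langle f,f-(\beta^2-\partial_y^2)^{-1}f\rangle^{1/2}$ (where $\langle\cdot,\cdot\rangle$ is the $L^2$ inner product), with domain $D(\mathcal{L}'_{k_1,k_3})=H^2(\mathbb{T}_{2\pi})$. Here $$\Psi(\mathcal{L}'_{k_1,k_3})=\inf\{\|(\mathcal{L}'_{k_1,k_3}-i\lambda)f\|_*: f\in D(\mathcal{L}'_{k_1,k_3}),\ \lambda\in\mathbb{R},\ \|f\|_*=1\}.$$ *)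

(* Defs.v *)
From HB Require Import structures.
From mathcomp Require Import all_boot all_order all_algebra.
From mathcomp Require Import complex.
From mathcomp Require Import all_classical all_reals all_analysis.

Set Implicit Arguments.
Unset Strict Implicit.
Unset Printing Implicit Defensive.

Import Order.TTheory GRing.Theory Num.Theory.
Import numFieldNormedType.Exports.

Local Open Scope classical_set_scope.
Local Open Scope ring_scope.
Local Open Scope complex_scope.

(* A function on the torus R / 2 pi Z is a 2 pi-periodic function on R, and
   integrals over the torus are integrals over [0, 2 pi].  Elements of L^2 are
   represented by functions; equalities between them are almost everywhere. *)

Section torus.
Context {R : realType}.
Implicit Types (f g u : R -> R[i]) (phi : R -> R).

Let mu := @lebesgue_measure R.

Definition torus_int f : R[i] :=
  Rintegral mu `[0, 2 * pi] (fun y => complex.Re (f y)) +i*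
  Rintegral mu `[0, 2 * pi] (fun y => complex.Im (f y)).

Definition inner f g : R[i] := torus_int (fun y => f y * conjc (g y)).

Definition L2 f : Prop :=
  [/\ periodic f (2 * pi),
      measurable_fun setT (fun y => complex.Re (f y)),
      measurable_fun setT (fun y => complex.Im (f y)) &
      mu.-integrable `[0, 2 * pi]
        (fun y => (complex.Re (f y) ^+ 2 + complex.Im (f y) ^+ 2)%:E)].

(* Test functions are real-valued of class C^1 on the torus. *)
Definition test_fun phi : Prop :=
  [/\ periodic phi (2 * pi), (forall y, derivable phi y 1) &
      continuous (derive1 phi)].

Definition is_weak_deriv f g : Prop :=
  forall phi, test_fun phi ->
    torus_int (fun y => f y * (derive1 phi y)%:C) =
    - torus_int (fun y => g y * (phi y)%:C).

(* A representative of the L^2 weak derivative of f, which is unique almost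
   everywhere; the value is irrelevant if f has no weak derivative in L^2. *)
Definition weak_deriv f : R -> R[i] :=
  xget (fun=> 0) [set g | L2 g /\ is_weak_deriv f g].

Definition H1 f : Prop := L2 f /\ exists g, L2 g /\ is_weak_deriv f g.

Definition H2 f : Prop := H1 f /\ H1 (weak_deriv f).

Definition dyy f : R -> R[i] := weak_deriv (weak_deriv f).

(* (b^2 - d_y^2)^{-1} f: a representative of the solution u in H^2 of
   b^2 u - u'' = f, which exists and is unique for b > 0 and f in L^2. *)
Definition helmholtz_inv (b : R) f : R -> R[i] :=
  xget (fun=> 0)
    [set u | H2 u /\ {ae mu, forall y, (b ^+ 2)%:C * u y - dyy u y = f y}].

(* For b > 1 and f in L^2 the inner product is a nonnegative real number. *)
Definition norm_star (b : R) f : R :=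
  Num.sqrt (complex.Re (inner f (fun y => f y - helmholtz_inv b f y))).

Definition beta (kf : R) (k1 k3 : int) : R :=
  Num.sqrt ((k1%:~R ^+ 2 + k3%:~R ^+ 2) / kf ^+ 2).

Definition opL (kf nu gamma : R) (k1 k3 : int) f : R -> R[i] := fun y =>
  - (nu * kf ^+ 2)%:C * dyy f y
  + 'i%C * (k1%:~R / kf ^+ 2 * (gamma / nu) * sin y)%:C
    * (f y - helmholtz_inv (beta kf k1 k3) f y).

(* The infimum is taken in the extended reals. *)
Definition Psi (kf nu gamma : R) (k1 k3 : int) : \bar R :=
  ereal_inf [set x : \bar R | exists (f : R -> R[i]) (lambda : R),
    [/\ H2 f, norm_star (beta kf k1 k3) f = 1 &
        x = (norm_star (beta kf k1 k3)
              (fun y => opL kf nu gamma k1 k3 f y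
                        - 'i%C * lambda%:C * f y))%:E]].

End torus.

(* Main.v *)
Require Import Defs.
From mathcomp Require Import all_boot all_order all_algebra.
From mathcomp Require Import complex.
From mathcomp Require Import all_classical all_reals all_analysis.
From mathcomp Require Import ring lra zify measurable_realfun.
Import Order.TTheory GRing.Theory Num.Theory.
Import numFieldNormedType.Exports.
Local Open Scope ring_scope.

(** Why the bound holds.  Fix f in H^2 and lambda, write b for beta and put
    k = b^2 - 1, u = (b^2 - d_y^2)^-1 f and v = f - u, so that v = k u - u''.
    Dividing the equation (L' - i lambda) f = F by the modulus m of the
    coefficient of the advection term gives
      F / m = - eps f'' + i (S v - lam f),   S = sin or - sin,  lam = lambda / m,
    and the hypotheses on nu, gamma and kf make eps as small as desired when K
    is large.  The squared starred norm of F is at least (1 - b^-2)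
    times its squared L^2 norm.  Since b^2 kf^2 is an integer, b^2 > 1 forces
    k >= k0 for some k0 > 0 that depends on kf alone, and |v|^2 >= k0 / 2 follows
    when f has starred norm 1 (bars denote L^2 norms).  The claim, which is
    trivial for k1 = 0, becomes the L^2 estimate [resolvent_estimate]: with
    e = eps^(1/4), the squared norm of F / m is at least a constant times
    e^4 |v|^2.

    Suppose that it is much smaller.  The advection term i (S v - lam f) is
    skew-symmetric for the starred inner product, so testing the equation with
    v, which represents f in that inner product, leaves only dissipation:
    e^2 |v'|^2 is a small multiple of |v|^2.  Testing with i v gives the energy
    balance int (S - lam) |v|^2 = lam <u, v> up to an error, where
    <u, v> = |u'|^2 + k |u|^2 >= 0 (take lam >= 0 without loss of generality).
    Let G = (S - lam) v - lam u be the inviscid residual.  Testing with i G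
    shows that G is small, and testing with G that int (S - lam) |v'|^2 is
    small; through the weight 1 - S, which controls C^2 for C = S', the latter
    makes C v' small.  Let D = 1 - lam.

    If D is at most a multiple of e^2, the energy balance confines v to the
    neighbourhood of size e of the maximum of S, where C is small.  This is
    incompatible with the bound on v' ([uncertainty], [concentrated_absurd]).

    Otherwise, two identities contradict each other.  Multiplying G by C times
    the derivative of v and integrating by parts, all terms in u' cancel
    ([virial]) and, up to errors, D |v|^2 <= lam (2 k + 1/2) |u|^2.  On the other
    hand u is small compared to v, for the reason that forbids neutral modes of
    the inviscid equation: expanding the square |u' - C u / (S - lam)|^2 gives,
    formally, lam^2 k |u|^2 <= 0 when G = 0.  The function 1 / (S - lam) is
    singular at the critical layer, so it is regularised at a scale r; the price
    is the part of C v in the layer |S - lam| ~ r ([howard]).  Layers for n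
    dyadic scales are essentially disjoint, so the sum over these scales
    telescopes ([howard_scales]) and lam^2 k |u|^2 <= 16 D |v|^2 / n up to
    errors.  With n large this contradicts the virial bound ([interior_absurd]).

    The integrations by parts require classical derivatives.  The part on weak
    derivatives shows, from the lemma of du Bois-Reymond, that f and u have
    representatives of class C^1 and C^2. *)

(** * Functions of class C1 on the circle *)

Section calculus.
Local Open Scope classical_set_scope.
Context {R : realType}.
Implicit Types (f g : R -> R) (y a : R).

(** The derivative is an argument so that a computation with derivatives is a
    unification problem: applying the closure lemmas below to a compound
    expression produces its derivative in a form known to the ring solvers. *)
Definition C1circle f f' := [/\ periodic f (2 * pi),
  forall y, is_derive y 1 f (f' y) & continuous f'].

Lemma continuous_add f g : continuous f -> continuous g ->
  continuous (fun y => f y + g y).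
Proof. by move=> cf cg y; apply: continuousD; [exact: cf|exact: cg]. Qed.

Lemma continuous_opp f : continuous f -> continuous (fun y => - f y).
Proof. by move=> cf y; apply: continuousN; exact: cf. Qed.

Lemma continuous_mul f g : continuous f -> continuous g ->
  continuous (fun y => f y * g y).
Proof. by move=> cf cg y; apply: continuousM; [exact: cf|exact: cg]. Qed.

Lemma continuous_const a : continuous (fun _ : R => a).
Proof. exact: cst_continuous. Qed.

Lemma continuous_expn n f : continuous f -> continuous (fun y => f y ^+ n).
Proof.
move=> cf; elim: n => [|n IH]; first exact: continuous_const.
by under eq_fun do rewrite exprS; exact: continuous_mul.
Qed.

Lemma continuous_inv f : (forall y, f y != 0) -> continuous f ->
  continuous (fun y => (f y)^-1).
Proof. by move=> f0 cf y; apply: continuousV => //; exact: cf. Qed.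

Lemma C1circle_deriv f f' : C1circle f f' -> continuous f'.
Proof. by case. Qed.

Lemma C1circle_cont f f' : C1circle f f' -> continuous f.
Proof.
case=> _ df _ y; apply: differentiable_continuous; apply/derivable1_diffP.
by have [] := df y.
Qed.

Lemma C1circle_cst a : C1circle (fun=> a) (fun=> 0).
Proof.
split=> [y //|y|]; [exact: is_derive_cst | exact: continuous_const].
Qed.

Lemma C1circleD f f' g g' : C1circle f f' -> C1circle g g' ->
  C1circle (fun y => f y + g y) (fun y => f' y + g' y).
Proof.
move=> [pf df cf] [pg dg cg]; split=> [y|y|]; first by rewrite pf pg.
  exact: is_deriveD.
exact: continuous_add.
Qed.

Lemma C1circleN f f' : C1circle f f' -> C1circle (fun y => - f y) (fun y => - f' y).
Proof.
move=> [pf df cf]; split=> [y|y|]; first by rewrite pf.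
  exact: is_deriveN.
exact: continuous_opp.
Qed.

Lemma C1circleM f f' g g' : C1circle f f' -> C1circle g g' ->
  C1circle (fun y => f y * g y) (fun y => f' y * g y + f y * g' y).
Proof.
move=> Cf Cg; have := C1circle_cont _ _ Cf; have := C1circle_cont _ _ Cg.
case: Cf Cg => [pf df cf] [pg dg cg] cg0 cf0; split=> [y|y|].
- by rewrite pf pg.
- have -> : f' y * g y + f y * g' y = f y *: g' y + g y *: f' y.
    by rewrite /GRing.scale /=; ring.
  exact: is_deriveM.
- by apply: continuous_add; exact: continuous_mul.
Qed.

Lemma C1circleV f f' : (forall y, f y != 0) -> C1circle f f' ->
  C1circle (fun y => (f y)^-1) (fun y => - (f y ^+ 2)^-1 * f' y).
Proof.
move=> f0 Cf; have cf0 := C1circle_cont _ _ Cf.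
case: Cf => [pf df cf]; split=> [y|y|].
- by rewrite pf.
- have -> : - (f y ^+ 2)^-1 * f' y = - (f y) ^- 2 *: f' y by [].
  exact: is_deriveV.
- apply: continuous_mul => //; apply: continuous_opp; apply: continuous_inv.
    by move=> y; rewrite expf_neq0.
  exact: continuous_expn.
Qed.

End calculus.

(** * Integrals over the circle *)

Section integrals.
Local Open Scope classical_set_scope.
Context {R : realType}.
Implicit Types (f g : R -> R) (F P p : bool -> R -> R) (y a : R).
Notation mu := (@lebesgue_measure R).

Definition oint f : R := Rintegral mu `[0, 2 * pi] f.

Lemma twopi_gt0 : 0 < 2 * pi :> R.
Proof. by rewrite mulr_gt0// pi_gt0. Qed.

Lemma continuous_within (A : set R) f : continuous f ->
  {within A, continuous f}.
Proof. exact: continuous_subspaceT. Qed.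

Lemma continuous_integrable f a b : continuous f ->
  mu.-integrable `[a, b] (EFin \o f).
Proof.
move=> cf; apply: continuous_compact_integrable.
  exact: segment_compact.
exact: continuous_within.
Qed.

Lemma ointD f g : continuous f -> continuous g ->
  oint (fun y => f y + g y) = oint f + oint g.
Proof. by move=> cf cg; rewrite /oint RintegralD//; exact: continuous_integrable. Qed.

Lemma ointZ a f : continuous f -> oint (fun y => a * f y) = a * oint f.
Proof. by move=> cf; rewrite /oint RintegralZl//; exact: continuous_integrable. Qed.

Lemma oint_deriv f f' : C1circle f f' -> oint f' = 0.
Proof.
move=> Cf; have cf := C1circle_cont _ _ Cf; case: Cf => pf df cf'.
have : (oint f')%:E = 0%E; last by case.
rewrite /oint /Rintegral fineK; last first.
  by apply: integrable_fin_num => //; exact: continuous_integrable.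
rewrite (@continuous_FTC2 _ _ f 0 (2 * pi) twopi_gt0).
- by rewrite -(add0r (2 * pi)) pf subee.
- exact: continuous_within.
- split=> [y _| |]; first by have [] := df y.
    exact/cvg_at_right_filter/cf.
  exact/cvg_at_left_filter/cf.
- by move=> y _; rewrite derive1E; have [_ ->] := df y.
Qed.

Lemma le_oint f g : continuous f -> continuous g -> (forall y, f y <= g y) ->
  oint f <= oint g.
Proof.
by move=> cf cg fg; rewrite /oint le_Rintegral//; exact: continuous_integrable.
Qed.

(** Complex-valued functions are handled as pairs of real functions, indexed by
    the booleans, true being the real part; the real part of the inner product of
    two functions is then [oint2] of their product. *)
Definition oint2 F : R := oint (F true) + oint (F false).
Definition cont2 F : Prop := forall b, continuous (F b).

(** A linear combination of pairs of functions is kept as a list, so that its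
    integral is computed in one step whatever its length. *)
Fixpoint lincomb (s : seq (R * (bool -> R -> R))) (b : bool) y : R :=
  if s is (a, F) :: s' then a * F b y + lincomb s' b y else 0.

Fixpoint oint2_lincomb (s : seq (R * (bool -> R -> R))) : R :=
  if s is (a, F) :: s' then a * oint2 F + oint2_lincomb s' else 0.

Fixpoint cont2s (s : seq (R * (bool -> R -> R))) : Prop :=
  if s is (_, F) :: s' then cont2 F /\ cont2s s' else True.

Lemma cont2_lincomb s : cont2s s -> cont2 (lincomb s).
Proof.
elim: s => [_ b|[a F] s IH [cF cs] b] /=; first exact: continuous_const.
apply: continuous_add; last exact: IH.
by apply: continuous_mul; [exact: continuous_const | exact: cF].
Qed.

Lemma oint2_lincombE s : cont2s s -> oint2 (lincomb s) = oint2_lincomb s.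
Proof.
elim: s => [_|[a F] s IH [cF cs]] /=.
  by rewrite /oint2 /oint /Rintegral integral0 addr0.
have cl := cont2_lincomb _ cs; rewrite -(IH cs) /oint2 !ointD//; last first.
- by apply: continuous_mul; [exact: continuous_const | exact: cF].
- by apply: continuous_mul; [exact: continuous_const | exact: cF].
by rewrite !ointZ// mulrDr addrACA.
Qed.

(** All integral identities and estimates below rest on this lemma: they hold
    pointwise up to the derivative of a periodic function, which integrates to
    zero and records the integrations by parts. *)
Lemma oint2_le P p F s : (forall b, C1circle (P b) (p b)) -> cont2 F -> cont2s s ->
  (forall y, F true y + F false y <=
     lincomb s true y + lincomb s false y + (p true y + p false y)) ->
  oint2 F <= oint2_lincomb s.
Proof.
move=> CP cF cs h; have cl := cont2_lincomb _ cs.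
have cp b : continuous (p b) := C1circle_deriv _ _ (CP b).
rewrite -oint2_lincombE// -[leRHS]addr0 -[X in _ + X](addr0 0).
rewrite -[X in _ + (X + _)](oint_deriv _ _ (CP true)).
rewrite -[X in _ + (_ + X)](oint_deriv _ _ (CP false)).
have c1 := continuous_add _ _ (cl true) (cl false).
have c2 := continuous_add _ _ (cp true) (cp false).
rewrite /oint2 -(ointD _ _ (cF true) (cF false)).
rewrite -(ointD _ _ (cl true) (cl false)) -(ointD _ _ (cp true) (cp false)).
rewrite -(ointD _ _ c1 c2).
by apply: le_oint => //; exact: continuous_add.
Qed.

Lemma oint2_eq P p F s : (forall b, C1circle (P b) (p b)) -> cont2 F -> cont2s s ->
  (forall y, F true y + F false y =
     lincomb s true y + lincomb s false y + (p true y + p false y)) ->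
  oint2 F = oint2_lincomb s.
Proof.
move=> CP cF cs h; apply/eqP; rewrite eq_le (oint2_le P p)//=; last first.
  by move=> y; rewrite h.
have := oint2_le (fun b y => - P b y) (fun b y => - p b y) (lincomb s) [:: (1, F)].
move=> /(_ (fun b => C1circleN _ _ (CP b)) (cont2_lincomb _ cs)) /=.
rewrite oint2_lincombE// addr0 mul1r => h1; apply: h1; first by split.
move=> y; move: (h y) => {}h /=; rewrite !mul1r !addr0 h; lra.
Qed.

Let C1zero (b : bool) : C1circle (fun=> 0 : R) (fun=> 0).
Proof. exact: C1circle_cst. Qed.

Lemma oint2_le_lincomb F s : cont2 F -> cont2s s ->
  (forall y, F true y + F false y <= lincomb s true y + lincomb s false y) ->
  oint2 F <= oint2_lincomb s.
Proof.
by move=> cF cs h; apply: (oint2_le _ _ _ _ C1zero) => // y; rewrite !addr0.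
Qed.

Lemma oint2_eq_lincomb F s : cont2 F -> cont2s s ->
  (forall b y, F b y = lincomb s b y) -> oint2 F = oint2_lincomb s.
Proof.
by move=> cF cs h; apply: (oint2_eq _ _ _ _ C1zero) => // y; rewrite !addr0 !h.
Qed.

Lemma oint2_ge0 F : (forall b y, 0 <= F b y) -> 0 <= oint2 F.
Proof. by move=> F0; apply: addr_ge0; apply: Rintegral_ge0 => y _. Qed.

Lemma oint2Z a F : cont2 F -> oint2 (fun b y => a * F b y) = a * oint2 F.
Proof.
move=> cF; rewrite (_ : a * _ = oint2_lincomb [:: (a, F)]); last by rewrite /= addr0.
apply: oint2_eq_lincomb => //.
  by move=> b; apply: continuous_mul => //; exact: continuous_const.
by move=> b y /=; rewrite addr0.
Qed.

Lemma oint2_swap F : oint2 (fun b => F (~~ b)) = oint2 F.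
Proof. by rewrite /oint2 addrC. Qed.

Definition sqnorm F := oint2 (fun b y => F b y ^+ 2).

Lemma sqnorm_ge0 F : 0 <= sqnorm F.
Proof. by apply: oint2_ge0 => b y; exact: sqr_ge0. Qed.

(** Multiplication by the imaginary unit sends the pair (x, y) to (- y, x): it
    swaps the two components, up to this sign. *)
Definition sg (b : bool) : R := if b then 1 else -1.

Lemma sg_le1 b : `|sg b| <= 1.
Proof. by case: b; rewrite /sg ?normrN normr1. Qed.

End integrals.

(** The tactics below follow the syntax of the function; the unknown derivative
    of [by_parts] is found by [prove_C1]. *)
Ltac prove_continuous :=
  lazymatch goal with
  | H : continuous ?f |- continuous ?f => exact: H
  | |- continuous (fun=> ?a) => exact: (continuous_const a)
  | |- continuous (fun y => @?f y + @?g y) =>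
      apply: (continuous_add f g); prove_continuous
  | |- continuous (fun y => @?f y * @?g y) =>
      apply: (continuous_mul f g); prove_continuous
  | |- continuous (fun y => - @?f y) => apply: (continuous_opp f); prove_continuous
  | |- continuous (fun y => @?f y ^+ ?n) =>
      apply: (continuous_expn n f); prove_continuous
  | |- continuous (fun y => (@?f y)^-1) =>
      apply: (continuous_inv f); [prove_continuous | prove_continuous]
  | H : cont2 ?f |- continuous (fun y => ?f ?b y) => exact: (H b)
  | H : cont2 ?f |- continuous (?f ?b) => exact: (H b)
  | H : continuous ?f |- continuous (fun y => ?f y) => exact: H
  | H : continuous ?f |- continuous ?f => exact: H
  | |- _ => done
  end.

Ltac prove_cont2 :=
  rewrite /=;
  repeat match goal with |- _ /\ _ => split | |- True => exact: Logic.I end;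
  (let b := fresh "b" in move=> b /=; prove_continuous).

Ltac prove_C1 :=
  lazymatch goal with
  | |- C1circle (fun=> ?a) _ => exact: (C1circle_cst a)
  | |- C1circle (fun y => @?f y + @?g y) _ => apply: (C1circleD f _ g); prove_C1
  | |- C1circle (fun y => @?f y * @?g y) _ => apply: (C1circleM f _ g); prove_C1
  | |- C1circle (fun y => - @?f y) _ => apply: (C1circleN f); prove_C1
  | |- C1circle (fun y => (@?f y)^-1) _ => apply: (C1circleV f); prove_C1
  | H : forall b : bool, C1circle (?f b) _ |- C1circle (fun y => ?f ?b y) _ => exact: (H b)
  | H : forall b : bool, C1circle (?f b) _ |- C1circle (?f ?b) _ => exact: (H b)
  | H : C1circle ?f _ |- C1circle (fun y => ?f y) _ => exact: H
  | H : C1circle ?f _ |- C1circle ?f _ => exact: H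
  | |- _ => done
  end.

Ltac by_parts P :=
  unshelve eapply (oint2_eq P);
  [ shelve | by move=> b; prove_C1 | prove_cont2 | prove_cont2 | move=> y /= ].

Ltac by_parts_le P :=
  unshelve eapply (oint2_le P);
  [ shelve | by move=> b; prove_C1 | prove_cont2 | prove_cont2 | move=> y /= ].

(** * Pointwise inequalities *)

Section young.
Local Open Scope classical_set_scope.
Context {R : realType}.
Implicit Types (m F G : bool -> R -> R) (M s : R).

Lemma young s (a b : R) : 0 < s -> 2 * (a * b) <= s * a ^+ 2 + s^-1 * b ^+ 2.
Proof.
move=> s0; have si : 0 < s^-1 by rewrite invr_gt0.
have ss : s * s^-1 = 1 by rewrite divff// gt_eqF.
have : 0 <= s^-1 * (s * a - b) ^+ 2 by rewrite mulr_ge0// ?sqr_ge0// ltW.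
rewrite (_ : s^-1 * _ = s * (s * s^-1) * a ^+ 2 - 2 * (s * s^-1) * (a * b)
  + s^-1 * b ^+ 2); last by ring.
rewrite ss; lra.
Qed.

Lemma young_norm (m : R) M s (a b : R) : 0 < s -> `|m| <= M ->
  2 * (m * a * b) <= M * s * a ^+ 2 + M * s^-1 * b ^+ 2.
Proof.
move=> s0 mM.
have M0 : 0 <= M by apply: le_trans mM.
have h : m * a * b <= M * (`|a| * `|b|).
  by rewrite -mulrA (le_trans (ler_norm _))// !normrM ler_wpM2r// mulr_ge0.
have := ler_wpM2l M0 (young s `|a| `|b| s0); rewrite !real_normK ?num_real//.
lra.
Qed.

Lemma oint2_young m F G M s : cont2 m -> cont2 F -> cont2 G ->
  0 < s -> (forall b y, `|m b y| <= M) ->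
  `|oint2 (fun b y => m b y * F b y * G b y)| <=
    M / 2 * (s * oint2 (fun b y => F b y ^+ 2) + s^-1 * oint2 (fun b y => G b y ^+ 2)).
Proof.
move=> cm cF cG s0 mM.
pose l := [:: (M / 2 * s, fun b y => F b y ^+ 2); (M / 2 * s^-1, fun b y => G b y ^+ 2)].
have -> : M / 2 * (s * oint2 (fun b y => F b y ^+ 2)
    + s^-1 * oint2 (fun b y => G b y ^+ 2)) = oint2_lincomb l.
  by rewrite /=; ring.
have cl : cont2s l by rewrite /l; prove_cont2.
rewrite ler_norml; apply/andP; split; last first.
  apply: oint2_le_lincomb => //; first by prove_cont2.
  move=> y /=.
  have := young_norm _ _ _ (F true y) (G true y) s0 (mM true y).
  have := young_norm _ _ _ (F false y) (G false y) s0 (mM false y).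
  lra.
rewrite lerNl.
have -> : - oint2 (fun b y => m b y * F b y * G b y) =
          oint2 (fun b y => - m b y * F b y * G b y).
  rewrite (@oint2_eq_lincomb R (fun b y => - m b y * F b y * G b y)
    [:: (-1, fun b y => m b y * F b y * G b y)]) /=.
  - by ring.
  - by prove_cont2.
  - by prove_cont2.
  - by move=> b y; ring.
apply: oint2_le_lincomb => //; first by prove_cont2.
move=> y /=; have mN b : `|- m b y| <= M by rewrite normrN.
have := young_norm _ _ _ (F true y) (G true y) s0 (mN true).
have := young_norm _ _ _ (F false y) (G false y) s0 (mN false).
lra.
Qed.

(** The function phi / (phi^2 + r^2) replaces 1 / phi near the zeros of phi, at
    scale r; the first quantity is r^2 times it, and the second is minus its
    derivative in phi, multiplied by phi^2 + r^2. *)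
Lemma regularised_inverse_bounds (r phi : R) : 0 < r ->
  [/\ `|r ^+ 2 * phi / (phi ^+ 2 + r ^+ 2)| <= r / 2,
      `|(phi ^+ 2 - r ^+ 2) / (phi ^+ 2 + r ^+ 2)| <= 1 &
      `|phi / (phi ^+ 2 + r ^+ 2)| <= (2 * r)^-1].
Proof.
move=> r0; have h0 : 0 < phi ^+ 2 + r ^+ 2.
  by rewrite ltr_wpDl ?sqr_ge0// exprn_gt0.
have p0 := normr_ge0 phi; have p2 : phi ^+ 2 = `|phi| ^+ 2 by rewrite real_normK ?num_real.
split.
- rewrite normrM normfV (gtr0_norm h0) ler_pdivrMr// normrM (ger0_norm (sqr_ge0 r)) p2.
  have : 0 <= r / 2 * (`|phi| - r) ^+ 2 by rewrite mulr_ge0 ?sqr_ge0// divr_ge0// ltW.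
  lra.
- rewrite normrM normfV (gtr0_norm h0) ler_pdivrMr// mul1r ler_norml.
  by have := sqr_ge0 phi; have := sqr_ge0 r; lra.
- rewrite normrM normfV (gtr0_norm h0) ler_pdivrMr// mulrC ler_pdivlMr ?mulr_gt0// p2.
  by have := sqr_ge0 (`|phi| - r); lra.
Qed.

(** The left side is of order one only where phi is comparable to r.  It is
    bounded by a difference of two smooth cut-offs at the scales r / 2 and r, so
    that the sum over dyadic scales telescopes. *)
Lemma dyadic_layer (r phi : R) : 0 < r ->
  r ^+ 2 * phi ^+ 2 / (phi ^+ 2 + r ^+ 2) ^+ 2 <=
  2 * (phi ^+ 2 / (phi ^+ 2 + (r / 2) ^+ 2) - phi ^+ 2 / (phi ^+ 2 + r ^+ 2)).
Proof.
move=> r0; have q0 : 0 < r ^+ 2 by rewrite exprn_gt0.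
have p0 := sqr_ge0 phi; rewrite expr_div_n.
set x := phi ^+ 2 in p0 *; set q := r ^+ 2 in q0 *.
have h1 : 0 < x + q by lra.
have h2 : 0 < x + q / 2 ^+ 2 by lra.
rewrite -subr_ge0 (_ : _ - _ = x * q * (2 * x + 5 * q) / 4 / ((x + q) ^+ 2 * (x + q / 2 ^+ 2))).
  apply: divr_ge0; last by apply: mulr_ge0; [exact: sqr_ge0 | exact: ltW].
  by apply: divr_ge0 => //; apply: mulr_ge0; [apply: mulr_ge0 => //; exact: ltW | lra].
have h3 : 0 < x * 4 + q by lra.
by field; rewrite !gt_eqF.
Qed.

(** The expansion of the square (u' - c b u)^2, for b = phi / (phi^2 + q) the
    regularised inverse of phi = s - l and c = s', with l u replaced by
    phi v - G where this helps.  The group that starts with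
    u1 ^+ 2 + u * u2 is the derivative of u u' - b c u^2. *)
Lemma howard_pointwise (c s l k v u u1 u2 q : R) :
  let phi := s - l in let h := phi ^+ 2 + q in let G := phi * v - l * u in
  h != 0 ->
  2 * (q * phi ^+ 2 / h ^+ 2 * (c * v) ^+ 2) + 2 * (c ^+ 2 * q / h ^+ 2 * G ^+ 2)
  + l * (q * phi / h * v ^+ 2 + (phi ^+ 2 - q) / h * v * G - phi / h * G ^+ 2)
  + l ^+ 2 * (u1 ^+ 2 + u * u2 - (- s * (phi / h) * u ^+ 2
     + c * (c * (q - phi ^+ 2) / h ^+ 2) * u ^+ 2 + 2 * (c * (phi / h) * (u * u1))))
  - l ^+ 2 * k * u ^+ 2 =
  l ^+ 2 * (u1 - c * (phi / h) * u) ^+ 2 + (l * phi * u) ^+ 2 / h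
  + c ^+ 2 * q / h ^+ 2 * (phi * v + G) ^+ 2 + l ^+ 2 * ((v - k * u + u2) * u).
Proof. by move=> phi h G h0; rewrite /G /h /phi; field. Qed.

(** The regularised terms that contain G or a power of r are estimated, and the
    layer term, in which c v is not small, is turned into a difference of
    cut-offs. *)
Lemma howard_bound (c s l k v u u1 u2 r M t : R) :
  let phi := s - l in let h := phi ^+ 2 + r ^+ 2 in let G := phi * v - l * u in
  0 < r -> 0 < t -> 0 <= l -> c ^+ 2 * r ^+ 2 / h ^+ 2 <= M ->
  (v - k * u + u2) * u = 0 ->
  l ^+ 2 * k * u ^+ 2 <=
  4 * (phi ^+ 2 / (phi ^+ 2 + (r / 2) ^+ 2) * (c * v) ^+ 2)
  - 4 * (phi ^+ 2 / h * (c * v) ^+ 2)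
  + (2 * M + l * ((2 * r)^-1 + t / 2)) * G ^+ 2 + l * (r / 2 + t^-1 / 2) * v ^+ 2
  + l ^+ 2 * (u1 ^+ 2 + u * u2 - (- s * (phi / h) * u ^+ 2
     + c * (c * (r ^+ 2 - phi ^+ 2) / h ^+ 2) * u ^+ 2 + 2 * (c * (phi / h) * (u * u1)))).
Proof.
move=> phi h G r0 t0 l0 hM rel.
have q0 : 0 < r ^+ 2 by rewrite exprn_gt0.
have h0 : 0 < h by rewrite ltr_wpDl ?sqr_ge0.
have := howard_pointwise c s l k v u u1 u2 (r ^+ 2) (lt0r_neq0 h0).
rewrite rel mulr0 addr0 -/phi -/h -/G.
have sos : 0 <= l ^+ 2 * (u1 - c * (phi / h) * u) ^+ 2 + (l * phi * u) ^+ 2 / h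
  + c ^+ 2 * r ^+ 2 / h ^+ 2 * (phi * v + G) ^+ 2.
  apply: addr_ge0; first apply: addr_ge0.
  - by apply: mulr_ge0; exact: sqr_ge0.
  - by apply: divr_ge0; [exact: sqr_ge0 | exact: ltW].
  - apply: mulr_ge0; last exact: sqr_ge0.
    by apply: divr_ge0; [apply: mulr_ge0; exact: sqr_ge0 | exact: sqr_ge0].
have a1 := ler_wpM2r (sqr_ge0 (c * v)) (dyadic_layer r phi r0).
have a2 := ler_wpM2r (sqr_ge0 G) hM.
have [b1 b2 b3] := regularised_inverse_bounds r phi r0.
have a3 : r ^+ 2 * phi / h * v ^+ 2 <= r / 2 * v ^+ 2.
  by rewrite ler_wpM2r ?sqr_ge0//; exact: le_trans (ler_norm _) b1.
have a4 := young_norm _ _ _ G v t0 b2.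
have a5 : - (phi / h) * G ^+ 2 <= (2 * r)^-1 * G ^+ 2.
  by rewrite ler_wpM2r ?sqr_ge0//; apply: le_trans (ler_norm _) _; rewrite normrN.
have a6 : l * (r ^+ 2 * phi / h * v ^+ 2 + (phi ^+ 2 - r ^+ 2) / h * v * G
    - phi / h * G ^+ 2) <=
  l * (r / 2 * v ^+ 2 + (t * G ^+ 2 + t^-1 * v ^+ 2) / 2 + (2 * r)^-1 * G ^+ 2).
  rewrite ler_wpM2l//; move: a3 a4 a5; rewrite -/h; lra.
move: a1 a2 a6 sos; rewrite -/h; lra.
Qed.

End young.

(** * Scalar inequalities *)

Section scalars.
Context {R : realFieldType}.
Implicit Types (L e d V B X Y Z D m : R).

(** Here and below e is the fourth root of the viscosity, and V, B, X, Y, Z are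
    the squared norms of v, v', C v, the inviscid residual and C v'.  When D is
    at most of order e^2, so is X / V.  The uncertainty inequality, used with t
    of order e^-2, then bounds V by 3/4 V. *)
Lemma concentrated_absurd L e V B X D m : 1 <= L -> 0 < e -> 32 * L ^+ 2 * e ^+ 2 <= 1 ->
  0 < V -> 0 <= X -> D <= L ^+ 2 * e ^+ 2 -> X <= 2 * (D * V - m) ->
  - m <= e ^+ 2 * V / (64 * L ^+ 2) -> e ^+ 2 * B <= V / (64 * L ^+ 2) ->
  (forall t, 0 < t -> V <= (2 + t) * X + t^-1 * B) -> False.
Proof.
move=> L1 e0 small V0 X0 hD hX hm hB unc.
have q0 : 0 < e ^+ 2 by rewrite exprn_gt0.
have a1 : 1 <= L ^+ 2 by rewrite exprn_ege1.
move: small hD hm hB hX; set q := e ^+ 2 in q0 *; set a := L ^+ 2 in a1 *.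
move=> small hD hm hB hX.
have a0 : 0 < a by lra.
have aq0 : 0 < a * q by rewrite mulr_gt0.
(* the choice of t that makes both t X and B / t at most V / 4 *)
have t0 : 0 < (16 * a * q)^-1 by rewrite invr_gt0 -mulrA; lra.
have := unc _ t0; rewrite invrK.
have X4 : X <= 4 * a * q * V.
  have h1 : D * V <= a * q * V by rewrite ler_wpM2r// ltW.
  have h2 : q * V / (64 * a) <= q * V * a.
    rewrite ler_pdivrMr; last by rewrite mulr_gt0.
    have qV : 0 <= q * V by rewrite mulr_ge0 ?ltW.
    have a2 : 1 <= a * (64 * a) by nra.
    by have := ler_wpM2l qV a2; lra.
  lra.
have tX : (16 * a * q)^-1 * X <= V / 4.
  by rewrite ler_pdivrMl ?mulr_gt0//; lra.
have tB : 16 * a * q * B <= V / 4.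
  have : 16 * a * (q * B) <= 16 * a * (V / (64 * a)).
    by rewrite ler_wpM2l// mulr_ge0// ltW.
  by rewrite (_ : 16 * a * (V / (64 * a)) = V / 4); [lra | field; rewrite gt_eqF].
have aqV : 32 * a * q * V <= 1 * V by rewrite ler_wpM2r// ltW.
lra.
Qed.

(** The case where d = sqrt (1 - lam) is at least L e.  Each lemma gathers the
    error terms of one integral estimate; powers of e / d are turned into powers
    of 1 / L. *)
Section interior.
Variables (L e d V : R).
Hypotheses (L1 : 1 <= L) (e0 : 0 < e) (d0 : 0 < d) (d1 : d <= 1) (Led : L * e <= d) (V0 : 0 < V).

Let L0 : 0 < L. Proof. exact: lt_le_trans L1. Qed.
Let ed : e <= d / L. Proof. by rewrite ler_pdivlMr// mulrC. Qed.
Let ed1 : e <= d.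
Proof. by apply: le_trans Led; rewrite ler_peMl// ltW. Qed.
Let Li1 : L^-1 <= 1. Proof. by rewrite invf_le1. Qed.
Let Li0 : 0 < L^-1. Proof. by rewrite invr_gt0. Qed.
(** The order of magnitude of the squared norm of the inviscid residual. *)
Let pw := e ^+ 3 * d * V / L.
Let e3 : 0 < e ^+ 3. Proof. by rewrite exprn_gt0. Qed.
Let e2 : 0 < e ^+ 2. Proof. by rewrite exprn_gt0. Qed.
Let e4 : 0 < e ^+ 4. Proof. by rewrite exprn_gt0. Qed.
Let d2 : 0 < d ^+ 2. Proof. by rewrite exprn_gt0. Qed.

Let e4V : e ^+ 4 * V <= pw.
Proof.
have := ler_wpM2l (ltW (mulr_gt0 e3 V0)) ed.
by rewrite /pw (_ : e ^+ 3 * V * e = e ^+ 4 * V); [lra | ring].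
Qed.

Let pw_le : pw <= e ^+ 2 * d ^+ 2 * V.
Proof.
rewrite /pw; have h : e ^+ 3 * d * V * L^-1 <= e ^+ 3 * d * V * 1.
  by rewrite ler_wpM2l// !mulr_ge0// ltW.
apply: (le_trans h); rewrite mulr1.
rewrite (_ : e ^+ 3 * d * V = e * (e ^+ 2 * d * V)); last by ring.
rewrite (_ : e ^+ 2 * d ^+ 2 * V = d * (e ^+ 2 * d * V)); last by ring.
by rewrite ler_wpM2r// !mulr_ge0// ltW.
Qed.

Let pw_le4 : pw <= d ^+ 4 * V / L ^+ 4.
Proof.
have h : e ^+ 3 <= (d / L) ^+ 3 by rewrite lerXn2r// ?nnegrE ltW// divr_gt0.
have := ler_wpM2r (ltW (divr_gt0 (mulr_gt0 d0 V0) L0)) h.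
by rewrite /pw (_ : (d / L) ^+ 3 * (d * V / L) = d ^+ 4 * V / L ^+ 4);
  [lra | field; rewrite gt_eqF].
Qed.

(** The weights 8 L e d and its inverse balance the bound 4 d^2 V on X against
    the bound on B, and give a total of order pw. *)
Lemma cross_small X B : X <= 4 * d ^+ 2 * V -> e ^+ 2 * B <= V / (64 * L ^+ 2) ->
  e ^+ 4 * ((8 * L * e * d)^-1 * X + (8 * L * e * d) * B) <= 5 / 8 * pw.
Proof.
move=> hX hB.
have s0 : 0 < e ^+ 4 / (8 * L * e * d) by rewrite divr_gt0// !mulr_gt0.
have f1 := ler_wpM2l (ltW s0) hX.
have r0 : 0 < 8 * L * e ^+ 3 * d by rewrite !mulr_gt0.
have f2 := ler_wpM2l (ltW r0) hB.
have E1 : e ^+ 4 / (8 * L * e * d) * (4 * d ^+ 2 * V) = pw / 2.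
  by rewrite /pw; field; rewrite !gt_eqF.
have E2 : 8 * L * e ^+ 3 * d * (V / (64 * L ^+ 2)) = pw / 8.
  by rewrite /pw; field; rewrite !gt_eqF.
rewrite E1 in f1; rewrite E2 in f2; lra.
Qed.

Let tiny N : N <= e ^+ 4 * V / (64 * L ^+ 2) ^+ 2 -> N <= e ^+ 4 * V.
Proof.
move=> h; apply: (le_trans h); rewrite ler_pdivrMr; last first.
  by rewrite exprn_gt0// mulr_gt0// exprn_gt0.
rewrite -[leLHS]mulr1 ler_wpM2l ?mulr_ge0 ?ltW//.
have := exprn_ege1 2 L1; have := exprn_ege1 2 (exprn_ege1 2 L1).
rewrite exprMn; nra.
Qed.

Lemma inviscid_small X B Y N U2 : X <= 4 * d ^+ 2 * V -> e ^+ 2 * B <= V / (64 * L ^+ 2) ->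
  N <= e ^+ 4 * V / (64 * L ^+ 2) ^+ 2 -> U2 <= V ->
  Y <= N + e ^+ 4 * ((8 * L * e * d)^-1 * X + (8 * L * e * d) * B) + 3 * e ^+ 4 * (V + U2) ->
  Y <= 8 * pw.
Proof.
move=> hX hB /tiny hN hU hY; have := cross_small _ _ hX hB.
have hU4 := ler_wpM2l (ltW e4) hU.
have := e4V; have := mulr_gt0 e4 V0; lra.
Qed.

(** The weight 1 - S controls C^2 and splits into d^2 and lam - S, so a bound on
    Q, the integral of (S - lam) |v'|^2, yields one on Z. *)
Lemma velocity_small X B Y N U2 lamU1 Q Z :
  X <= 4 * d ^+ 2 * V -> e ^+ 2 * B <= V / (64 * L ^+ 2) ->
  N <= e ^+ 4 * V / (64 * L ^+ 2) ^+ 2 -> U2 <= V -> lamU1 <= 2 * V -> Y <= 8 * pw ->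
  e ^+ 4 * `|Q| <= 2^-1 * ((d / e) ^+ 2 * N + (e / d) ^+ 2 * Y)
    + e ^+ 4 * (2^-1 * ((8 * L * e * d)^-1 * X + (8 * L * e * d) * B) + 2 * (V + U2) + lamU1) ->
  Z <= 2 * (d ^+ 2 * B - Q) -> e ^+ 2 * Z <= 24 * d ^+ 2 * V.
Proof.
move=> hX hB /tiny hN hU hU1 hY hQ hZ; have hc := cross_small _ _ hX hB.
have hU4 := ler_wpM2l (ltW e4) hU; have hU14 := ler_wpM2l (ltW e4) hU1.
have e4d : e ^+ 4 * V <= e ^+ 2 * d ^+ 2 * V by apply: (le_trans e4V pw_le).
have w2 : 0 < (d / e) ^+ 2 by rewrite exprn_gt0// divr_gt0.
have w3 : 0 < (e / d) ^+ 2 by rewrite exprn_gt0// divr_gt0.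
have f1 := ler_wpM2l (ltW w2) hN.
have f2 := ler_wpM2l (ltW w3) (le_trans hY (ler_wpM2l (ler0n _ 8) pw_le)).
have E1 : (d / e) ^+ 2 * (e ^+ 4 * V) = e ^+ 2 * d ^+ 2 * V by field; rewrite gt_eqF.
have E2 : (e / d) ^+ 2 * (8 * (e ^+ 2 * d ^+ 2 * V)) = 8 * (e ^+ 4 * V) by field; rewrite gt_eqF.
rewrite E1 in f1; rewrite E2 in f2.
have pl := pw_le; have W0 := mulr_gt0 (mulr_gt0 e2 d2) V0.
have hQ' : e ^+ 2 * (e ^+ 2 * `|Q|) <= e ^+ 2 * (11 * d ^+ 2 * V) by lra.
rewrite ler_pM2l// in hQ'.
have hZ' := ler_wpM2l (ltW e2) hZ.
have hQ2 : e ^+ 2 * - Q <= e ^+ 2 * `|Q| by rewrite ler_pM2l// -normrN ler_norm.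
have hB2 : e ^+ 2 * B <= V.
  apply: (le_trans hB); rewrite ler_pdivrMr; last by rewrite mulr_gt0// exprn_gt0.
  by have := ler_wpM2l (ltW V0) (exprn_ege1 2 L1); have := V0; lra.
have hB3 := ler_wpM2l (ltW d2) hB2.
lra.
Qed.

(** Of the terms on the right of the virial bound only the last is not an error;
    the others add up to at most 46.5 d^2 V / L. *)
Lemma virial_small lam k Y Z m U0 : 0 <= lam <= 1 -> d ^+ 2 = 1 - lam ->
  Y <= 8 * pw -> e ^+ 2 * Z <= 24 * d ^+ 2 * V -> m <= e ^+ 2 * V / (64 * L ^+ 2) ->
  (1 - lam ^+ 2) * V <= 2^-1 * ((L / d) ^+ 2 * Y + (d / L) ^+ 2 * V)
    + (d / e ^+ 3 * Y + e ^+ 3 / d * Z) + Y + 2 * lam * m + lam * (2 * k + 2^-1) * U0 ->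
  d ^+ 2 * V <= 47 / L * (d ^+ 2 * V) + lam * (2 * k + 2^-1) * U0.
Proof.
move=> /andP[l0 l1] hd hY hZ hm h.
set T := d ^+ 2 * V / L.
have T0 : 0 < T by rewrite /T divr_gt0// mulr_gt0.
have Li2 : (L ^+ 2)^-1 <= L^-1.
  by rewrite lef_pV2 ?posrE ?exprn_gt0// expr2 ler_peMl// ltW.
have g1 : (L / d) ^+ 2 * Y <= 8 * T.
  have w0 : 0 < (L / d) ^+ 2 by rewrite exprn_gt0// divr_gt0.
  have := ler_wpM2l (ltW w0) (le_trans hY (ler_wpM2l (ler0n _ 8) pw_le4)).
  rewrite (_ : (L / d) ^+ 2 * (8 * (d ^+ 4 * V / L ^+ 4)) = 8 * (d ^+ 2 * V * (L ^+ 2)^-1));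
    last by field; rewrite !gt_eqF.
  have := ler_wpM2l (ltW (mulr_gt0 d2 V0)) Li2; rewrite -/T; lra.
have g2 : (d / L) ^+ 2 * V <= T.
  rewrite (_ : _ * _ = d ^+ 2 * V * (L ^+ 2)^-1); last by field; rewrite gt_eqF.
  by rewrite /T; exact: (ler_wpM2l (ltW (mulr_gt0 d2 V0)) Li2).
have g3 : d / e ^+ 3 * Y <= 8 * T.
  have := ler_wpM2l (ltW (divr_gt0 d0 e3)) hY.
  by rewrite (_ : d / e ^+ 3 * (8 * pw) = 8 * T)// /T /pw; field; rewrite !gt_eqF.
have g4 : e ^+ 3 / d * Z <= 24 * T.
  have := ler_wpM2l (ltW (divr_gt0 e0 d0)) hZ.
  rewrite (_ : e / d * (e ^+ 2 * Z) = e ^+ 3 / d * Z); last by field; rewrite gt_eqF.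
  rewrite (_ : e / d * (24 * d ^+ 2 * V) = 24 * (d * V * e)); last by field; rewrite gt_eqF.
  have := ler_wpM2l (ltW (mulr_gt0 d0 V0)) ed.
  rewrite (_ : d * V * (d / L) = T); last by rewrite /T; ring.
  lra.
have g5 : Y <= 8 * T.
  apply: (le_trans hY); rewrite ler_pM2l//; apply: (le_trans pw_le4).
  rewrite /T (_ : d ^+ 4 * V / L ^+ 4 = d ^+ 2 * V * (d ^+ 2 / L ^+ 4)); last by ring.
  apply: ler_wpM2l; first exact: ltW (mulr_gt0 d2 V0).
  have dd : d ^+ 2 <= 1 by rewrite exprn_ile1// ltW.
  have LL : (L ^+ 4)^-1 <= L^-1.
    by rewrite lef_pV2 ?posrE ?exprn_gt0// exprS ler_peMr ?exprn_ege1// ltW.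
  rewrite -[leRHS]mul1r; apply: ler_pM => //; first exact: ltW.
  by rewrite invr_ge0 ltW// exprn_gt0.
have g6 : lam * m <= T.
  have mT : m <= T.
    apply: (le_trans hm); rewrite /T invfM.
    have q1 : e ^+ 2 * V <= d ^+ 2 * V by rewrite ler_wpM2r ?(ltW V0)// lerXn2r// ?nnegrE ltW.
    rewrite mulrA.
    apply: ler_pM => //.
    - by rewrite !mulr_ge0 ?invr_ge0// ltW.
    - by rewrite invr_ge0 ltW// exprn_gt0.
    - by have := mulr_gt0 e2 V0; lra.
  have [m0|m0] := leP 0 m.
    by apply: le_trans mT; rewrite -[leRHS]mul1r ler_wpM2r.
  by apply: (le_trans _ (ltW T0)); rewrite mulr_ge0_le0// ltW.
have g7 : d ^+ 2 * V <= (1 - lam ^+ 2) * V by rewrite ler_wpM2r ?(ltW V0)// hd; nra.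
rewrite (_ : 47 / L * (d ^+ 2 * V) = 47 * T); last by rewrite /T; ring.
lra.
Qed.

(** Errors of the Howard bound at the scale r = sgr d^2.  The part proportional
    to r is not small with 1 / L: it is the reason why the largest scale sg0 has
    to be chosen small.  The other parts add up to 48 + 4 + 4 + 1/2 times
    d^2 V / (sg1^2 L). *)
Lemma howard_small lam sg0 sg1 sgr Y : 0 <= lam <= 1 -> d ^+ 2 = 1 - lam ->
  Y <= 8 * pw -> 0 < sg1 -> sg1 <= sgr -> sgr <= sg0 -> sg0 <= 1 -> 0 <= Y ->
  (2 * (2 * (1 - lam) / (sgr * d ^+ 2) ^+ 2 + (sgr * d ^+ 2)^-1)
    + lam * ((2 * (sgr * d ^+ 2))^-1 + (L / d) ^+ 2 / 2)) * Y
  + lam * ((sgr * d ^+ 2) / 2 + (d / L) ^+ 2 / 2) * V <=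
  (sg0 / 2 + 57 / (sg1 ^+ 2 * L)) * (d ^+ 2 * V).
Proof.
move=> /andP[l0 l1] hd hY s10 s1r sr0 s01 Y0.
have r0 : 0 < sgr by apply: lt_le_trans s1r.
have rle1 : sgr <= 1 by apply: le_trans s01.
have i1 : sgr^-1 <= sg1^-1 by rewrite lef_pV2.
have i1' : 1 <= sg1^-1 by rewrite invf_ge1//; apply: le_trans rle1.
set a := sg1^-1 in i1 i1' *; have a2 : a <= a ^+ 2 by rewrite expr2 ler_peMl//; lra.
have ir0 : 0 < sgr^-1 by rewrite invr_gt0.
have i2 : (sgr^-1) ^+ 2 <= a ^+ 2 by rewrite lerXn2r// ?nnegrE; lra.
have W0 : 0 < d ^+ 2 * V by rewrite mulr_gt0.
set W := d ^+ 2 * V in W0 *.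
have YW : Y <= 8 * (d ^+ 2 * W / L ^+ 4).
  by apply: (le_trans (le_trans hY (ler_wpM2l (ler0n _ 8) pw_le4))); rewrite /W; lra.
have L4 : (L ^+ 4)^-1 <= L^-1.
  by rewrite lef_pV2 ?posrE ?exprn_gt0// exprS ler_peMr ?exprn_ege1// ltW.
have L2 : (L ^+ 2)^-1 <= L^-1.
  by rewrite lef_pV2 ?posrE ?exprn_gt0// expr2 ler_peMl// ltW.
have YW' : d ^- 2 * Y <= 8 * (W / L).
  rewrite ler_pdivrMl//; apply: (le_trans YW).
  by have := ler_wpM2l (ltW (mulr_gt0 d2 W0)) L4; lra.
have dY0 : 0 <= d ^- 2 * Y by rewrite mulr_ge0// invr_ge0 ltW.
set y := d ^- 2 * Y in YW' dY0.
have M1 : (2 * (2 * (1 - lam) / (sgr * d ^+ 2) ^+ 2 + (sgr * d ^+ 2)^-1)) * Y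
   = (4 * sgr^-1 ^+ 2 + 2 * sgr^-1) * y.
  by rewrite -hd /y; field; rewrite !gt_eqF.
have M1' : (4 * sgr^-1 ^+ 2 + 2 * sgr^-1) * y <= (6 * a ^+ 2) * (8 * (W / L)).
  by apply: ler_pM => //; [rewrite addr_ge0// mulr_ge0// ?sqr_ge0// ltW | lra].
have M2 : (2 * (sgr * d ^+ 2))^-1 * Y = (sgr^-1 / 2) * y.
  by rewrite /y; field; rewrite !gt_eqF.
have M2' : (sgr^-1 / 2) * y <= (a ^+ 2 / 2) * (8 * (W / L)).
  by apply: ler_pM => //; [rewrite divr_ge0// ltW | lra].
have WL : 0 <= W / L by rewrite divr_ge0// ltW.
have WL2 : W / L ^+ 2 <= a ^+ 2 * (W / L).
  rewrite -[leLHS]mul1r; apply: ler_pM => //.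
  - by rewrite divr_ge0// ?(ltW W0)// exprn_ge0// ltW.
  - by rewrite exprn_ege1.
  - by rewrite ler_wpM2l// ltW.
have M3 : (L / d) ^+ 2 / 2 * Y <= 4 * (a ^+ 2 * (W / L)).
  have w0 : 0 < (L / d) ^+ 2 / 2 by rewrite divr_gt0// exprn_gt0// divr_gt0.
  apply: (le_trans (ler_wpM2l (ltW w0) YW)).
  rewrite (_ : (L / d) ^+ 2 / 2 * (8 * (d ^+ 2 * W / L ^+ 4)) = 4 * (W / L ^+ 2));
    last by field; rewrite !gt_eqF.
  by rewrite ler_pM2l.
have M4 : (sgr * d ^+ 2) / 2 * V <= sg0 / 2 * W.
  have -> : sgr * d ^+ 2 / 2 * V = sgr / 2 * W by rewrite /W; ring.
  by rewrite ler_wpM2r ?(ltW W0)//; lra.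
have M5 : (d / L) ^+ 2 / 2 * V <= 2^-1 * (a ^+ 2 * (W / L)).
  rewrite (_ : (d / L) ^+ 2 / 2 * V = 2^-1 * (W / L ^+ 2)); first by rewrite ler_pM2l// invr_gt0.
  by rewrite /W; field; rewrite gt_eqF.
have E : 57 / (sg1 ^+ 2 * L) = 57 * a ^+ 2 / L by rewrite /a; field; rewrite !gt_eqF.
rewrite E mulrDl M1.
have P1 : 0 <= (2 * (sgr * d ^+ 2))^-1 * Y + (L / d) ^+ 2 / 2 * Y.
  by rewrite addr_ge0// mulr_ge0// ?invr_ge0 ?divr_ge0 ?sqr_ge0// ?mulr_ge0// ltW.
have P2 : 0 <= (sgr * d ^+ 2) / 2 * V + (d / L) ^+ 2 / 2 * V.
  by rewrite addr_ge0// mulr_ge0 ?divr_ge0 ?sqr_ge0 ?(ltW V0)// mulr_ge0// ltW.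
have Q1 := ler_wpM2r P1 l1; have Q2 := ler_wpM2r P2 l1.
rewrite -M2 in M2'; lra.
Qed.

End interior.

(** The virial bound says that U0 is at least of order D V, the Howard bound
    averaged over n scales that it is much smaller.  When lam is small the virial
    bound alone is absurd, because U0 is at most V / k^2. *)
Lemma interior_absurd k0 k lam D V U0 L n sg0 sg1 :
  0 < k0 <= 1 -> k0 <= k -> 0 <= lam <= 1 -> D = 1 - lam -> 0 < V -> 0 < D -> 0 < L ->
  0 <= U0 -> k ^+ 2 * U0 <= V ->
  D * V <= 47 / L * (D * V) + lam * (2 * k + 2^-1) * U0 ->
  n * (lam ^+ 2 * k * U0) <= 16 * D * V + n * ((sg0 / 2 + 57 / (sg1 ^+ 2 * L)) * (D * V)) ->
  0 < n -> 94 <= L -> 128 * 50 <= n * k0 ^+ 3 -> 200 * sg0 <= k0 ^+ 3 ->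
  57 * 400 <= k0 ^+ 3 * sg1 ^+ 2 * L -> 0 < sg1 -> False.
Proof.
move=> /andP[k00 k01] hk /andP[l0 l1] hD V0 D0 L0 U00 hU hvir how n0 L94 hn hs0 hs1 s10.
have W0 : 0 < D * V by rewrite mulr_gt0.
have k_gt0 : 0 < k by lra.
have h47 : 47 / L * (D * V) <= 2^-1 * (D * V).
  by rewrite ler_pM2r// ler_pdivrMr//; move: L94; clear; lra.
have K30 : 0 < k0 ^+ 3 by rewrite exprn_gt0.
have kU : k0 * (k * U0) <= V.
  by apply: le_trans hU; rewrite expr2 -mulrA ler_wpM2r// mulr_ge0// (ltW k_gt0).
have kU0 : 0 <= k * U0 by rewrite mulr_ge0// ltW.
have half : 2^-1 * (D * V) <= lam * ((2 * k + 2^-1) * U0).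
  by move: hvir h47; clear; lra.
have cU : k0 * ((2 * k + 2^-1) * U0) <= 5 / 2 * (k * U0).
  have h1 := ler_wpM2r U00 hk.
  have h2 : k0 * (k * U0) <= k * U0 by rewrite ler_piMl.
  have h3 : k0 * U0 <= k * U0 by [].
  by move: h2 h3; clear; lra.
have [small|big] := leP lam (k0 ^+ 2 / 20).
  have c0 : 0 <= (2 * k + 2^-1) * U0.
    by rewrite mulr_ge0//; move: k_gt0; clear; lra.
  have h1 : lam * ((2 * k + 2^-1) * U0) <= k0 ^+ 2 / 20 * ((2 * k + 2^-1) * U0).
    by rewrite ler_wpM2r.
  have h2 : k0 ^+ 2 / 20 * ((2 * k + 2^-1) * U0) <= V / 8.
    by have := ler_wpM2l (ltW k00) cU; move: kU; clear; lra.
  have k2 : k0 ^+ 2 <= 1 by rewrite exprn_ile1// ltW.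
  have h3 : 19 / 20 * V <= D * V by rewrite ler_pM2r// hD; move: small k2; clear; lra.
  by move: h1 h2 h3 half V0; clear; lra.
(* For lam bounded below, the averaged bound is divided by the number of
   scales; each of its three terms is at most k0 ^+ 3 / 400. *)
have how' : lam ^+ 2 * k * U0 <= 3 / 400 * (k0 ^+ 3 * (D * V)).
  have e2 : sg0 / 2 <= k0 ^+ 3 / 400 by move: hs0; clear; lra.
  have e3 : 57 / (sg1 ^+ 2 * L) <= k0 ^+ 3 / 400.
    have p : 0 < sg1 ^+ 2 * L by rewrite mulr_gt0// exprn_gt0.
    by rewrite ler_pdivrMr//; move: hs1; clear; lra.
  have e4 : 16 <= n * (k0 ^+ 3 / 400) by move: hn; clear; lra.
  rewrite -(ler_pM2l n0); apply: (le_trans how).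
  have f1 := ler_wpM2r (ltW W0) e4.
  have f2 : n * ((sg0 / 2 + 57 / (sg1 ^+ 2 * L)) * (D * V)) <= n * (2 * (k0 ^+ 3 / 400) * (D * V)).
    by rewrite ler_pM2l// ler_pM2r//; move: e2 e3; clear; lra.
  by move: f1 f2; clear; lra.
have l_gt0 : 0 < lam by apply: le_lt_trans big; rewrite divr_ge0// sqr_ge0.
have h1 : k0 ^+ 2 * (lam * (k * U0)) <= 20 * (lam ^+ 2 * k * U0).
  have lkU : 0 <= lam * (k * U0) by rewrite mulr_ge0.
  by have := ler_wpM2r lkU (ltW big); clear; lra.
have h3 : k0 ^+ 3 * (lam * ((2 * k + 2^-1) * U0)) <= 50 * (lam ^+ 2 * k * U0).
  have k2l : 0 <= k0 ^+ 2 * lam by rewrite mulr_ge0// sqr_ge0.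
  by have := ler_wpM2l k2l cU; move: h1; clear; lra.
have h4 := ler_wpM2l (ltW K30) half.
have h5 := mulr_gt0 K30 W0.
by move: h3 h4 h5 how'; clear; lra.
Qed.

End scalars.

(** * Identities for the inviscid residual *)

(** S is the sine up to sign and C its derivative.  The relations say that
    v = k u - u'', except at points where u, u' and u'' vanish. *)
Section identities.
Local Open Scope classical_set_scope.
Context {R : realType}.
Variables (S C : R -> R) (k lam : R) (v v' u u' u'' : bool -> R -> R).
Hypothesis hS : C1circle S C.
Hypothesis hC : C1circle C (fun y => - S y).
Hypothesis SC1 : forall y, S y ^+ 2 + C y ^+ 2 = 1.
Hypothesis hv : forall b, C1circle (v b) (v' b).
Hypothesis hu : forall b, C1circle (u b) (u' b).
Hypothesis hu' : forall b, C1circle (u' b) (u'' b).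
Hypothesis rel0 : forall b b' y, (v b y - k * u b y + u'' b y) * u b' y = 0.
Hypothesis rel1 : forall b b' y, (v b y - k * u b y + u'' b y) * u' b' y = 0.
Hypothesis rel2 : forall b b' y, (v b y - k * u b y + u'' b y) * u'' b' y = 0.

Let cS : continuous S. Proof. exact: C1circle_cont hS. Qed.
Let cC : continuous C. Proof. exact: C1circle_cont hC. Qed.
Let cv : cont2 v. Proof. by move=> b; exact: C1circle_cont (hv b). Qed.
Let cv' : cont2 v'. Proof. by move=> b; exact: C1circle_deriv (hv b). Qed.
Let cu : cont2 u. Proof. by move=> b; exact: C1circle_cont (hu b). Qed.
Let cu' : cont2 u'. Proof. by move=> b; exact: C1circle_deriv (hu b). Qed.
Let cu'' : cont2 u''. Proof. by move=> b; exact: C1circle_deriv (hu' b). Qed.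

(** The advection term S v - lam w for w = v + u. *)
Definition inviscid b y := (S y - lam) * v b y - lam * u b y.
(** The inner product of u and v, by [oint2_vu]. *)
Definition energy := sqnorm u' + k * sqnorm u.

Let S2E y : S y ^+ 2 = 1 - C y ^+ 2.
Proof. by rewrite -(SC1 y) addrK. Qed.

Lemma oint2_vu : oint2 (fun b y => v b y * u b y) = energy.
Proof.
rewrite (_ : energy = oint2_lincomb [:: (1, fun b y => u' b y ^+ 2); (k, fun b y => u b y ^+ 2)]);
  last by rewrite /energy /sqnorm /=; ring.
by_parts (fun b y => - (u b y * u' b y)).
have := rel0 true true y; have := rel0 false false y; lra.
Qed.

Lemma oint2_u'v' : oint2 (fun b y => u' b y * v' b y) = k * sqnorm u' + sqnorm u''.
Proof.
rewrite (_ : _ + _ = oint2_lincomb [:: (k, fun b y => u' b y ^+ 2); (1, fun b y => u'' b y ^+ 2)]);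
  last by rewrite /sqnorm /=; ring.
by_parts (fun b y => u' b y * v b y + - k * (u b y * u' b y)).
have := rel2 true true y; have := rel2 false false y; lra.
Qed.

(** The left side is the squared norm of k u - u''; where this differs from v,
    it vanishes. *)
Lemma sqnorm_v_ge : k ^+ 2 * sqnorm u + 2 * k * sqnorm u' + sqnorm u'' <= sqnorm v.
Proof.
have -> : k ^+ 2 * sqnorm u + 2 * k * sqnorm u' + sqnorm u'' =
  oint2 (fun b y => (k * u b y - u'' b y) ^+ 2).
  symmetry.
  rewrite (_ : _ + _ = oint2_lincomb [:: (k ^+ 2, fun b y => u b y ^+ 2);
     (2 * k, fun b y => u' b y ^+ 2); (1, fun b y => u'' b y ^+ 2)]);
    last by rewrite /sqnorm /=; ring.
  by_parts (fun b y => - (2 * k) * (u b y * u' b y)); ring.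
rewrite [leRHS](_ : _ = oint2_lincomb [:: (1, fun b y => v b y ^+ 2)]);
  last by rewrite /sqnorm /=; ring.
apply: oint2_le_lincomb; [prove_cont2|prove_cont2|move=> y /=].
have := sqr_ge0 (v true y - k * u true y + u'' true y).
have := sqr_ge0 (v false y - k * u false y + u'' false y).
have := congr1 ( *%R k) (rel0 true true y); have := congr1 ( *%R k) (rel0 false false y).
have := rel2 true true y; have := rel2 false false y; lra.
Qed.

Lemma S_le1 y : `|S y| <= 1.
Proof.
rewrite -(ler_sqr (normr_nneg _) ler01)//= ?nnegrE// expr1n real_normK ?num_real//.
by have := SC1 y; have := sqr_ge0 (C y); lra.
Qed.

(** The function S C has derivative C^2 - S^2 = 2 C^2 - 1; integrating it
    against |v|^2 shows that v cannot concentrate near the zeros of C without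
    having a large derivative. *)
Lemma uncertainty (t : R) : 0 < t -> sqnorm v <=
  (2 + t) * sqnorm (fun b y => C y * v b y) + t^-1 * sqnorm v'.
Proof.
move=> t0; rewrite [leRHS](_ : _ = oint2_lincomb [:: (2 + t, fun b y => (C y * v b y) ^+ 2);
  (t^-1, fun b y => v' b y ^+ 2)]); last by rewrite /sqnorm /=; ring.
by_parts_le (fun b y => - (S y * C y * (v b y * v b y))).
have E b : S y ^+ 2 * v b y ^+ 2 = v b y ^+ 2 - C y ^+ 2 * v b y ^+ 2.
  by rewrite S2E; ring.
have := young_norm _ _ _ (C y * v true y) (v' true y) t0 (S_le1 y).
have := young_norm _ _ _ (C y * v false y) (v' false y) t0 (S_le1 y).
have := E true; have := E false; lra.
Qed.

(** C^2 = (1 - S) (1 + S) <= 2 (1 - S), and 1 - S = (1 - lam) - (S - lam). *)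
Lemma cos_weight (f : bool -> R -> R) : cont2 f ->
  sqnorm (fun b y => C y * f b y) <=
  2 * ((1 - lam) * sqnorm f - oint2 (fun b y => (S y - lam) * f b y ^+ 2)).
Proof.
move=> cf; rewrite [leRHS](_ : _ = oint2_lincomb [:: (2 * (1 - lam), fun b y => f b y ^+ 2);
  (-2, fun b y => (S y - lam) * f b y ^+ 2)]); last by rewrite /sqnorm /=; ring.
apply: oint2_le_lincomb; [prove_cont2|prove_cont2|move=> y /=].
have h b : 0 <= (1 - S y) ^+ 2 * f b y ^+ 2 by rewrite mulr_ge0 ?sqr_ge0.
have E b : S y ^+ 2 * f b y ^+ 2 = f b y ^+ 2 - C y ^+ 2 * f b y ^+ 2.
  by rewrite S2E; ring.
have := h true; have := h false; have := E true; have := E false; lra.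
Qed.

Definition inviscid' b y := C y * v b y + (S y - lam) * v' b y - lam * u' b y.

Lemma C1circle_inviscid b : C1circle (inviscid b) (inviscid' b).
Proof.
have -> : inviscid b = fun y => (S y + - lam) * v b y + - lam * u b y.
  by apply/funext => y; rewrite /inviscid; ring.
have -> : inviscid' b = fun y => (C y + 0) * v b y + (S y + - lam) * v' b y
   + (0 * u b y + - lam * u' b y).
  by apply/funext => y; rewrite /inviscid'; ring.
by apply: C1circleD; apply: C1circleM => //;
  [apply: C1circleD => //; exact: C1circle_cst | exact: C1circle_cst].
Qed.

Let cG : cont2 inviscid.
Proof. by move=> b; exact: C1circle_cont (C1circle_inviscid b). Qed.

Lemma oint2_inviscid_v : oint2 (fun b y => inviscid b y * v b y) =
  oint2 (fun b y => (S y - lam) * v b y ^+ 2) - lam * energy.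
Proof.
rewrite -oint2_vu (_ : _ - _ = oint2_lincomb [:: (1, fun b y => (S y - lam) * v b y ^+ 2);
  (- lam, fun b y => v b y * u b y)]); last by rewrite /=; ring.
apply: oint2_eq_lincomb; [prove_cont2|prove_cont2|move=> b y /=].
by rewrite /inviscid; ring.
Qed.

(** The advection operator is symmetric for the starred inner product: the
    pairings of S v and of u with v are real. *)
Lemma skew_inviscid_v : oint2 (fun b y => sg b * inviscid b y * v (~~ b) y) = 0.
Proof.
rewrite (_ : 0 = oint2_lincomb [::])//.
by_parts (fun b y => sg b * lam * (u b y * u' (~~ b) y)).
rewrite /inviscid /=; have := congr1 ( *%R lam) (rel0 true false y).
have := congr1 ( *%R lam) (rel0 false true y); lra.
Qed.

Lemma skew_w'v' : oint2 (fun b y => sg b * (v' b y + u' b y) * v' (~~ b) y) = 0.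
Proof.
rewrite (_ : 0 = oint2_lincomb [::])//.
by_parts (fun b y => sg b * (u' b y * v (~~ b) y) - sg b * k * (u' b y * u (~~ b) y)).
rewrite /=; have := rel2 true false y; have := rel2 false true y; lra.
Qed.

Let cG' : cont2 inviscid'.
Proof. by move=> b; exact: C1circle_deriv (C1circle_inviscid b). Qed.

(** Integrating by parts moves every second derivative onto u, where it is
    controlled by v.  The term in v' v' drops out since sg is antisymmetric. *)
Lemma skew_w'inviscid' : oint2 (fun b y => sg b * (v' b y + u' b y) * inviscid' (~~ b) y) =
  oint2 (fun b y => sg b * C y * v' b y * v (~~ b) y)
  - oint2 (fun b y => sg b * (S y - lam) * u'' b y * v (~~ b) y)
  + lam * oint2 (fun b y => sg b * v b y * u'' (~~ b) y).
Proof.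
rewrite (_ : _ + _ = oint2_lincomb [:: (1, fun b y => sg b * C y * v' b y * v (~~ b) y);
  (-1, fun b y => sg b * (S y - lam) * u'' b y * v (~~ b) y);
  (lam, fun b y => sg b * v b y * u'' (~~ b) y)]); last by rewrite /=; ring.
by_parts (fun b y => sg b * (S y + - lam) * (u' b y * v (~~ b) y)
  - sg b * lam * (v b y * u' (~~ b) y)).
by rewrite /inviscid' /=; ring.
Qed.

Lemma w'inviscid' : oint2 (fun b y => (v' b y + u' b y) * inviscid' b y) =
  oint2 (fun b y => (S y - lam) * v' b y ^+ 2)
  + oint2 (fun b y => C y * v' b y * v b y)
  - oint2 (fun b y => (S y - lam) * u'' b y * v b y)
  - lam * sqnorm u' + lam * oint2 (fun b y => 1 * v b y * u'' b y).
Proof.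
rewrite (_ : _ + _ = oint2_lincomb [:: (1, fun b y => (S y - lam) * v' b y ^+ 2);
  (1, fun b y => C y * v' b y * v b y);
  (-1, fun b y => (S y - lam) * u'' b y * v b y);
  (- lam, fun b y => u' b y ^+ 2);
  (lam, fun b y => 1 * v b y * u'' b y)]); last by rewrite /sqnorm /=; ring.
by_parts (fun b y => (S y + - lam) * (u' b y * v b y) - lam * (v b y * u' b y)).
by rewrite /inviscid' /=; ring.
Qed.

(** The inviscid residual paired with the field C d_y v.  The terms in u'
    produced by the multiplier cancel against those of the energy balance and of
    the equation for u tested with (S - lam) u; for this reason the only positive
    term left on the right, besides errors, is the one in |u|^2. *)
Lemma virial : (1 - lam ^+ 2) * sqnorm v =
  oint2 (fun b y => S y * inviscid b y * v b y) - 2 * oint2 (fun b y => C y * inviscid b y * v' b y)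
  + sqnorm inviscid + 2 * lam * (oint2 (fun b y => (S y - lam) * v b y ^+ 2) - lam * energy)
  - lam ^+ 2 * sqnorm u + lam * (2 * k + 2^-1) * oint2 (fun b y => S y * u b y ^+ 2).
Proof.
have -> : (1 - lam ^+ 2) * sqnorm v = oint2 (fun b y => (1 - lam ^+ 2) * v b y ^+ 2).
  symmetry; rewrite (_ : _ * _ = oint2_lincomb [:: (1 - lam ^+ 2, fun b y => v b y ^+ 2)]);
    last by rewrite /= addr0.
  by apply: oint2_eq_lincomb; [prove_cont2|prove_cont2|move=> b y /=; rewrite addr0].
rewrite (_ : _ + _ = oint2_lincomb [:: (1, fun b y => S y * inviscid b y * v b y);
  (-2, fun b y => C y * inviscid b y * v' b y); (1, fun b y => inviscid b y ^+ 2);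
  (2 * lam, fun b y => (S y - lam) * v b y ^+ 2);
  (- (2 * lam ^+ 2), fun b y => u' b y ^+ 2);
  (- (2 * lam ^+ 2) * k, fun b y => u b y ^+ 2);
  (- lam ^+ 2, fun b y => u b y ^+ 2);
  (lam * (2 * k + 2^-1), fun b y => S y * u b y ^+ 2)]); last first.
  by rewrite /energy /sqnorm /=; ring.
by_parts (fun b y => (S y + - lam) * C y * (v b y * v b y) - 2 * lam * (C y * (u b y * v b y))
  + lam * (S y * (u b y * u' b y) - 2^-1 * (C y * (u b y * u b y))
     + k * (C y * (u b y * u b y)) - C y * (u' b y * u' b y))
  - 2 * lam * ((S y + - lam) * (u b y * u' b y) - 2^-1 * (C y * (u b y * u b y)))).
have E b : S y ^+ 2 * v b y ^+ 2 = v b y ^+ 2 - C y ^+ 2 * v b y ^+ 2.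
  by rewrite S2E; ring.
have h0 b : lam * S y * ((v b y - k * u b y + u'' b y) * u b y) = 0.
  by rewrite rel0 mulr0.
have h1 b : lam * C y * ((v b y - k * u b y + u'' b y) * u' b y) = 0.
  by rewrite rel1 mulr0.
have h2 b : lam ^+ 2 * ((v b y - k * u b y + u'' b y) * u b y) = 0.
  by rewrite rel0 mulr0.
have := E true; have := E false; rewrite /inviscid.
have := h0 true; have := h0 false; have := h1 true; have := h1 false.
have := h2 true; have := h2 false; lra.
Qed.

(** * The critical layer *)

Section howard.
Variable q : R.
Hypothesis q0 : 0 < q.

Let phi y := S y + - lam.
Let den y := phi y * phi y + q.

Let den_neq0 y : den y != 0.
Proof. by rewrite gt_eqF// ltr_wpDl// -expr2 sqr_ge0. Qed.

Let Cphi : C1circle phi C.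
Proof.
have -> : C = fun y => C y + 0 by apply/funext => y; rewrite addr0.
by apply: C1circleD => //; exact: C1circle_cst.
Qed.

Let Cden : C1circle den (fun y => 2 * (phi y * C y)).
Proof.
have -> : (fun y => 2 * (phi y * C y)) = fun y => C y * phi y + phi y * C y + 0.
  by apply/funext => y; ring.
by apply: C1circleD; [exact: C1circleM | exact: C1circle_cst].
Qed.

Definition reg_inv y := (S y - lam) / ((S y - lam) ^+ 2 + q).

Lemma C1circle_reg_inv : C1circle reg_inv
  (fun y => C y * (q - (S y - lam) ^+ 2) / ((S y - lam) ^+ 2 + q) ^+ 2).
Proof.
have -> : reg_inv = fun y => phi y * (den y)^-1 by [].
have := C1circleM _ _ _ _ Cphi (C1circleV _ _ den_neq0 Cden).
congr C1circle; apply/funext => y; rewrite /den /phi.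
by field; have := den_neq0 y; rewrite /den /phi expr2.
Qed.

End howard.

(** The quotient is a smooth cut-off that removes the layer |S - lam| < r. *)
Definition outer_mass (r : R) :=
  oint2 (fun b y => (S y - lam) ^+ 2 / ((S y - lam) ^+ 2 + r ^+ 2) * (C y * v b y) ^+ 2).

(** Howard's substitution: the square of u' - C b u is integrated, for b the
    regularised inverse of S - lam.  Without regularisation, u' - C b u is
    S - lam times the derivative of u / (S - lam).  What the regularisation costs
    is the mass of C v between the scales r / 2 and r. *)
Lemma howard (r M s : R) : 0 < r -> 0 < s -> 0 <= lam ->
  (forall y, C y ^+ 2 * r ^+ 2 / ((S y - lam) ^+ 2 + r ^+ 2) ^+ 2 <= M) ->
  lam ^+ 2 * k * sqnorm u <=
   4 * (outer_mass (r / 2) - outer_mass r) +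
   (2 * M + lam * ((2 * r)^-1 + s / 2)) * sqnorm inviscid + lam * (r / 2 + s^-1 / 2) * sqnorm v.
Proof.
move=> r0 s0 lam0 hM.
have q0 : 0 < r ^+ 2 by rewrite exprn_gt0.
have q20 : 0 < (r / 2) ^+ 2 by rewrite exprn_gt0// divr_gt0.
have hreg := C1circle_reg_inv _ q0.
have cinv q : 0 < q -> continuous (fun y => ((S y - lam) ^+ 2 + q)^-1).
  move=> q_gt0; apply: continuous_inv; last by prove_continuous.
  by move=> y; rewrite gt_eqF// ltr_wpDl// sqr_ge0.
have c1 := cinv _ q0; have c2 := cinv _ q20.
rewrite [leRHS](_ : _ = oint2_lincomb [::
  (4, fun b y => (S y - lam) ^+ 2 * ((S y - lam) ^+ 2 + (r / 2) ^+ 2)^-1 * (C y * v b y) ^+ 2);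
  (-4, fun b y => (S y - lam) ^+ 2 * ((S y - lam) ^+ 2 + r ^+ 2)^-1 * (C y * v b y) ^+ 2);
  (2 * M + lam * ((2 * r)^-1 + s / 2), fun b y => inviscid b y ^+ 2);
  (lam * (r / 2 + s^-1 / 2), fun b y => v b y ^+ 2)]); last first.
  by rewrite /outer_mass /sqnorm /=; ring.
have -> : lam ^+ 2 * k * sqnorm u = oint2 (fun b y => lam ^+ 2 * k * u b y ^+ 2).
  symmetry; rewrite (_ : _ * sqnorm u = oint2_lincomb [:: (lam ^+ 2 * k, fun b y => u b y ^+ 2)]);
    last by rewrite /sqnorm /=; ring.
  by apply: oint2_eq_lincomb; [prove_cont2|prove_cont2|move=> b y /=; ring].
by_parts_le (fun b y => lam ^+ 2 * (u b y * u' b y - reg_inv (r ^+ 2) y * C y * (u b y * u b y))).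
have := howard_bound _ _ _ k (v true y) (u true y) (u' true y) (u'' true y)
  r M s r0 s0 lam0 (hM y) (rel0 true true y).
have := howard_bound _ _ _ k (v false y) (u false y) (u' false y) (u'' false y)
  r M s r0 s0 lam0 (hM y) (rel0 false false y).
rewrite /reg_inv /inviscid; lra.
Qed.

Lemma outer_mass_bounds (r : R) : 0 < r ->
  0 <= outer_mass r <= sqnorm (fun b y => C y * v b y).
Proof.
move=> r0; have q0 : 0 < r ^+ 2 by rewrite exprn_gt0.
have h y : 0 < (S y - lam) ^+ 2 + r ^+ 2 by rewrite ltr_wpDl ?sqr_ge0.
have c1 : continuous (fun y => ((S y - lam) ^+ 2 + r ^+ 2)^-1).
  by apply: continuous_inv; [move=> y; rewrite gt_eqF | prove_continuous].
apply/andP; split.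
  apply: oint2_ge0 => b y; apply: mulr_ge0; last exact: sqr_ge0.
  by apply: divr_ge0; [exact: sqr_ge0 | exact: ltW].
rewrite [leRHS](_ : _ = oint2_lincomb [:: (1, fun b y => (C y * v b y) ^+ 2)]);
  last by rewrite /sqnorm /=; ring.
apply: oint2_le_lincomb; [prove_cont2|prove_cont2|move=> y /=].
have hb b : (S y - lam) ^+ 2 / ((S y - lam) ^+ 2 + r ^+ 2) * (C y * v b y) ^+ 2
    <= (C y * v b y) ^+ 2.
  rewrite -[leRHS]mul1r ler_wpM2r ?sqr_ge0// ler_pdivrMr// mul1r.
  by rewrite lerDl ltW.
by have := hb true; have := hb false; lra.
Qed.

(** C^2 <= 2 (1 - lam) - 2 (S - lam), and the second part is absorbed by
    2 |S - lam| r <= (S - lam)^2 + r^2. *)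
Lemma critical_layer_weight (r y : R) : 0 < r -> lam <= 1 ->
  C y ^+ 2 * r ^+ 2 / ((S y - lam) ^+ 2 + r ^+ 2) ^+ 2 <=
  2 * (1 - lam) / r ^+ 2 + r^-1.
Proof.
move=> r0 lam1; have q0 : 0 < r ^+ 2 by rewrite exprn_gt0.
have [b1 _ _] := regularised_inverse_bounds r (S y - lam) r0.
set phi := S y - lam in b1 *; have p0 := sqr_ge0 phi.
have h0 : 0 < phi ^+ 2 + r ^+ 2 by lra.
have cE : C y ^+ 2 <= 2 * (1 - lam - phi).
  have := sqr_ge0 (1 - S y); have := S2E y; rewrite /phi; lra.
have i0 : 0 < (phi ^+ 2 + r ^+ 2)^-1 by rewrite invr_gt0.
have i1 : (phi ^+ 2 + r ^+ 2)^-1 <= (r ^+ 2)^-1 by rewrite lef_pV2 ?posrE//; lra.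
set i := _^-1 in b1 i0 i1 *.
rewrite (_ : _ / _ = C y ^+ 2 * (r ^+ 2 * i * i)); last first.
  by rewrite /i; field; rewrite gt_eqF.
have qi : r ^+ 2 * i <= 1 by rewrite -ler_pdivlMl// mulr1.
have w0 : 0 <= r ^+ 2 * i * i by rewrite !mulr_ge0// ltW.
apply: (le_trans (ler_wpM2r w0 cE)).
have e1 : (1 - lam) * (r ^+ 2 * i * i) <= (1 - lam) * (r ^+ 2)^-1.
  apply: ler_wpM2l; first by rewrite subr_ge0.
  by rewrite -[leRHS]mul1r; apply: ler_pM => //; [rewrite mulr_ge0// ltW | exact: ltW].
have e2 : - (r ^+ 2 * phi * i) * i <= r / 2 * (r ^+ 2)^-1.
  apply: (@le_trans _ _ (`|r ^+ 2 * phi * i| * i)).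
    by rewrite ler_wpM2r ?(ltW i0)// -normrN ler_norm.
  by apply: ler_pM => //; exact: ltW.
have e3 : r / 2 * (r ^+ 2)^-1 = r^-1 / 2 by field; rewrite gt_eqF.
move: e1 e2; rewrite e3; lra.
Qed.

(** The masses between consecutive scales add up to at most the total mass, so
    the average over n scales carries a factor 1 / n. *)
Lemma howard_scales (a b r : R) (n : nat) : 0 < r ->
  (forall j, (j < n)%N ->
    a <= 4 * (outer_mass (r / 2 ^+ j.+1) - outer_mass (r / 2 ^+ j)) + b) ->
  n%:R * a <= 4 * sqnorm (fun b y => C y * v b y) + n%:R * b.
Proof.
move=> r0 h.
suff : n%:R * a <= 4 * (outer_mass (r / 2 ^+ n) - outer_mass r) + n%:R * b.
  have p j : 0 < r / 2 ^+ j by rewrite divr_gt0// exprn_gt0.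
  have /andP[_ +] := outer_mass_bounds _ (p n).
  have /andP[+ _] := outer_mass_bounds _ r0; lra.
elim: n h => [|n IH] h; first by rewrite expr0 divr1 !mul0r subrr mulr0 addr0.
have := IH (fun j jn => h j (ltnW jn)); have := h n (ltnSn n).
by rewrite -[n.+1]addn1 natrD addn1; lra.
Qed.

Lemma cross_bound (m : bool -> R -> R) (s : R) : 0 < s -> cont2 m ->
  (forall b y, `|m b y| <= 1) ->
  `|oint2 (fun b y => m b y * C y * v' b y * v (~~ b) y)| <=
  2^-1 * (s * sqnorm (fun b y => C y * v b y) + s^-1 * sqnorm v').
Proof.
move=> s0 cm hm.
have -> : (fun b y => m b y * C y * v' b y * v (~~ b) y) =
          (fun b y => m b y * (C y * v (~~ b) y) * v' b y).
  by apply/funext => b; apply/funext => y; ring.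
have := @oint2_young R m (fun b y => C y * v (~~ b) y) v' 1 s cm.
rewrite (oint2_swap (fun b y => (C y * v b y) ^+ 2)) mul1r; apply => //.
by prove_cont2.
Qed.

Lemma virial_bound (s t : R) : 0 < s -> 0 < t -> 0 <= lam -> 0 <= k ->
  (1 - lam ^+ 2) * sqnorm v <=
  2^-1 * (s * sqnorm inviscid + s^-1 * sqnorm v)
  + (t * sqnorm inviscid + t^-1 * sqnorm (fun b y => C y * v' b y)) + sqnorm inviscid
  + 2 * lam * `|oint2 (fun b y => (S y - lam) * v b y ^+ 2) - lam * energy|
  + lam * (2 * k + 2^-1) * sqnorm u.
Proof.
move=> s0 t0 l0 k0; rewrite virial.
have b1 : oint2 (fun b y => S y * inviscid b y * v b y) <=
    2^-1 * (s * sqnorm inviscid + s^-1 * sqnorm v).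
  apply: le_trans (ler_norm _) _; rewrite -[X in X * _]mul1r.
  by apply: oint2_young => //; try prove_cont2; move=> b y; exact: S_le1.
have b2 : - oint2 (fun b y => C y * inviscid b y * v' b y) <=
    2^-1 * (t * sqnorm inviscid + t^-1 * sqnorm (fun b y => C y * v' b y)).
  have -> : (fun b y => C y * inviscid b y * v' b y) =
      (fun b y => 1 * inviscid b y * (C y * v' b y)).
    by apply/funext => b; apply/funext => y; ring.
  apply: le_trans (ler_norm _) _; rewrite normrN -[X in X * _]mul1r.
  by apply: oint2_young => //; try prove_cont2; move=> b y; rewrite normr1.
have b3 : oint2 (fun b y => S y * u b y ^+ 2) <= sqnorm u.
  rewrite [leRHS](_ : _ = oint2_lincomb [:: (1, fun b y => u b y ^+ 2)]);
    last by rewrite /sqnorm /=; ring.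
  apply: oint2_le_lincomb; [prove_cont2|prove_cont2|move=> y /=].
  have hb b : S y * u b y ^+ 2 <= 1 * u b y ^+ 2.
    by rewrite ler_wpM2r ?sqr_ge0//; apply: le_trans (ler_norm _) (S_le1 y).
  by have := hb true; have := hb false; lra.
have b4 := ler_norm (oint2 (fun b y => (S y - lam) * v b y ^+ 2) - lam * energy).
have c3 : 0 <= lam * (2 * k + 2^-1) by rewrite mulr_ge0// addr_ge0// mulr_ge0.
have {}b3 := ler_wpM2l c3 b3.
have l2 : 0 <= 2 * lam by rewrite mulr_ge0.
have {}b4 := ler_wpM2l l2 b4.
have p : 0 <= lam ^+ 2 * sqnorm u by rewrite mulr_ge0 ?sqr_ge0// sqnorm_ge0.
lra.
Qed.

(** * Consequences of the resolvent equation *)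

(** The weak form of the rescaled equation for w = v + u, tested with p, when
    the right side has squared norm N2 and Young's inequality is applied with
    weight t.  The equation enters the estimates only in this form. *)
Definition tested (d4 N2 : R) := forall p p' : bool -> R -> R,
  (forall b, C1circle (p b) (p' b)) -> forall t : R, 0 < t ->
  2 * (d4 * oint2 (fun b y => (v' b y + u' b y) * p' b y)
       + oint2 (fun b y => sg b * inviscid b y * p (~~ b) y)) <= t * N2 + t^-1 * sqnorm p.

Section tested.
Variables (d4 N2 : R).
Hypothesis test : tested d4 N2.

(** Testing with v: advection drops out, only dissipation is left. *)
Lemma test_v (t : R) : 0 < d4 -> 0 < t -> 0 <= k ->
  2 * (d4 * sqnorm v') <= t * N2 + t^-1 * sqnorm v.
Proof.
move=> d40 t0 k0; apply: le_trans (test _ _ hv _ t0).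
rewrite skew_inviscid_v addr0 ler_pM2l// ler_pM2l//.
have -> : oint2 (fun b y => (v' b y + u' b y) * v' b y) = sqnorm v' + (k * sqnorm u' + sqnorm u'').
  rewrite -oint2_u'v' (_ : _ + _ = oint2_lincomb [:: (1, fun b y => v' b y ^+ 2);
    (1, fun b y => u' b y * v' b y)]); last by rewrite /sqnorm /=; ring.
  by apply: oint2_eq_lincomb; [prove_cont2|prove_cont2|move=> b y /=; ring].
by rewrite lerDl addr_ge0 ?mulr_ge0// sqnorm_ge0.
Qed.

Lemma test_norm (F F' : bool -> R -> R) (t : R) : (forall b, C1circle (F b) (F' b)) -> 0 < t ->
  2 * `|d4 * oint2 (fun b y => (v' b y + u' b y) * F' b y)
       + oint2 (fun b y => sg b * inviscid b y * F (~~ b) y)| <= t * N2 + t^-1 * sqnorm F.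
Proof.
move=> hF t0.
have cF : cont2 F by move=> b; exact: C1circle_cont (hF b).
have cF' : cont2 F' by move=> b; exact: C1circle_deriv (hF b).
case: ger0P => _; first exact: (test _ _ hF _ t0).
have hN b : C1circle (fun y => -1 * F b y) (fun y => -1 * F' b y).
  have -> : (fun y => -1 * F' b y) = fun y => 0 * F b y + -1 * F' b y.
    by apply/funext => y; ring.
  by apply: C1circleM => //; exact: C1circle_cst.
have := test _ _ hN _ t0.
have -> : (fun b y => (v' b y + u' b y) * (-1 * F' b y)) =
          (fun b y => -1 * ((v' b y + u' b y) * F' b y)).
  by apply/funext => b; apply/funext => y; ring.
have -> : (fun b y => sg b * inviscid b y * (-1 * F (~~ b) y)) =
          (fun b y => -1 * (sg b * inviscid b y * F (~~ b) y)).
  by apply/funext => b; apply/funext => y; ring.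
have -> : sqnorm (fun b y => -1 * F b y) = sqnorm F.
  by congr oint2; apply/funext => b; apply/funext => y; ring.
rewrite !oint2Z; [|prove_cont2|prove_cont2]; lra.
Qed.

(** The test function is F multiplied by the imaginary unit. *)
Lemma test_rot (F F' : bool -> R -> R) (t : R) : (forall b, C1circle (F b) (F' b)) -> 0 < t ->
  2 * `|oint2 (fun b y => inviscid b y * F b y)
        - d4 * oint2 (fun b y => sg b * (v' b y + u' b y) * F' (~~ b) y)|
   <= t * N2 + t^-1 * sqnorm F.
Proof.
move=> hF t0.
have cF : cont2 F by move=> b; exact: C1circle_cont (hF b).
have cF' : cont2 F' by move=> b; exact: C1circle_deriv (hF b).
have hN b : C1circle (fun y => - sg b * F (~~ b) y) (fun y => - sg b * F' (~~ b) y).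
  have -> : (fun y => - sg b * F' (~~ b) y) = fun y => 0 * F (~~ b) y + - sg b * F' (~~ b) y.
    by apply/funext => y; ring.
  by apply: C1circleM => //; exact: C1circle_cst.
have := test_norm _ _ t hN t0.
have -> : (fun b y => (v' b y + u' b y) * (- sg b * F' (~~ b) y)) =
          (fun b y => -1 * (sg b * (v' b y + u' b y) * F' (~~ b) y)).
  by apply/funext => b; apply/funext => y; ring.
have -> : (fun b y => sg b * inviscid b y * (- sg (~~ b) * F (~~ ~~ b) y)) =
          (fun b y => inviscid b y * F b y).
  by apply/funext => -[]; apply/funext => y; rewrite /sg /=; ring.
have -> : sqnorm (fun b y => - sg b * F (~~ b) y) = sqnorm F.
  rewrite /sqnorm -[RHS]oint2_swap; congr oint2; apply/funext => -[]; apply/funext => y;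
  rewrite /sg /=; ring.
rewrite oint2Z; last by prove_cont2.
by rewrite mulN1r mulrN [- _ + _]addrC.
Qed.

(** Testing with i v: the viscous term is real and drops out. *)
Lemma test_Jv (t : R) : 0 < t ->
  2 * `|oint2 (fun b y => (S y - lam) * v b y ^+ 2) - lam * energy| <=
  t * N2 + t^-1 * sqnorm v.
Proof.
by move=> t0; have := test_rot _ _ _ hv t0; rewrite skew_w'v' mulr0 subr0 oint2_inviscid_v.
Qed.

Lemma phi_le2 y : 0 <= lam <= 1 -> `|S y - lam| <= 2.
Proof.
move=> /andP[l0 l1]; have := S_le1 y; rewrite !ler_norml => /andP[h1 h2].
by apply/andP; split; lra.
Qed.

(** Testing with i times the residual.  The viscous term only contains C v' v and
    terms in u'', by [skew_w'inviscid']. *)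
Lemma inviscid_bound (s : R) : 0 < d4 -> 0 < s -> 0 <= lam <= 1 ->
  sqnorm inviscid <= N2 + d4 * (s * sqnorm (fun b y => C y * v b y) + s^-1 * sqnorm v')
          + 3 * d4 * (sqnorm v + sqnorm u'').
Proof.
move=> d40 s0 lam01; have /andP[l0 l1] := lam01.
have := test_rot _ _ 1 C1circle_inviscid ltr01; rewrite skew_w'inviscid' invr1 !mul1r.
have b1 := cross_bound (fun b _ => sg b) s s0 (fun b => @continuous_const R (sg b))
  (fun b _ => sg_le1 b).
have b2 : `|oint2 (fun b y => sg b * (S y - lam) * u'' b y * v (~~ b) y)| <= sqnorm u'' + sqnorm v.
  have := @oint2_young R (fun b y => sg b * (S y - lam)) u'' (fun b => v (~~ b)) 2 1.
  rewrite (oint2_swap (fun b y => v b y ^+ 2)) invr1 !mul1r divff ?mul1r ?pnatr_eq0//.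
  apply=> //; try prove_cont2; move=> b y.
  by rewrite normrM -[leRHS]mul1r; apply: ler_pM => //; [exact: sg_le1 | exact: phi_le2].
have b3 : `|oint2 (fun b y => sg b * v b y * u'' (~~ b) y)| <= 2^-1 * (sqnorm v + sqnorm u'').
  have := @oint2_young R (fun b y => sg b) v (fun b => u'' (~~ b)) 1 1.
  rewrite (oint2_swap (fun b y => u'' b y ^+ 2)) invr1 !mul1r.
  apply=> //; try prove_cont2; move=> b y; exact: sg_le1.
have -> : oint2 (fun b y => inviscid b y * inviscid b y) = sqnorm inviscid by [].
move: b1 b2 b3.
set c1 := oint2 _; set c2 := oint2 _; set c3 := oint2 _ => b1 b2 b3 h.
have dc1 := ler_wpM2l (ltW d40) (le_trans (ler_norm _) b1).
have dc2 : d4 * - c2 <= d4 * (sqnorm u'' + sqnorm v).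
  by rewrite ler_wpM2l ?(ltW d40)//; apply: le_trans b2; rewrite -normrN ler_norm.
have dc3 : d4 * (lam * c3) <= d4 * (2^-1 * (sqnorm v + sqnorm u'')).
  rewrite ler_wpM2l ?(ltW d40)//; apply: le_trans b3.
  apply: (@le_trans _ _ (lam * `|c3|)); first by rewrite ler_wpM2l// ler_norm.
  by rewrite -[leRHS]mul1r ler_wpM2r.
have {}h := le_trans (ler_wpM2l (ler0n _ 2) (ler_norm _)) h.
move: h dc1 dc2 dc3; lra.
Qed.

(** Testing with the residual itself: advection drops out, and the viscous term
    is the integral of (S - lam) |v'|^2 plus controlled terms.  Its sign is not
    definite, which is why [cos_weight] is needed to extract a bound on C v'. *)
Lemma velocity_bound (s t : R) : 0 < d4 -> 0 < s -> 0 < t -> 0 <= lam <= 1 ->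
  d4 * `|oint2 (fun b y => (S y - lam) * v' b y ^+ 2)| <=
  2^-1 * (t * N2 + t^-1 * sqnorm inviscid) +
  d4 * (2^-1 * (s * sqnorm (fun b y => C y * v b y) + s^-1 * sqnorm v')
        + 2 * (sqnorm v + sqnorm u'') + lam * sqnorm u').
Proof.
move=> d40 s0 t0 lam01; have /andP[l0 l1] := lam01.
have h := test_norm _ _ _ C1circle_inviscid t0.
have z : oint2 (fun b y => sg b * inviscid b y * inviscid (~~ b) y) = 0.
  rewrite (_ : 0 = oint2_lincomb [::])//.
  unshelve eapply (@oint2_eq R (fun _ _ => 0)); first exact (fun _ _ => 0).
  - by move=> b; exact: C1circle_cst.
  - by prove_cont2.
  - by [].
  - by move=> y /=; rewrite /sg /=; ring.
move: h; rewrite z addr0 w'inviscid'.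
have b1 : `|oint2 (fun b y => C y * v' b y * v b y)| <=
  2^-1 * (s * sqnorm (fun b y => C y * v b y) + s^-1 * sqnorm v').
  have -> : (fun b y => C y * v' b y * v b y) = (fun b y => 1 * (C y * v b y) * v' b y).
    by apply/funext => b; apply/funext => y; ring.
  have := @oint2_young R (fun _ _ => 1) (fun b y => C y * v b y) v' 1 s.
  rewrite mul1r; apply=> //; try prove_cont2; move=> b y; by rewrite normr1.
have b2 : `|oint2 (fun b y => (S y - lam) * u'' b y * v b y)| <= sqnorm u'' + sqnorm v.
  have := @oint2_young R (fun b y => (S y - lam)) u'' v 2 1.
  rewrite invr1 !mul1r divff ?mul1r ?pnatr_eq0//.
  apply=> //; try prove_cont2; move=> b y; exact: phi_le2.
have b3 : `|oint2 (fun b y => 1 * v b y * u'' b y)| <= 2^-1 * (sqnorm v + sqnorm u'').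
  have := @oint2_young R (fun b y => 1) v u'' 1 1.
  rewrite invr1 !mul1r.
  apply=> //; try prove_cont2; move=> b y; by rewrite normr1.
have U1 : 0 <= sqnorm u' by exact: sqnorm_ge0.
move: b1 b2 b3.
set c1 := oint2 _; set c2 := oint2 _; set c3 := oint2 _; set q := oint2 _ => b1 b2 b3.
set r := (X in d4 * X) => h.
have e : `|q| <= `|r| + `|c1| + `|c2| + lam * sqnorm u' + `|c3|.
  have -> : q = r - c1 + c2 + lam * sqnorm u' - lam * c3 by rewrite /r; ring.
  apply: le_trans (ler_normB _ _) _; apply: lerD; last first.
    by rewrite normrM (ger0_norm l0) -[leRHS]mul1r ler_wpM2r.
  apply: le_trans (ler_normD _ _) _; apply: lerD; last by rewrite ger0_norm ?mulr_ge0.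
  apply: le_trans (ler_normD _ _) _; rewrite lerD2r; exact: ler_normB.
have e' := ler_wpM2l (ltW d40) e.
have dc1 := ler_wpM2l (ltW d40) b1.
have dc2 := ler_wpM2l (ltW d40) b2.
have dc3 := ler_wpM2l (ltW d40) b3.
have p0 : 0 <= d4 * (sqnorm v + sqnorm u'') by rewrite mulr_ge0 ?(ltW d40)// addr_ge0// sqnorm_ge0.
move: h; rewrite normrM (gtr0_norm d40); lra.
Qed.

Ltac clear_bounds := repeat match goal with H : is_true _ |- _ => clear H end.

(** Assembly of the two cases.  With t = 64 L^2 / e^2 the tests with v and i v
    have errors of order e^2 |v|^2 / L^2.  In the interior case, the n scales are
    sg0 (1 - lam) / 2^j for j < n. *)
Lemma resolvent_absurd (k0 L e sg0 : R) (n : nat) :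
  0 < k0 <= 1 -> k0 <= k -> 0 <= lam -> 94 <= L -> 0 < e -> d4 = e ^+ 4 ->
  32 * L ^+ 2 * e ^+ 2 <= 1 -> 128 * 50 <= n%:R * k0 ^+ 3 ->
  0 < sg0 -> 200 * sg0 <= k0 ^+ 3 -> 57 * 400 <= k0 ^+ 3 * (sg0 / 2 ^+ n) ^+ 2 * L ->
  N2 <= e ^+ 4 * sqnorm v / (64 * L ^+ 2) ^+ 2 -> 0 < sqnorm v -> False.
Proof.
move=> k01 hk l0 hL e0 hd4 small hn s00 hs0 hs1 hN V0.
have /andP[k00 k0le1] := k01.
have s01 : sg0 <= 1 by have := exprn_ile1 3 (ltW k00) k0le1; lra.
have d40 : 0 < d4 by rewrite hd4 exprn_gt0.
have L1 : 1 <= L by lra.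
have L0 : 0 < L by lra.
have kge0 : 0 <= k by lra.
have e2 : 0 < e ^+ 2 by rewrite exprn_gt0.
have hL2 : 0 < L ^+ 2 by rewrite exprn_gt0.
have U0 : 0 <= sqnorm u by exact: sqnorm_ge0.
have U1 : 0 <= sqnorm u' by exact: sqnorm_ge0.
have U2 : 0 <= sqnorm u'' by exact: sqnorm_ge0.
have X0 : 0 <= sqnorm (fun b y => C y * v b y) by exact: sqnorm_ge0.
have E0 : 0 <= energy by rewrite addr_ge0// mulr_ge0.
have lE0 : 0 <= lam * energy by rewrite mulr_ge0.
have hU := sqnorm_v_ge.
have p1 : 0 <= k ^+ 2 * sqnorm u by rewrite mulr_ge0// sqr_ge0.
have p2 : 0 <= 2 * k * sqnorm u' by rewrite !mulr_ge0.
pose t := 64 * L ^+ 2 / e ^+ 2.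
have t0 : 0 < t by rewrite divr_gt0// mulr_gt0.
have tE : t * N2 + t^-1 * sqnorm v <= 2 * (e ^+ 2 * sqnorm v / (64 * L ^+ 2)).
  have := ler_wpM2l (ltW t0) hN.
  rewrite (_ : t * (e ^+ 4 * sqnorm v / (64 * L ^+ 2) ^+ 2) = e ^+ 2 * sqnorm v / (64 * L ^+ 2));
    last by rewrite /t; field; rewrite !gt_eqF.
  rewrite (_ : t^-1 * sqnorm v = e ^+ 2 * sqnorm v / (64 * L ^+ 2));
    last by rewrite /t; field; rewrite !gt_eqF.
  by clear_bounds; lra.
have hB : e ^+ 2 * sqnorm v' <= sqnorm v / (64 * L ^+ 2).
  have := le_trans (test_v t d40 t0 kge0) tE.
  rewrite ler_pM2l// hd4 (_ : e ^+ 4 * _ = e ^+ 2 * (e ^+ 2 * sqnorm v')); last by ring.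
  by rewrite -mulrA ler_pM2l.
have hm : `|oint2 (fun b y => (S y - lam) * v b y ^+ 2) - lam * energy| <=
    e ^+ 2 * sqnorm v / (64 * L ^+ 2).
  by have := le_trans (test_Jv t t0) tE; rewrite ler_pM2l.
have hX := cos_weight v cv.
have hP := le_trans (ler_norm _) hm.
have hP' : - (oint2 (fun b y => (S y - lam) * v b y ^+ 2) - lam * energy) <=
    e ^+ 2 * sqnorm v / (64 * L ^+ 2).
  by apply: le_trans hm; rewrite -normrN ler_norm.
have [near|far] := leP (1 - lam) (L ^+ 2 * e ^+ 2).
  apply: (@concentrated_absurd _ L e (sqnorm v) (sqnorm v') _ _ _ L1 e0 small V0 X0 near hX _ hB
    uncertainty).
  by move: hP' lE0; clear_bounds; lra.
have D0 : 0 < 1 - lam by apply: le_lt_trans far; rewrite mulr_ge0// ltW.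
have lam01 : 0 <= lam <= 1 by rewrite l0 -subr_ge0 ltW.
pose d := Num.sqrt (1 - lam).
have d2 : d ^+ 2 = 1 - lam by rewrite sqr_sqrtr// ltW.
have d0 : 0 < d by rewrite sqrtr_gt0.
have d1 : d <= 1 by rewrite -(ler_pXn2r (n:=2))// ?nnegrE ?(ltW d0)// d2 expr1n gerBl.
have Led : L * e <= d.
  rewrite -(ler_pXn2r (n:=2))// ?nnegrE ?(ltW d0)//; last by rewrite mulr_ge0// ltW.
  by rewrite d2 exprMn ltW.
have Led0 : 0 < 8 * L * e * d by rewrite !mulr_gt0.
have q8 : e ^+ 2 * sqnorm v / (64 * L ^+ 2) <= d ^+ 2 * sqnorm v.
  rewrite ler_pdivrMr; last by rewrite mulr_gt0.
  have h1 : e ^+ 2 <= d ^+ 2 * (64 * L ^+ 2).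
    have L2 := exprn_ege1 2 L1.
    rewrite d2; apply: (@le_trans _ _ (1 - lam)).
      by apply: le_trans (ltW far); rewrite ler_peMl// ltW.
    by rewrite ler_peMr ?(ltW D0)//; move: L2; clear_bounds; lra.
  by have := ler_wpM2r (ltW V0) h1; clear_bounds; lra.
have hX4 : sqnorm (fun b y => C y * v b y) <= 4 * d ^+ 2 * sqnorm v.
  by rewrite -d2 in hX; move: hX q8 hP' lE0; clear_bounds; lra.
have hlE : lam * energy <= 2 * d ^+ 2 * sqnorm v.
  by rewrite -d2 in hX; move: X0 hX q8 hP'; clear_bounds; lra.
have hU1 : lam * sqnorm u' <= 2 * sqnorm v.
  apply: (@le_trans _ _ (lam * energy)); first by rewrite ler_wpM2l// lerDl mulr_ge0.
  apply: (le_trans hlE); rewrite -mulrA ler_pM2l// -[leRHS]mul1r ler_wpM2r ?(ltW V0)//.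
  by rewrite exprn_ile1// ltW.
have hU2 : sqnorm u'' <= sqnorm v by move: hU p1 p2; clear_bounds; lra.
have s1 : 0 < (8 * L * e * d)^-1 by rewrite invr_gt0.
have hG := inviscid_bound _ d40 s1 lam01; rewrite invrK hd4 in hG.
have hY := @inviscid_small _ L e d (sqnorm v) L1 e0 d0 Led V0 _ _ _ _ _ hX4 hB hN hU2 hG.
have de0 : 0 < (d / e) ^+ 2 by rewrite exprn_gt0// divr_gt0.
have hQ := velocity_bound _ _ d40 s1 de0 lam01.
rewrite invrK hd4 in hQ.
have hdi : ((d / e) ^+ 2)^-1 = (e / d) ^+ 2 by field; rewrite !gt_eqF.
rewrite hdi in hQ.
have hZ := cos_weight v' cv'; rewrite -d2 in hZ.
have {}hZ := @velocity_small _ L e d (sqnorm v) L1 e0 d0 Led V0 _ _ _ _ _ _ _ _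
  hX4 hB hN hU2 hU1 hY hQ hZ.
have Ld0 : 0 < (L / d) ^+ 2 by rewrite exprn_gt0// divr_gt0.
have de30 : 0 < d / e ^+ 3 by rewrite divr_gt0// exprn_gt0.
have hv1 := virial_bound _ _ Ld0 de30 l0 kge0.
have hLi : ((L / d) ^+ 2)^-1 = (d / L) ^+ 2 by field; rewrite !gt_eqF.
have hdi3 : (d / e ^+ 3)^-1 = e ^+ 3 / d by rewrite invf_div.
rewrite hLi hdi3 in hv1.
have {}hv1 := @virial_small _ L e d (sqnorm v) L1 e0 d0 d1 Led V0 _ _ _ _ _ _ lam01 d2 hY hZ hm hv1.
have sg1_0 : 0 < sg0 / 2 ^+ n by rewrite divr_gt0// exprn_gt0.
have r0 : 0 < sg0 * d ^+ 2 by rewrite mulr_gt0// exprn_gt0.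
have how := howard_scales (lam ^+ 2 * k * sqnorm u)
  ((sg0 / 2 + 57 / ((sg0 / 2 ^+ n) ^+ 2 * L)) * (d ^+ 2 * sqnorm v)) (sg0 * d ^+ 2) n r0.
have {}how : n%:R * (lam ^+ 2 * k * sqnorm u) <=
  16 * (1 - lam) * sqnorm v
  + n%:R * ((sg0 / 2 + 57 / ((sg0 / 2 ^+ n) ^+ 2 * L)) * ((1 - lam) * sqnorm v)).
  rewrite -d2; apply: (le_trans (how _)); last by move: hX4; clear_bounds; lra.
  move=> j jn; set r := sg0 * d ^+ 2 / 2 ^+ j.
  have r_gt0 : 0 < r by rewrite divr_gt0// exprn_gt0.
  have -> : sg0 * d ^+ 2 / 2 ^+ j.+1 = r / 2 by rewrite /r (exprSr 2 j) invfM mulrA.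
  have rE : r = (sg0 / 2 ^+ j) * d ^+ 2 by rewrite /r; ring.
  have sj1 : sg0 / 2 ^+ n <= sg0 / 2 ^+ j.
    by rewrite ler_pM2l// lef_pV2 ?posrE ?exprn_gt0// ler_eXn2l ?ltr1n// ltnW.
  have sj0 : sg0 / 2 ^+ j <= sg0.
    by rewrite ler_pdivrMr ?exprn_gt0// ler_peMr ?(ltW s00)// exprn_ege1// ler1n.
  have hsmall := @howard_small _ L e d (sqnorm v) L1 e0 d0 Led V0 lam sg0 (sg0 / 2 ^+ n)
    (sg0 / 2 ^+ j) (sqnorm inviscid) lam01 d2 hY sg1_0 sj1 sj0 s01 (sqnorm_ge0 _).
  have := howard r (2 * (1 - lam) / r ^+ 2 + r^-1) ((L / d) ^+ 2) r_gt0 Ld0 l0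
    (fun y => critical_layer_weight r y r_gt0 (proj2 (andP lam01))).
  rewrite hLi; rewrite -rE in hsmall => hr; apply: (le_trans hr).
  by rewrite -addrA lerD2l; exact: hsmall.
rewrite d2 in hv1.
apply: (@interior_absurd _ k0 k lam (1 - lam) (sqnorm v) (sqnorm u) L n%:R sg0 (sg0 / 2 ^+ n)
  k01 hk lam01 erefl V0 D0 L0 U0 _ hv1 how _ hL hn hs0 hs1 sg1_0).
- by move: hU p2 U2; clear_bounds; lra.
- rewrite ltr0n lt0n; apply/negP => /eqP n0; move: hn; rewrite n0 mul0r.
  by clear_bounds; lra.
Qed.

End tested.

End identities.

(** * Primitives *)

Section primitives.
Local Open Scope classical_set_scope.
Context {R : realType}.
Implicit Types (f g : R -> R) (a y : R).
Notation mu := (@lebesgue_measure R).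

Lemma primitive_shift g a a' y : continuous g -> a' <= a -> a <= y -> a <= 0 ->
  Rintegral mu `[a', y] g - Rintegral mu `[a', 0] g =
  Rintegral mu `[a, y] g - Rintegral mu `[a, 0] g.
Proof.
move=> cg a'a ay a0.
have h b : a <= b -> Rintegral mu `[a', b] g =
    Rintegral mu `[a', a] g + Rintegral mu `[a, b] g.
  move=> ab; have := @Rintegral_itvB R g (BLeft a') (BRight b) a.
  rewrite !bnd_simp => /(_ (continuous_integrable _ _ _ cg) a'a ab) /eqP.
  rewrite subr_eq => /eqP ->; rewrite addrC; congr (_ + _).
  rewrite Rintegral_itv_obnd_cbnd//.
  by apply: integrableS (continuous_integrable _ a b cg) => //;
    apply: subset_itvr; rewrite bnd_simp.
by rewrite (h _ ay) (h _ a0); ring.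
Qed.

(** The primitive is the integral from 0 to y, written as a difference of two
    integrals from a common left end point below both; the left end point
    recedes with y to cover the whole line. *)
Lemma primitive_exists g : continuous g -> exists F : R -> R, forall y, is_derive y 1 F (g y).
Proof.
move=> cg.
pose A a y : R := Rintegral mu `[a, y] g - Rintegral mu `[a, 0] g.
exists (fun y => A (- (`|y| + 1)) y) => y0.
have bound y : - `|y| <= y by rewrite lerNl -normrN ler_norm.
pose a := - (`|y0| + 2).
have a0 : a <= 0 by rewrite /a oppr_le0 addr_ge0.
have ay0 : a < y0 by have := bound y0; rewrite /a; lra.
have [dA eA] : derivable (fun y => Rintegral mu `[a, y] g) y0 1 /\
    derive1 (fun y => Rintegral mu `[a, y] g) y0 = g y0.
  apply: (@continuous_FTC1_closed R g a y0 (y0 + 1)) => //; first by rewrite ltrDl.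
    exact: continuous_integrable.
  exact: cg.
have dAa : is_derive y0 1 (A a) (g y0).
  rewrite -[g y0]subr0; apply: is_deriveB.
  by apply: DeriveDef; [exact: dA | rewrite -derive1E; exact: eA].
apply: near_eq_is_derive dAa; near=> y.
have yy0 : `|y0 - y| < 1 by near: y; apply: nbhsx_ballx; exact: ltr01.
have yn : `|y| <= `|y0| + 1.
  rewrite (_ : y = y0 - (y0 - y)); last by ring.
  by apply: (le_trans (ler_normB _ _)); rewrite lerD2l ltW.
have := bound y => by1.
rewrite /A (primitive_shift _ (- (`|y| + 1)) a)//; rewrite /a; lra.
Unshelve. all: by end_near. Qed.

Lemma C1circle_primitive g : continuous g -> periodic g (2 * pi) -> oint g = 0 ->
  exists F, C1circle F g.
Proof.
move=> cg pg g0; have [F dF] := primitive_exists _ cg; exists F.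
have cF y : {for y, continuous F}.
  by apply: differentiable_continuous; apply/derivable1_diffP; have [] := dF y.
have F0 : F (2 * pi) = F 0.
  apply/eqP; rewrite -subr_eq0; apply/eqP.
  move: g0; rewrite /oint /Rintegral (@continuous_FTC2 _ _ F 0 (2 * pi) twopi_gt0) //.
  - exact: continuous_within.
  - split=> [y _| |]; first by have [] := dF y.
      exact/cvg_at_right_filter/cF.
    exact/cvg_at_left_filter/cF.
  - by move=> y _; rewrite derive1E; have [_ ->] := dF y.
split => // y; apply/eqP; rewrite -subr_eq0; apply/eqP.
have dsh (z : R) : is_derive z 1 (fun y => F (y + 2 * pi) - F y) 0.
  rewrite -(subrr (g z)) -{1}(pg z); apply: is_deriveB.
  rewrite -[X in is_derive _ _ _ X]mulr1.
  exact: (@is_derive1_comp R F (shift (2 * pi)) z (g (z + 2 * pi)) 1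
    (dF _) (is_derive_shift z 1 (2 * pi))).
by rewrite (@is_derive_0_is_cst R _ y 0 dsh) add0r F0 subrr.
Qed.

Lemma continuous_bounded f (a b : R) : continuous f ->
  exists M, 0 <= M /\ forall y, `[a, b]%classic y -> `|f y| <= M.
Proof.
move=> cf; have := @compact_bounded _ _ (f @` `[a, b]%classic).
have cK : compact (f @` `[a, b]%classic).
  apply: continuous_compact; [exact: continuous_within | exact: segment_compact].
move=> /(_ cK) [M [_ hM]]; exists (`|M| + 1); split; first by rewrite addr_ge0.
move=> y aby; apply: (hM (`|M| + 1)); last by exists y.
by rewrite (le_lt_trans (ler_norm _))// ltrDl.
Qed.

Lemma integrable_mul f g a b : mu.-integrable `[a, b] (EFin \o f) -> continuous g ->
  mu.-integrable `[a, b] (EFin \o (fun y => f y * g y)).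
Proof.
move=> fi cg; have := @integrableMl _ _ _ mu `[a, b]%classic _ (EFin \o f) g fi.
apply => //.
  by apply: measurable_funTS; exact: continuous_measurable_fun.
have [M [M0 hM]] := continuous_bounded g a b cg.
exists M; split; first exact: num_real.
by move=> x Mx y aby; apply: le_trans (ltW Mx); exact: hM.
Qed.

End primitives.

(** * The lemma of du Bois-Reymond *)

Section du_bois_reymond.
Local Open Scope classical_set_scope.
Context {R : realType}.
Implicit Types (f g k : R -> R) (a x y : R).
Notation mu := (@lebesgue_measure R).

Lemma continuous_comp_sub g a : continuous g -> continuous (fun y => g (y - a)).
Proof.
move=> cg y; apply: (@continuous_comp _ _ _ (fun y => y - a) g); last exact: cg.
apply: (continuous_add (fun y => y) (fun=> - a)); last exact: continuous_const.
by move=> z; exact: cvg_id.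
Qed.

(** Near any point the extension is a sum of two translates of g: to the right of
    a multiple of the period one of them vanishes, to the left the other. *)
Lemma periodic_extension g : continuous g ->
  (forall y, y <= 0 -> g y = 0) -> (forall y, 2 * pi <= y -> g y = 0) ->
  exists f, [/\ continuous f, periodic f (2 * pi) &
    forall y, 0 <= y <= 2 * pi -> f y = g y].
Proof.
move=> cg gl gr; have T0 := @twopi_gt0 R; set T := 2 * pi in gr T0 *.
pose N y : int := Num.floor (y / T).
have Nb y : (N y)%:~R * T <= y < ((N y)%:~R + 1) * T.
  have /andP[h1 h2] := floor_itv (y / T); apply/andP; split.
    by rewrite -ler_pdivlMr.
  by rewrite -ltr_pdivrMr//; move: h2; rewrite intrD.
exists (fun y => g (y - (N y)%:~R * T)); split.
- move=> y0.
  have loc y : ((N y0)%:~R - 1) * T < y < ((N y0)%:~R + 1) * T ->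
    g (y - (N y0)%:~R * T) + g (y - ((N y0)%:~R - 1) * T) = g (y - (N y)%:~R * T).
    move=> /andP[y1 y2].
    have [h|h] := leP ((N y0)%:~R * T) y.
      have -> : N y = N y0.
        apply: floor_def; rewrite ler_pdivlMr// h /= ltr_pdivrMr// intrD//.
      rewrite (gr (y - ((N y0)%:~R - 1) * T)) ?addr0//; move: h; lra.
    have -> : N y = N y0 - 1.
      apply: floor_def; rewrite ler_pdivlMr// ltr_pdivrMr// !intrD subrK rmorphN /= h andbT.
      exact: ltW.
    by rewrite (gl (y - (N y0)%:~R * T)) ?add0r ?intrD ?rmorphN//; lra.
  have /andP[b1 b2] := Nb y0.
  rewrite /continuous_at -loc; last by apply/andP; split => //; move: b1; lra.
  apply: cvg_trans (continuous_add _ _ (continuous_comp_sub g ((N y0)%:~R * T) cg)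
    (continuous_comp_sub g (((N y0)%:~R - 1) * T) cg) y0).
  apply: near_eq_cvg; near=> y; apply: loc; apply/andP; split.
    by near: y; apply: lt_nbhsr; move: b1; lra.
  by near: y; apply: lt_nbhsl.
- move=> y; congr g; have -> : N (y + T) = N y + 1.
    apply: floor_def; have /andP[b1 b2] := Nb y.
    by rewrite ler_pdivlMr// ltr_pdivrMr// !intrD; apply/andP; split; lra.
  by rewrite intrD; ring.
- move=> y /andP[y0 yT]; move: yT; rewrite le_eqVlt => /predU1P[->|yT].
    have -> : N T = 1 by rewrite /N divff ?gt_eqF// floor1.
    by rewrite mul1r subrr gl// gr.
  have -> : N y = 0 by apply: floor_def; rewrite ler_pdivlMr// mul0r y0 /= ltr_pdivrMr// mul1r.
  by rewrite mul0r subr0.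
Unshelve. all: by end_near. Qed.

(** A continuous approximation of the indicator of the interval from 0 to x.  A
    rational function of the positive part of y (x - y) is used because its
    continuity and its limit as n grows need no case analysis. *)
Definition plateau x (n : nat) y : R :=
  let t := `|y * (x - y)| + y * (x - y) in n%:R * t / (n%:R * t + 1).

Lemma plateau_arg_ge0 x y : 0 <= `|y * (x - y)| + y * (x - y).
Proof. by rewrite -lerBlDr sub0r -normrN ler_norm. Qed.

Lemma plateau_den_gt0 x n y : 0 < n%:R * (`|y * (x - y)| + y * (x - y)) + 1.
Proof. by rewrite ltr_wpDl// mulr_ge0// plateau_arg_ge0. Qed.

Lemma continuous_plateau x n : continuous (plateau x n).
Proof.
have ct : continuous (fun y => `|y * (x - y)| + y * (x - y)).
  have c1 : continuous (fun y => y * (x - y)).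
    apply: continuous_mul; first by move=> z; exact: cvg_id.
    apply: continuous_add; first exact: continuous_const.
    by apply: continuous_opp => z; exact: cvg_id.
  apply: continuous_add => //.
  by move=> z; apply: (@continuous_comp _ _ _ (fun y => y * (x - y)) (fun z : R => `|z|));
    [exact: c1 | exact: norm_continuous].
apply: continuous_mul.
  by apply: continuous_mul => //; exact: continuous_const.
apply: continuous_inv; first by move=> y; rewrite gt_eqF// plateau_den_gt0.
apply: continuous_add; last exact: continuous_const.
by apply: continuous_mul => //; exact: continuous_const.
Qed.

Lemma plateau_bounds x n y : 0 <= plateau x n y <= 1.
Proof.
have t0 := plateau_arg_ge0 x y; have d0 := plateau_den_gt0 x n y.
apply/andP; split; first by apply: divr_ge0; [exact: mulr_ge0 | exact: ltW].
by rewrite ler_pdivrMr// mul1r lerDl.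
Qed.

Lemma plateau_out x n y : 0 <= x -> y <= 0 \/ x <= y -> plateau x n y = 0.
Proof.
move=> x0 h; have t0 : y * (x - y) <= 0.
  case: h => h; first by rewrite mulr_le0_ge0// subr_ge0 (le_trans h).
  by rewrite mulr_ge0_le0 ?subr_le0// (le_trans x0).
by rewrite /plateau ler0_norm// addNr mulr0 mul0r.
Qed.

Lemma plateau_cvg x y : 0 < y < x -> plateau x n y @[n --> \oo] --> (1 : R).
Proof.
move=> /andP[y0 yx]; have t0 : 0 < `|y * (x - y)| + y * (x - y).
  have h : 0 < y * (x - y) by rewrite mulr_gt0// subr_gt0.
  by rewrite gtr0_norm// addr_gt0.
set t := (X in 0 < X) in t0.
apply/cvgrPdist_le => /= e e0; near=> n.
have d0 : 0 < n%:R * t + 1 by rewrite ltr_wpDl// mulr_ge0// ltW.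
rewrite /plateau -/t (_ : 1 - _ = (n%:R * t + 1)^-1); last first.
  by field; rewrite gt_eqF.
rewrite gtr0_norm ?invr_gt0// invf_ple ?posrE//.
apply: (@le_trans _ _ (n%:R * t)); last by rewrite lerDl.
rewrite -ler_pdivrMr//; near: n; exact: nbhs_infty_ger.
Unshelve. all: by end_near. Qed.

Definition circle_integrable f := mu.-integrable `[0, 2 * pi] (EFin \o f).
Definition ae_circle f g := {ae mu, forall y, `[0, 2 * pi]%classic y -> f y = g y}.

Lemma integral_plateau k x : circle_integrable k -> 0 < x <= 2 * pi ->
  oint (fun y => k y * plateau x n y) @[n --> \oo] --> Rintegral mu `[0, x] k.
Proof.
move=> ki /andP[x0 x2].
have mk : measurable_fun `[0, 2 * pi]%classic k.
  by apply/measurable_EFinP; exact: measurable_int ki.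
have kn n : mu.-integrable `[0, 2 * pi] (EFin \o (fun y => k y * plateau x n y)).
  by apply: integrable_mul => //; exact: continuous_plateau.
have sub : `]0, x[ `<=` `[0, 2 * pi]%classic.
  move=> y /=; rewrite !in_itv /= => /andP[y0 yx].
  by rewrite ltW//= ltW// (lt_le_trans yx).
have kx : mu.-integrable `]0, x[ (EFin \o k) by apply: integrableS ki.
have E : Rintegral mu `[0, x] k = fine (\int[mu]_(y in `[0, 2 * pi]) ((k \_ `]0, x[) y)%:E).
  transitivity (Rintegral mu `]0, x[ k).
    rewrite -Rintegral_itv_obnd_cbnd; last first.
      by apply: integrableS ki => // y /=; rewrite !in_itv /= => /andP[y0 yx];
        rewrite ltW//= (le_trans yx).
    by rewrite Rintegral_itv_bndo_bndc.
  rewrite -[in LHS](setIidr sub) Rintegral_mkcondr /Rintegral.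
  by congr fine; apply: eq_integral => y _.
rewrite E.
have := @dominated_convergence _ _ _ mu `[0, 2 * pi]%classic _
  (fun n y => (k y * plateau x n y)%:E) (fun y => ((k \_ `]0, x[) y)%:E) (fun y => `|(k y)%:E|%E).
case => //.
- by move=> n; exact: measurable_int (kn n).
- apply/measurable_EFinP; apply/measurable_restrict => //.
  exact: measurable_funS mk.
- apply: aeW => y y2; apply: cvg_EFin; first by near=> n.
  rewrite /patch; case: ifPn => [|].
    rewrite inE /= in_itv /= => yx; rewrite -[X in _ --> X]mulr1.
    apply: cvgM; [exact: cvg_cst | exact: plateau_cvg].
  rewrite notin_setE /= in_itv /= => /negP yx.
  rewrite (_ : _ \o _ = fun=> 0); first exact: cvg_cst.
  apply/funext => n /=; rewrite plateau_out ?mulr0 ?(ltW x0)//.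
  by move: yx; rewrite negb_and -!leNgt => /orP[]; [left|right].
- exact: integrable_abse.
- apply: aeW => y n _; have /andP[p0 p1] := plateau_bounds x n y.
  by rewrite /= lee_fin normrM (ger0_norm p0) ler_piMr.
move=> ik _; rewrite -[X in _ --> X]fineK; last exact: integrable_fin_num.
by move=> /fine_cvg.
Unshelve. all: by end_near. Qed.

Lemma ointB f g : circle_integrable f -> circle_integrable g ->
  oint (fun y => f y - g y) = oint f - oint g.
Proof. by move=> fi gi; rewrite /oint RintegralB. Qed.

Lemma circle_integrable_cst a : circle_integrable (fun=> a).
Proof. exact: continuous_integrable (@continuous_const _ a). Qed.

Lemma circle_integrableB f g : circle_integrable f -> circle_integrable g ->
  circle_integrable (fun y => f y - g y).
Proof.
move=> fi gi; rewrite /circle_integrable.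
rewrite (_ : _ \o _ = (EFin \o f) \- (EFin \o g))%E; first exact: integrableB.
by apply/funext => y; rewrite /= EFinB.
Qed.

Lemma oint_cst a : oint (fun=> a) = a * (2 * pi).
Proof.
by rewrite /oint Rintegral_cst//= lebesgue_measure_itv /= lte_fin twopi_gt0 /= subr0.
Qed.

(** By the Lebesgue differentiation theorem k is almost everywhere the
    derivative of its integral, which is constant. *)
Lemma ae_zero_of_intervals k : circle_integrable k ->
  (forall x, 0 < x <= 2 * pi -> Rintegral mu `[0, x] k = 0) -> ae_circle k (fun=> 0).
Proof.
move=> ki k0; pose f := k \_ `[0, 2 * pi]%classic.
have fi : mu.-integrable setT (EFin \o f).
  by rewrite /f -restrict_EFin; apply/(integrable_mkcond _ _).1.
have lf : locally_integrable setT f by apply: open_integrable_locally => //; exact: openT.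
have fS (y : R) : mu.-integrable [set` Interval (BLeft 0) (BRight y)] (EFin \o f).
  exact: integrableS fi.
have := @FTC1 R f (BLeft 0) fS lf.
have F0 (x : R) : 0 < x < 2 * pi ->
    \near x, Rintegral mu [set` Interval (BLeft 0) (BRight x)] f = 0.
  move=> /andP[x0 x2]; near=> z.
  have z02 : 0 < z <= 2 * pi.
    apply/andP; split; first by near: z; exact: lt_nbhsr.
    by apply: ltW; near: z; exact: lt_nbhsl.
  rewrite -[RHS](k0 z z02); apply: eq_Rintegral => y; rewrite inE /= in_itv /= => /andP[y0 yz].
  by rewrite /f /patch mem_set//= in_itv /= y0 (le_trans yz)//; have /andP[] := z02.
have end_pt (a : R) : {ae mu, forall y, y != a}.
  exists [set a]; split => //; first exact: lebesgue_measure_set1.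
  by move=> y /= /negP; rewrite negbK => /eqP.
have := end_pt 0; have := end_pt (2 * pi).
apply: filterS3; first exact: (ae_filter_ringOfSetsType mu).
move=> y y2 y0 ftc; rewrite /= in_itv /= => /andP[y0' y2'].
have y02 : 0 < y < 2 * pi by rewrite !lt_neqAle y0' y2' y2 eq_sym y0.
have [_] : derivable (fun x : R => Rintegral mu [set` Interval (BLeft 0) (BRight x)] f) y 1 /\
    derive1 (fun x : R => Rintegral mu [set` Interval (BLeft 0) (BRight x)] f) y = f y.
  by apply: ftc; rewrite /= lte_fin; have /andP[] := y02.
have fy : f y = k y by rewrite /f /patch mem_set//= in_itv /= y0' y2'.
rewrite fy => <-.
rewrite derive1E (near_eq_derive _ (F0 y y02)) derive_cst.
Unshelve. all: by end_near. Qed.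

(** A continuous periodic function of mean zero is the derivative of a test
    function.  Hence k minus its mean is orthogonal to all continuous periodic
    functions, and in the limit to the indicators of intervals. *)
Lemma du_bois_reymond k : circle_integrable k ->
  (forall f f', C1circle f f' -> oint (fun y => k y * f' y) = 0) ->
  exists c, ae_circle k (fun=> c).
Proof.
move=> ki h; have T0 := @twopi_gt0 R.
pose c := oint k / (2 * pi); exists c.
have kc : circle_integrable (fun y => k y - c).
  by apply: circle_integrableB => //; exact: circle_integrable_cst.
have mean f : continuous f -> periodic f (2 * pi) -> oint (fun y => (k y - c) * f y) = 0.
  move=> cf pf; pose m := oint f / (2 * pi).
  have cfm : continuous (fun y => f y - m).
    by apply: continuous_add => //; exact: (@continuous_const _ (- m)).
  have fi : circle_integrable f := continuous_integrable _ _ _ cf.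
  have fm0 : oint (fun y => f y - m) = 0.
    rewrite ointB//; last exact: circle_integrable_cst.
    by rewrite oint_cst /m divfK ?gt_eqF// subrr.
  have [F CF] := C1circle_primitive _ cfm (fun y => congr1 (fun z => z - m) (pf y)) fm0.
  have := h _ _ CF.
  have kf : circle_integrable (fun y => k y * f y) by exact: integrable_mul.
  have km : circle_integrable (fun y => k y * m).
    by apply: integrable_mul => //; exact: continuous_const.
  have cfi : circle_integrable (fun y => c * f y).
    by apply: continuous_integrable; apply: continuous_mul => //; exact: continuous_const.
  have -> : (fun y => k y * (f y - m)) = fun y => k y * f y - k y * m.
    by apply/funext => y; ring.
  have -> : (fun y => (k y - c) * f y) = fun y => k y * f y - c * f y.
    by apply/funext => y; ring.
  rewrite !ointB// ointZ// => hk; rewrite -[RHS]hk; congr (_ - _).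
  have -> : oint (fun y => k y * m) = oint k * m by rewrite /oint RintegralZr.
  by rewrite /m /c mulrAC mulrA.
have : ae_circle (fun y => k y - c) (fun=> 0).
  apply: ae_zero_of_intervals => // x /andP[x0 x2].
  have := integral_plateau _ x kc _; rewrite x0 x2 => /(_ isT) hc.
  apply: (cvg_unique _ hc); first exact: norm_hausdorff.
  rewrite (_ : (fun n => _) = fun=> 0); first exact: cvg_cst.
  apply/funext => n.
  have cp := @continuous_plateau x n.
  have [f [cf pf fE]] := periodic_extension _ cp
    (fun y h0 => plateau_out x n y (ltW x0) (or_introl h0))
    (fun y h0 => plateau_out x n y (ltW x0) (or_intror (le_trans x2 h0))).
  rewrite -(mean f cf pf); apply: eq_Rintegral => y.
  by rewrite inE /= in_itv /= => /fE ->.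
apply: filterS; first exact: (ae_filter_ringOfSetsType mu).
by move=> y hy /hy /eqP; rewrite subr_eq0 => /eqP.
Qed.

End du_bois_reymond.

(** * Weak derivatives *)

Section weak_derivatives.
Local Open Scope classical_set_scope.
Context {R : realType}.
Implicit Types (f g h k : R -> R) (a x y e : R).
Notation mu := (@lebesgue_measure R).

Definition real_weak_deriv f g := forall p p', C1circle p p' ->
  oint (fun y => f y * p' y) = - oint (fun y => g y * p y).

Lemma weak_mean0 f g : real_weak_deriv f g -> oint g = 0.
Proof.
move=> fg; have := fg _ _ (C1circle_cst 1).
have -> : (fun y => f y * 0) = fun=> 0 by apply/funext => y; rewrite mulr0.
have -> : (fun y => g y * 1) = g by apply/funext => y; rewrite mulr1.
by rewrite oint_cst mul0r => /eqP; rewrite eq_sym oppr_eq0 => /eqP.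
Qed.

Lemma ointD_integrable f g : circle_integrable f -> circle_integrable g ->
  oint (fun y => f y + g y) = oint f + oint g.
Proof. by move=> fi gi; rewrite /oint RintegralD. Qed.

Lemma continuous_circle_integrable f : continuous f -> circle_integrable f.
Proof. exact: continuous_integrable. Qed.

Lemma weak_difference f g F : circle_integrable f -> circle_integrable g ->
  continuous F -> real_weak_deriv f g -> real_weak_deriv F g ->
  exists c, ae_circle f (fun y => F y + c).
Proof.
move=> fi gi cF fg Fg.
have [||c hc] := du_bois_reymond (fun y => f y - F y).
- by apply: circle_integrableB => //; exact: continuous_circle_integrable.
- move=> p p' Cp; have cp' := C1circle_deriv _ _ Cp.
  have -> : (fun y => (f y - F y) * p' y) = fun y => f y * p' y - F y * p' y.
    by apply/funext => y; ring.
  rewrite ointB; first by rewrite (fg _ _ Cp) (Fg _ _ Cp) subrr.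
    exact: integrable_mul.
  by apply: continuous_circle_integrable; exact: continuous_mul.
exists c; apply: filterS hc; first exact: (ae_filter_ringOfSetsType mu).
by move=> y hy /hy <-; ring.
Qed.

Lemma C1circle_weak f f' : C1circle f f' -> real_weak_deriv f f'.
Proof.
move=> Cf p p' Cp; have := oint_deriv _ _ (C1circleM _ _ _ _ Cf Cp).
rewrite ointD; last 2 first.
- by apply: continuous_mul; [exact: C1circle_deriv Cf | exact: C1circle_cont Cp].
- by apply: continuous_mul; [exact: C1circle_cont Cf | exact: C1circle_deriv Cp].
by move=> /eqP; rewrite addrC addr_eq0 => /eqP.
Qed.

(** A continuous weak derivative is a classical one: f differs from a primitive
    of g by a function with vanishing weak derivative, that is, a constant. *)
Lemma weak_C1 f g : circle_integrable f -> continuous g -> periodic g (2 * pi) ->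
  real_weak_deriv f g -> exists F, C1circle F g /\ ae_circle f F.
Proof.
move=> fi cg pg fg.
have [F CF] := C1circle_primitive _ cg pg (weak_mean0 _ _ fg).
have gi := continuous_circle_integrable _ cg.
have [c hc] := weak_difference _ _ _ fi gi (C1circle_cont _ _ CF) fg (C1circle_weak _ _ CF).
exists (fun y => F y + c); split => //.
have -> : g = fun y => g y + 0 by apply/funext => y; rewrite addr0.
by apply: C1circleD => //; exact: C1circle_cst.
Qed.

Definition abs_oint k := oint (fun y => `|k y|).

Lemma circle_integrable_abs k : circle_integrable k -> circle_integrable (fun y => `|k y|).
Proof. by move=> ki; exact: (integrable_abse ki). Qed.

Lemma oint_mul_bound k p M : circle_integrable k -> continuous p ->
  (forall y, `[0, 2 * pi]%classic y -> `|p y| <= M) ->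
  `|oint (fun y => k y * p y)| <= M * abs_oint k.
Proof.
move=> ki cp hM.
have kp : circle_integrable (fun y => k y * p y) by exact: integrable_mul.
apply: (le_trans (le_normr_Rintegral _ kp)) => //.
rewrite -RintegralZl//; last exact: circle_integrable_abs.
apply: le_Rintegral => //; first exact: circle_integrable_abs.
  have := integrable_mul _ (fun=> M) _ _ (circle_integrable_abs _ ki) (@continuous_const _ M).
  by congr (mu.-integrable _ _); apply/funext => y /=; rewrite mulrC.
by move=> y y2; rewrite normrM mulrC ler_wpM2r// hM.
Qed.

Lemma continuous_approximation g e : circle_integrable g -> 0 < e ->
  exists h, continuous h /\ abs_oint (fun y => g y - h y) <= e.
Proof.
move=> gi e0.
have [//||h_ [ch hi]] := @approximation_continuous_integrable R `[0, 2 * pi]%classic g _ _ gi.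
  by rewrite /= lebesgue_measure_itv /= lte_fin twopi_gt0 -EFinD ltry.
move=> /fine_cvgP[_] /cvgrPdist_le /(_ e e0) [N _ hN].
exists (h_ N); split => //; have := hN N (leqnn N).
rewrite sub0r normrN; apply: le_trans; rewrite /abs_oint /oint /Rintegral.
exact: ler_norm.
Qed.

(** Integration by parts for the integral of an integrable function, by density:
    it is classical when g is continuous, and both sides are continuous in g for
    the L^1 norm. *)
Lemma primitive_weak g H : circle_integrable g -> oint g = 0 -> continuous H ->
  (forall y, 0 <= y <= 2 * pi -> H y = Rintegral mu `[0, y] g) -> real_weak_deriv H g.
Proof.
move=> gi g0 cH HE p p' Cp; have cp := C1circle_cont _ _ Cp; have cp' := C1circle_deriv _ _ Cp.
apply/eqP; rewrite -subr_eq0 opprK -normr_le0.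
have [M [M0 hM]] := continuous_bounded p 0 (2 * pi) cp.
have [M' [M'0 hM']] := continuous_bounded p' 0 (2 * pi) cp'.
have T0 := @twopi_gt0 R.
apply/ler_addgt0Pr => e e0; rewrite add0r.
pose d := e / (2 * pi * M' + 2 * M + 1).
have c0 : 0 < 2 * pi * M' + 2 * M + 1.
  have h1 : 0 <= 2 * pi * M' by rewrite mulr_ge0// ltW.
  lra.
have d0 : 0 < d by rewrite divr_gt0.
have [h [ch hd]] := continuous_approximation _ _ gi d0.
have hi := continuous_circle_integrable _ ch.
have ghi : circle_integrable (fun y => g y - h y) by exact: circle_integrableB.
have [F dF] := primitive_exists _ ch.
have cF : continuous F.
  by move=> y; apply: differentiable_continuous; apply/derivable1_diffP; have [] := dF y.
pose K y := F y - F 0.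
have cK : continuous K by apply: continuous_add => //; exact: (@continuous_const _ (- F 0)).
have KE y : 0 <= y <= 2 * pi -> K y = Rintegral mu `[0, y] h.
  move=> /andP[]; rewrite le_eqVlt => /predU1P[<- _|y0 y2].
    by rewrite set_itv1 Rintegral_set1 /K subrr.
  rewrite /Rintegral (@continuous_FTC2 _ _ F 0 y y0)//; first exact: continuous_within.
  - split=> [z _| |]; first by have [] := dF z.
      exact/cvg_at_right_filter/cF.
    exact/cvg_at_left_filter/cF.
  - by move=> z _; rewrite derive1E; have [_ ->] := dF z.
have HK y : `[0, 2 * pi]%classic y -> `|H y - K y| <= d.
  rewrite /= in_itv /= => y02; rewrite HE// KE//; have /andP[y0 y2] := y02.
  have sub : `[0, y] `<=` `[0, 2 * pi]%classic by apply: subset_itvl; rewrite bnd_simp.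
  rewrite -RintegralB//; [|exact: integrableS gi|exact: integrableS hi].
  have ghy : mu.-integrable `[0, y] (EFin \o (fun y => g y - h y)) by exact: integrableS ghi.
  apply: (le_trans (le_normr_Rintegral _ ghy)) => //; apply: le_trans hd.
  rewrite /abs_oint /oint /Rintegral; apply: fine_le.
  - by apply: integrable_fin_num => //; exact: (integrable_abse ghy).
  - by apply: integrable_fin_num => //; exact: (circle_integrable_abs _ ghi).
  apply: ge0_subset_integral => //.
  have := circle_integrable_abs _ ghi; exact: measurable_int.
have parts : oint (fun y => K y * p' y) = oint h * p (2 * pi) - oint (fun y => h y * p y).
  have hK : oint h = K (2 * pi) by rewrite KE// ltW//= lexx.
  have [pp dp _] := Cp.
  rewrite hK /oint (@Rintegration_by_parts R K p h p' 0 (2 * pi) T0).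
  - by rewrite {2}/K subrr mul0r subr0.
  - exact: continuous_within.
  - split=> [z _| |].
      by apply: derivableB; [have [] := dF z | exact: derivable_cst].
      exact/cvg_at_right_filter/cK.
    exact/cvg_at_left_filter/cK.
  - move=> z _; rewrite derive1E deriveB; [|by have [] := dF z|exact: derivable_cst].
    by rewrite derive_cst subr0; have [_ ->] := dF z.
  - exact: continuous_within.
  - split=> [z _| |]; first by have [] := dp z.
      exact/cvg_at_right_filter/cp.
    exact/cvg_at_left_filter/cp.
  - by move=> z _; rewrite derive1E; have [_ ->] := dp z.
have E : oint (fun y => H y * p' y) + oint (fun y => g y * p y) =
  oint (fun y => (H y - K y) * p' y) - oint (fun y => g y - h y) * p (2 * pi)
  + oint (fun y => (g y - h y) * p y).
  have -> : (fun y => (H y - K y) * p' y) = fun y => H y * p' y - K y * p' y.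
    by apply/funext => y; ring.
  have -> : (fun y => (g y - h y) * p y) = fun y => g y * p y - h y * p y.
    by apply/funext => y; ring.
  rewrite !ointB//; first by rewrite parts g0; ring.
  - exact: integrable_mul.
  - exact: integrable_mul.
  - by apply: continuous_circle_integrable; exact: continuous_mul.
  - by apply: continuous_circle_integrable; exact: continuous_mul.
rewrite E.
have p2 : `|p (2 * pi)| <= M by apply: hM; rewrite /= in_itv /= lexx ltW.
have e1 : `|oint (fun y => (H y - K y) * p' y)| <= d * (2 * pi * M').
  have cHK : continuous (fun y => H y - K y) by apply: continuous_add => //; exact: continuous_opp.
  have HKi := continuous_circle_integrable _ cHK.
  apply: (le_trans (oint_mul_bound _ _ _ HKi cp' hM')).
  rewrite (_ : d * _ = M' * (d * (2 * pi))); last by ring.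
  rewrite ler_wpM2l// -oint_cst; apply: le_Rintegral => //.
    exact: circle_integrable_abs.
  exact: circle_integrable_cst.
have e2 : `|oint (fun y => g y - h y) * p (2 * pi)| <= d * M.
  rewrite normrM; apply: ler_pM => //; apply: le_trans hd.
  exact: (le_normr_Rintegral _ ghi).
have e3 : `|oint (fun y => (g y - h y) * p y)| <= d * M.
  by apply: (le_trans (oint_mul_bound _ _ _ ghi cp hM)); rewrite mulrC ler_wpM2r.
have dE : d * (2 * pi * M' + 2 * M + 1) = e by rewrite /d divfK ?gt_eqF.
apply: (le_trans (ler_normD _ _)); apply: (@le_trans _ _ (d * (2 * pi * M') + d * M + d * M)).
  by apply: lerD => //; apply: (le_trans (ler_normB _ _)); exact: lerD.
rewrite -dE; move: (ltW d0); lra.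
Qed.

(** The representative is the primitive of g.  It is built from g restricted to
    one period, which makes it vanish to the left of 0 and, g having mean
    zero, to the right of the period; it then extends periodically. *)
Lemma weak_continuous f g : circle_integrable f -> circle_integrable g -> real_weak_deriv f g ->
  exists F, [/\ continuous F, periodic F (2 * pi) & ae_circle f F].
Proof.
move=> fi gi fg; have T0 := @twopi_gt0 R; have g0 := weak_mean0 _ _ fg.
pose gp := g \_ `]0, 2 * pi[.
have sub : (`]0, 2 * pi[ : set R) `<=` `[0, 2 * pi]%classic.
  by move=> y /=; rewrite !in_itv /= => /andP[y0 y2]; rewrite !ltW.
have gpi : mu.-integrable setT (EFin \o gp).
  rewrite /gp -restrict_EFin; apply/(integrable_mkcond _ _).1 => //.
  exact: integrableS gi.
pose H y := Rintegral mu `[-1, y] gp.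
have H0 y : y <= 0 -> H y = 0.
  move=> y0; rewrite /H -[RHS](mul0r (fine (mu `[-1, y]%classic))) -Rintegral_cst//.
  apply: eq_Rintegral => z; rewrite inE /= in_itv /= => /andP[_ zy].
  rewrite /gp /patch memNset//= in_itv /= => /andP[z0 _].
  by have := lt_le_trans z0 (le_trans zy y0); rewrite ltxx.
have gsub : mu.-integrable `]0, 2 * pi[ (EFin \o g) by exact: integrableS gi.
have full : Rintegral mu `]0, 2 * pi[ g = Rintegral mu `[0, 2 * pi] g.
  rewrite -Rintegral_itv_obnd_cbnd; first by rewrite Rintegral_itv_bndo_bndc.
  by apply: integrableS gi => // y /=; rewrite !in_itv /= => /andP[y0 ->]; rewrite ltW.
have HI y : H y = Rintegral mu (`[-1, y] `&` `]0, 2 * pi[) g.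
  by rewrite Rintegral_mkcondr.
have past y : 2 * pi <= y -> H y = Rintegral mu `[0, 2 * pi] g.
  move=> y2; rewrite HI setIidr// => z /=; rewrite !in_itv /= => /andP[z0 z2].
  by rewrite (le_trans (ltW z2) y2) andbT; lra.
have HE y : 0 <= y <= 2 * pi -> H y = Rintegral mu `[0, y] g.
  move=> /andP[y0]; rewrite le_eqVlt => /predU1P[->|y2]; first exact: past.
  rewrite HI (_ : _ `&` _ = `]0, y]%classic); last first.
    apply/seteqP; split => z /=; rewrite !in_itv /=.
      by move=> [/andP[_ zy] /andP[z0 _]]; rewrite z0.
    by move=> /andP[z0 zy]; rewrite z0 zy (le_lt_trans zy)// andbT; split => //; lra.
  rewrite Rintegral_itv_obnd_cbnd//; apply: integrableS gi => // z /=.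
  by rewrite !in_itv /= => /andP[z0 zy]; rewrite ltW//= (le_trans zy)// ltW.
have H2 y : 2 * pi <= y -> H y = 0 by move=> /past ->.
have cH : continuous H.
  move=> y; have [y0|y0] := ltP y 0.
    rewrite /continuous_at (H0 y (ltW y0)); apply: cvg_near_cst; near=> z.
    by apply: H0; apply: ltW; near: z; exact: lt_nbhsl.
  have y1 : -1 <= y + 1 by lra.
  have gpy : mu.-integrable `[-1, y + 1] (EFin \o gp) by exact: integrableS gpi.
  have cw := parameterized_integral_continuous y1 gpy.
  have y1y : (-1 : R) < y + 1 by lra.
  apply: (within_continuous_continuous y1y cw).
  by rewrite in_itv /=; apply/andP; split; lra.
have [F [cF pF FE]] := periodic_extension _ cH H0 H2.
have Fg : real_weak_deriv F g by apply: primitive_weak => // y y02; rewrite FE// HE.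
have [c hc] := weak_difference _ _ _ fi gi cF fg Fg.
exists (fun y => F y + c); split => //; last by move=> y; rewrite pF.
by apply: continuous_add => //; exact: continuous_const.
Unshelve. all: by end_near. Qed.

End weak_derivatives.

(** * Classical representatives *)

Section representatives.
Local Open Scope classical_set_scope.
Context {R : realType}.
Implicit Types (f g : R -> R[i]) (p q : R -> R) (b : bool).
Notation mu := (@lebesgue_measure R).

Definition part b (z : R[i]) : R := if b then complex.Re z else complex.Im z.
Definition component f b y := part b (f y).

Definition L2real p := measurable_fun `[0, 2 * pi]%classic p /\
  circle_integrable (fun y => p y ^+ 2).

Lemma circle_integrableD p q : circle_integrable p -> circle_integrable q ->
  circle_integrable (fun y => p y + q y).
Proof.
move=> fi gi; rewrite /circle_integrable.
rewrite (_ : _ \o _ = (EFin \o p) \+ (EFin \o q))%E; first exact: integrableD.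
by apply/funext => y; rewrite /= EFinD.
Qed.

Lemma circle_integrableZ (a : R) p : circle_integrable p ->
  circle_integrable (fun y => a * p y).
Proof.
move=> ip; have := integrable_mul _ (fun=> a) _ _ ip (@continuous_const _ a).
by congr (mu.-integrable _ _); apply/funext => y /=; rewrite mulrC.
Qed.

Lemma circle_integrable_le p q : measurable_fun `[0, 2 * pi]%classic p ->
  circle_integrable q -> (forall y, `|p y| <= q y) -> circle_integrable p.
Proof.
move=> mp iq pq; apply: (le_integrable _ _ _ iq) => //; first exact/measurable_EFinP.
by move=> y _; rewrite /= lee_fin (le_trans (pq y))// ler_norm.
Qed.

Lemma L2real_integrable p : L2real p -> circle_integrable p.
Proof.
move=> [mp ip].
apply: (@circle_integrable_le _ (fun y => 1 + p y ^+ 2)) => //.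
  by apply: circle_integrableD => //; exact: circle_integrable_cst.
move=> y; have := sqr_ge0 (`|p y| - 1); rewrite -[p y ^+ 2]real_normK ?num_real//.
have := normr_ge0 (p y); nra.
Qed.

Lemma L2real_lin (a c : R) p q : L2real p -> L2real q -> L2real (fun y => a * p y + c * q y).
Proof.
move=> [mp ip] [mq iq]; split.
  by apply: measurable_funD; apply: measurable_funM => //; exact: measurable_cst.
apply: (@circle_integrable_le _ (fun y => 2 * a ^+ 2 * p y ^+ 2 + 2 * c ^+ 2 * q y ^+ 2)).
- apply: measurable_funX.
  by apply: measurable_funD; apply: measurable_funM => //; exact: measurable_cst.
- by apply: circle_integrableD; exact: circle_integrableZ.
move=> y; rewrite ger0_norm ?sqr_ge0//.
have := sqr_ge0 (a * p y - c * q y); lra.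
Qed.

Lemma L2real_mul p q : L2real p -> continuous q -> L2real (fun y => q y * p y).
Proof.
move=> [mp ip] cq; split.
  apply: measurable_funM => //; apply: measurable_funTS; exact: continuous_measurable_fun.
have := integrable_mul _ (fun y => q y ^+ 2) _ _ ip (continuous_expn _ _ cq).
by apply: eq_integrable => // y _ /=; rewrite exprMn mulrC.
Qed.

Lemma L2_comp f b : L2 f -> L2real (component f b).
Proof.
move=> [pf mr mi fi]; have mb : measurable_fun setT (component f b) by case: b.
split; first exact: measurable_funTS.
apply: (circle_integrable_le _ _ _ fi).
  by apply: measurable_funX; exact: measurable_funTS.
move=> y; rewrite ger0_norm ?sqr_ge0//.
by case: b {mb}; rewrite /component /= ?lerDl ?lerDr sqr_ge0.
Qed.

Lemma C1circle_test p p' : C1circle p p' -> test_fun p /\ derive1 p = p'.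
Proof.
move=> [pp dp cp].
have E : derive1 p = p' by apply/funext => y; rewrite derive1E; have [_ ->] := dp y.
split; last exact: E.
by split; [exact: pp | move=> y; have [] := dp y | rewrite E].
Qed.

Lemma weak_deriv_comp f g b : is_weak_deriv f g -> real_weak_deriv (component f b) (component g b).
Proof.
move=> fg p p' /C1circle_test [tp pE]; have := fg _ tp; rewrite pE.
rewrite /torus_int => -[h1 h2].
have re (h : R -> R[i]) (q : R -> R) y : complex.Re (h y * (q y)%:C%C) = complex.Re (h y) * q y.
  by case: (h y) => r i /=; rewrite mulr0 subr0.
have im (h : R -> R[i]) (q : R -> R) y : complex.Im (h y * (q y)%:C%C) = complex.Im (h y) * q y.
  by case: (h y) => r i /=; rewrite mulr0 add0r.
case: b; rewrite /oint /component /part.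
  by move: h1; under eq_Rintegral do rewrite re; under [in X in - X]eq_Rintegral do rewrite re.
by move: h2; under eq_Rintegral do rewrite im; under [in X in - X]eq_Rintegral do rewrite im.
Qed.

Lemma H1_weak_deriv f : H1 f -> L2 (weak_deriv f) /\ is_weak_deriv f (weak_deriv f).
Proof.
move=> [_ [g hg]]; rewrite /weak_deriv.
exact: (@xgetPex _ (fun=> 0) [set g | L2 g /\ is_weak_deriv f g] (ex_intro _ g hg)).
Qed.

Lemma ae_oint p q p0 : circle_integrable p -> circle_integrable q -> ae_circle p q ->
  continuous p0 -> oint (fun y => p y * p0 y) = oint (fun y => q y * p0 y).
Proof.
move=> ip iq pq c0; rewrite /oint /Rintegral; congr fine; apply: ae_eq_integral => //.
- by have := integrable_mul _ _ _ _ ip c0; apply: measurable_int.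
- by have := integrable_mul _ _ _ _ iq c0; apply: measurable_int.
by apply: filterS pq; first exact: (ae_filter_ringOfSetsType mu); move=> y hy /hy ->.
Qed.

Lemma ae_weak_r p q q' : circle_integrable q -> circle_integrable q' -> ae_circle q q' ->
  real_weak_deriv p q -> real_weak_deriv p q'.
Proof.
move=> iq iq' qq' pq t t' Ct; rewrite (pq _ _ Ct) (ae_oint _ _ _ iq iq' qq')//.
exact: C1circle_cont Ct.
Qed.

Lemma ae_weak_l p p' q : circle_integrable p -> circle_integrable p' -> ae_circle p p' ->
  real_weak_deriv p q -> real_weak_deriv p' q.
Proof.
move=> ip ip' pp' pq t t' Ct; rewrite -(pq _ _ Ct) (ae_oint _ _ _ ip ip' pp')//.
exact: C1circle_deriv Ct.
Qed.

(** The first weak derivative has an integrable weak derivative, so it is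
    continuous, so f is of class C1. *)
Lemma H2_C1 f : H2 f -> exists w w' : bool -> R -> R,
  [/\ forall b, C1circle (w b) (w' b), forall b, ae_circle (component f b) (w b),
      forall b, ae_circle (component (weak_deriv f) b) (w' b) &
      forall b, real_weak_deriv (w' b) (component (dyy f) b)].
Proof.
move=> [h1f h1g]; have [l2g fg] := H1_weak_deriv _ h1f.
have [l2h gh] := H1_weak_deriv _ h1g; have [l2f _] := h1f.
have main b : exists w w' : R -> R, [/\ C1circle w w', ae_circle (component f b) w,
    ae_circle (component (weak_deriv f) b) w' & real_weak_deriv w' (component (dyy f) b)].
  have fi := L2real_integrable _ (L2_comp _ b l2f).
  have gi := L2real_integrable _ (L2_comp _ b l2g).
  have hi := L2real_integrable _ (L2_comp _ b l2h).
  have [G [cG pG gG]] := weak_continuous _ _ gi hi (weak_deriv_comp _ _ b gh).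
  have Gi := continuous_circle_integrable _ cG.
  have [F [CF fF]] := weak_C1 _ _ fi cG pG (ae_weak_r _ _ _ gi Gi gG (weak_deriv_comp _ _ b fg)).
  exists F, G; split => //; exact: (ae_weak_l _ _ _ gi Gi gG (weak_deriv_comp _ _ b gh)).
have [w1 [w1' [a1 a2 a3 a4]]] := main true; have [w2 [w2' [b1 b2 b3 b4]]] := main false.
by exists (fun b => if b then w1 else w2), (fun b => if b then w1' else w2'); split; case.
Qed.

(** The primitive of (p - q)^2 is monotone and periodic, hence constant. *)
Lemma ae_circle_eq p q : continuous p -> continuous q -> periodic p (2 * pi) ->
  periodic q (2 * pi) -> ae_circle p q -> p = q.
Proof.
move=> cp cq pp pq pqE.
pose k y := (p y - q y) ^+ 2.
have ck : continuous k.
  by apply: continuous_expn; apply: continuous_add => //; exact: continuous_opp.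
have k0 : oint k = 0.
  have [ip iq] := (continuous_circle_integrable _ cp, continuous_circle_integrable _ cq).
  have cpq : continuous (fun y => p y - q y) by apply: continuous_add => //; exact: continuous_opp.
  have h := ae_oint _ _ _ ip iq pqE cpq.
  have -> : k = fun y => p y * (p y - q y) - q y * (p y - q y).
    by apply/funext => y; rewrite /k; ring.
  rewrite ointB ?h ?subrr//; exact: integrable_mul.
have pk : periodic k (2 * pi) by move=> y; rewrite /k pp pq.
have [F [pF dF _]] := C1circle_primitive _ ck pk k0.
have mono (x y : R) : x <= y -> F x <= F y.
  move=> xy; have cF : continuous F.
    move=> z; apply: differentiable_continuous.
    by apply/derivable1_diffP; have [] := dF z.
  have [c _ E] := @MVT_segment R F k x y xy (fun z _ => dF z) (continuous_within _ _ cF).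
  by rewrite -subr_ge0 E mulr_ge0 ?sqr_ge0// subr_ge0.
have pi0 : 0 < pi :> R by exact: pi_gt0.
apply/funext => z; apply/eqP; rewrite -subr_eq0 -sqrf_eq0 -/(k z).
have : is_derive z 1 F 0.
  have : is_derive z 1 (fun=> F (z - pi)) 0 by exact: is_derive_cst.
  apply: near_eq_is_derive; near=> y.
  have y1 : z - pi <= y by apply: ltW; near: y; apply: lt_nbhsr; lra.
  have y2 : y <= z + pi by apply: ltW; near: y; apply: lt_nbhsl; lra.
  apply/eqP; rewrite eq_le mono//= -(pF (z - pi)) mono//; lra.
by move=> [_ h]; have [_ <-] := dF z; rewrite h.
Unshelve. all: by end_near. Qed.

End representatives.

(** * The starred norm *)

Section norms.
Local Open Scope classical_set_scope.
Context {R : realType}.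
Implicit Types (f g : R -> R[i]) (p q : R -> R) (b : bool).
Notation mu := (@lebesgue_measure R).

Lemma L2real_prod p q : L2real p -> L2real q -> circle_integrable (fun y => p y * q y).
Proof.
move=> [mp ip] [mq iq].
apply: (@circle_integrable_le _ _ (fun y => p y ^+ 2 + q y ^+ 2)).
- exact: measurable_funM.
- exact: circle_integrableD.
move=> y; rewrite normrM -[p y ^+ 2]real_normK ?num_real// -[q y ^+ 2]real_normK ?num_real//.
have := sqr_ge0 (`|p y| - `|q y|); have := sqr_ge0 (`|p y|); have := sqr_ge0 (`|q y|); lra.
Qed.

Lemma continuous_L2real p : continuous p -> L2real p.
Proof.
move=> cp; split; first by apply: measurable_funTS; exact: continuous_measurable_fun.
by apply: continuous_circle_integrable; exact: continuous_expn.
Qed.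

Lemma Re_inner f g : (forall b, L2real (component f b)) -> (forall b, L2real (component g b)) ->
  complex.Re (inner f g) = oint2 (fun b y => component f b y * component g b y).
Proof.
move=> hf hg; rewrite /oint2 -ointD_integrable; [|exact: L2real_prod..].
apply: eq_Rintegral => y _; rewrite /component /part.
by case: (f y) (g y) => [a1 a2] [c1 c2] /=; ring.
Qed.

Lemma helmholtz_inv_cases (beta : R) f :
  helmholtz_inv beta f = (fun=> 0) \/
  H2 (helmholtz_inv beta f) /\ {ae mu, forall y,
    (beta ^+ 2)%:C%C * helmholtz_inv beta f y - dyy (helmholtz_inv beta f) y = f y}.
Proof.
rewrite /helmholtz_inv; case: xgetP => [u _ hu|_]; [by right | by left].
Qed.

Lemma part_helmholtz (b2 : R) (x z w : R[i]) b : b2%:C%C * x - z = w ->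
  part b z = b2 * part b x - part b w.
Proof.
by move=> <-; case: b x z => -[x1 x2] [z1 z2] /=; ring.
Qed.

Lemma oint2_young_L2 (t : R) (p q : bool -> R -> R) : 0 < t ->
  (forall b, L2real (p b)) -> (forall b, L2real (q b)) ->
  2 * oint2 (fun b y => p b y * q b y) <= t * sqnorm p + t^-1 * sqnorm q.
Proof.
move=> t0 hp hq; rewrite /sqnorm /oint2.
have main b : 2 * oint (fun y => p b y * q b y) <=
    t * oint (fun y => p b y ^+ 2) + t^-1 * oint (fun y => q b y ^+ 2).
  have [_ ip] := hp b; have [_ iq] := hq b; have ipq := L2real_prod _ _ (hp b) (hq b).
  rewrite /oint -!RintegralZl// -RintegralD//; [|exact: circle_integrableZ..].
  apply: le_Rintegral => //; first exact: circle_integrableZ.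
    by apply: circle_integrableD; exact: circle_integrableZ.
  by move=> y _; exact: young.
have := main true; have := main false; lra.
Qed.

(** With U the Helmholtz inverse of f, <f, U> = b^2 |U|^2 + |U'|^2, and also
    2 <f, U> <= b^-2 |f|^2 + b^2 |U|^2; together they give
    <f, U> <= b^-2 |f|^2.  When U is the default value 0, the starred norm is the
    L^2 norm and the bound is plain. *)
Lemma norm_star_ge (beta : R) f : 1 < beta ^+ 2 -> (forall b, L2real (component f b)) ->
  (1 - beta ^- 2) * sqnorm (component f) <=
  complex.Re (inner f (fun y => f y - helmholtz_inv beta f y)).
Proof.
move=> b1 hf; set B := beta ^+ 2 in b1 *.
have B0 : 0 < B by apply: lt_trans b1.
have N0 := sqnorm_ge0 (component f).
case: (helmholtz_inv_cases beta f) => [->|[hU eU]].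
  have -> : (fun y => f y - 0) = f by apply/funext => y; rewrite subr0.
  rewrite Re_inner// -[leRHS]mul1r [X in _ <= 1 * X](_ : _ = sqnorm (component f)).
    by rewrite ler_wpM2r// lerBlDr lerDl invr_ge0 ltW.
  by congr oint2; apply/funext => b; apply/funext => y; rewrite expr2.
set U := helmholtz_inv beta f in hU eU *.
have [u [u' [Cu aeu _ wu]]] := H2_C1 _ hU.
have [[l2U _] [l2gU _]] := hU.
have hUc b : L2real (component U b) := L2_comp _ b l2U.
have hU2 b : L2real (component (dyy U) b).
  by have [h2g _] := H1_weak_deriv _ (proj2 hU); exact: L2_comp.
have cu b := C1circle_cont _ _ (Cu b); have cu' b := C1circle_deriv _ _ (Cu b).
have hu b : L2real (u b) := continuous_L2real _ (cu b).
have hfU b : L2real (component (fun y => f y - U y) b).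
  have -> : component (fun y => f y - U y) b = fun y => 1 * component f b y + -1 * component U b y.
    apply/funext => y; rewrite /component; case: b (f y) (U y) => -[a1 a2] [c1 c2] /=; ring.
  exact: L2real_lin.
rewrite Re_inner//.
have E : oint2 (fun b y => component f b y * component (fun y => f y - U y) b y) =
    sqnorm (component f) - oint2 (fun b y => component f b y * u b y).
  rewrite /sqnorm /oint2.
  have main b : oint (fun y => component f b y * component (fun y => f y - U y) b y) =
      oint (fun y => component f b y ^+ 2) - oint (fun y => component f b y * u b y).
    rewrite -ointB; [|by have [] := hf b|exact: L2real_prod].
    rewrite /oint /Rintegral; congr fine; apply: ae_eq_integral => //.
    - by have := L2real_prod _ _ (hf b) (hfU b); apply: measurable_int.
    - have := circle_integrableB _ _ (proj2 (hf b)) (L2real_prod _ _ (hf b) (hu b)).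
      by apply: measurable_int.
    apply: filterS (aeu b); first exact: (ae_filter_ringOfSetsType mu).
    move=> y hy /hy <-; congr (_%:E); rewrite /component.
    by case: b {hy} (f y) (U y) => -[a1 a2] [c1 c2] /=; ring.
  by rewrite !main; ring.
have fu b : oint (fun y => component f b y * u b y) =
    B * oint (fun y => u b y ^+ 2) + oint (fun y => u' b y ^+ 2).
  have [iu ifu] : circle_integrable (u b) /\ circle_integrable (component f b).
    by split; exact: L2real_integrable.
  have hw : ae_circle (component f b) (fun y => B * component U b y - component (dyy U) b y).
    apply: filterS eU; first exact: (ae_filter_ringOfSetsType mu).
    by move=> y hy _; rewrite /component (part_helmholtz _ _ _ _ b hy) -/B; ring.
  have hD : circle_integrable (fun y => B * component U b y - component (dyy U) b y).
    by apply: circle_integrableB; [apply: circle_integrableZ|]; exact: L2real_integrable.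
  rewrite (ae_oint _ _ _ ifu hD hw (cu b)).
  have -> : (fun y => (B * component U b y - component (dyy U) b y) * u b y) =
      fun y => B * (component U b y * u b y) - component (dyy U) b y * u b y.
    by apply/funext => y; ring.
  have iUu := L2real_prod _ _ (hUc b) (hu b).
  rewrite ointB; [|exact: circle_integrableZ|exact: L2real_prod].
  rewrite /oint RintegralZl// -!/(oint _) (ae_oint _ _ _ _ iu (aeu b) (cu b)); last first.
    exact: L2real_integrable.
  have := wu b _ _ (Cu b) => /eqP; rewrite eq_sym eqr_oppLR => /eqP ->.
  rewrite opprK; congr (B * _ + _); by congr oint; apply/funext => y; rewrite expr2.
have fuE : oint2 (fun b y => component f b y * u b y) = B * sqnorm u + sqnorm u'.
  by rewrite /sqnorm /oint2 !fu; ring.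
have Bi : 0 < B^-1 by rewrite invr_gt0.
have := oint2_young_L2 _ (component f) u Bi hf hu; rewrite invrK E fuE.
have := sqnorm_ge0 u'; lra.
Qed.

End norms.

(** * The rescaled resolvent bound *)

Section resolvent.
Local Open Scope classical_set_scope.
Context {R : realType}.

(** The constants in the order in which they are chosen: the number n of scales,
    the largest scale sg0, and finally L.  They make each of the three
    terms 16 / n, sg0 / 2 and 57 / (sg1^2 L) of the averaged Howard bound at most
    k0^3 / 400, where sg1 = sg0 / 2^n is the smallest scale. *)
Lemma constants_exist (k0 : R) : 0 < k0 <= 1 -> exists (n : nat) (sg0 L : R),
  [/\ 128 * 50 <= n%:R * k0 ^+ 3, 0 < sg0, 200 * sg0 <= k0 ^+ 3,
      57 * 400 <= k0 ^+ 3 * (sg0 / 2 ^+ n) ^+ 2 * L & 94 <= L].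
Proof.
move=> /andP[k00 k01]; have K0 : 0 < k0 ^+ 3 by rewrite exprn_gt0.
pose n := (Num.truncn (128 * 50 / k0 ^+ 3)).+1.
pose sg0 := k0 ^+ 3 / 200.
have sg00 : 0 < sg0 by apply: divr_gt0; [exact: K0 | rewrite ltr0n].
pose w := k0 ^+ 3 * (sg0 / 2 ^+ n) ^+ 2.
have w0 : 0 < w by rewrite mulr_gt0// exprn_gt0// divr_gt0// exprn_gt0.
exists n, sg0, (94 + 57 * 400 / w); split => //.
- rewrite -ler_pdivrMr// ltW// /n.
  exact: truncnS_gt.
- by rewrite /sg0; lra.
- rewrite -/w (_ : w * _ = 94 * w + 57 * 400); last by field; rewrite gt_eqF.
  by rewrite lerDr mulr_ge0// ltW.
- by rewrite lerDl; apply: divr_ge0; [apply: mulr_ge0; exact: ler0n | exact: ltW].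
Qed.

(** Complex conjugation changes the signs of S and lam.  In terms of components
    it can be replaced by their exchange, which differs from it by the factor i.
    This reduces negative lam to positive lam. *)
Lemma tested_reflect (S : R -> R) lam v v' u u' d4 N2 : tested S lam v v' u u' d4 N2 ->
  tested (fun y => - S y) (- lam) (fun b => v (~~ b)) (fun b => v' (~~ b))
    (fun b => u (~~ b)) (fun b => u' (~~ b)) d4 N2.
Proof.
move=> h p p' Cp t t0.
have := h (fun b => p (~~ b)) (fun b => p' (~~ b)) (fun b => Cp (~~ b)) t t0.
rewrite /sqnorm (oint2_swap (fun b y => p b y ^+ 2)).
rewrite -(oint2_swap (fun b y => (v' b y + u' b y) * p' (~~ b) y)).
rewrite -(oint2_swap (fun b y => sg b * _ b y * _)).
congr (2 * (d4 * _ + _) <= _); congr oint2; apply/funext => -[]; apply/funext => y //=;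
  by rewrite /sg /inviscid; ring.
Qed.

(** The parameter e is the fourth root of the rescaled viscosity. *)
Definition resolvent_bound (k0 L : R) : Prop :=
  forall (S C : R -> R) (k lam : R) (v v' u u' u'' : bool -> R -> R) (e N2 : R),
  C1circle S C -> C1circle C (fun y => - S y) -> (forall y, S y ^+ 2 + C y ^+ 2 = 1) ->
  (forall b, C1circle (v b) (v' b)) -> (forall b, C1circle (u b) (u' b)) ->
  (forall b, C1circle (u' b) (u'' b)) ->
  (forall b b' y, (v b y - k * u b y + u'' b y) * u b' y = 0) ->
  (forall b b' y, (v b y - k * u b y + u'' b y) * u' b' y = 0) ->
  (forall b b' y, (v b y - k * u b y + u'' b y) * u'' b' y = 0) ->
  k0 <= k -> 0 < e -> 32 * L ^+ 2 * e ^+ 2 <= 1 -> 0 <= N2 ->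
  tested S lam v v' u u' (e ^+ 4) N2 -> e ^+ 4 * sqnorm v / (64 * L ^+ 2) ^+ 2 <= N2.

Lemma resolvent_estimate (k0 : R) : 0 < k0 <= 1 -> exists L : R,
  1 <= L /\ resolvent_bound k0 L.
Proof.
move=> k01; have [n [sg0 [L [hn s00 hs0 hs1 hL]]]] := constants_exist _ k01.
exists L; split; first by lra.
have main (S C : R -> R) (k lam : R) (v v' u u' u'' : bool -> R -> R) (e N2 : R) : 0 <= lam ->
  C1circle S C -> C1circle C (fun y => - S y) -> (forall y, S y ^+ 2 + C y ^+ 2 = 1) ->
  (forall b, C1circle (v b) (v' b)) -> (forall b, C1circle (u b) (u' b)) ->
  (forall b, C1circle (u' b) (u'' b)) ->
  (forall b b' y, (v b y - k * u b y + u'' b y) * u b' y = 0) ->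
  (forall b b' y, (v b y - k * u b y + u'' b y) * u' b' y = 0) ->
  (forall b b' y, (v b y - k * u b y + u'' b y) * u'' b' y = 0) ->
  k0 <= k -> 0 < e -> 32 * L ^+ 2 * e ^+ 2 <= 1 -> 0 <= N2 ->
  tested S lam v v' u u' (e ^+ 4) N2 -> e ^+ 4 * sqnorm v / (64 * L ^+ 2) ^+ 2 <= N2.
  move=> l0 hS hC SC hv hu hu' r0 r1 r2 hk e0 small N0 ht.
  have [//|lt] := leP (e ^+ 4 * sqnorm v / (64 * L ^+ 2) ^+ 2) N2.
  have e40 : 0 < e ^+ 4 by rewrite exprn_gt0.
  have L0 : 0 < (64 * L ^+ 2) ^+ 2 by rewrite exprn_gt0// mulr_gt0// exprn_gt0//; lra.
  have V0 : 0 < sqnorm v.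
    have := le_lt_trans N0 lt; rewrite ltr_pdivlMr// mul0r pmulr_rgt0//.
  exfalso; exact: (resolvent_absurd S C k lam v v' u u' u'' hS hC SC hv hu hu' r0 r1 r2
    (e ^+ 4) N2 ht k0 L e sg0 n k01 hk l0 hL e0 erefl small hn s00 hs0 hs1 (ltW lt) V0).
move=> S C k lam v v' u u' u'' e N2 hS hC SC hv hu hu' r0 r1 r2 hk e0 small N0 ht.
have [l0|l0] := leP 0 lam; first by apply: (main S C k lam v v' u u' u'').
rewrite -[sqnorm v](oint2_swap (fun b y => v b y ^+ 2)).
apply: (main _ (fun y => - C y) k _ (fun b => v (~~ b)) (fun b => v' (~~ b))
  (fun b => u (~~ b)) (fun b => u' (~~ b)) (fun b => u'' (~~ b)) e N2
  _ _ _ _ _ _ _ _ _ _ hk e0 small N0 (tested_reflect _ _ _ _ _ _ _ _ ht)).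
- by rewrite oppr_ge0 ltW.
- exact: C1circleN.
- by have := C1circleN _ _ hC.
- by move=> y; rewrite !sqrrN.
- by move=> b; exact: hv.
- by move=> b; exact: hu.
- by move=> b; exact: hu'.
- by move=> b b' y; exact: r0.
- by move=> b b' y; exact: r1.
- by move=> b b' y; exact: r2.
Qed.

End resolvent.

(** * The operator *)

Section operator.
Local Open Scope classical_set_scope.
Context {R : realType}.
Implicit Types (f g : R -> R[i]) (b : bool).
Notation mu := (@lebesgue_measure R).

Lemma C1circle_sin : C1circle (@sin R) cos.
Proof.
split=> [y|y|]; [by rewrite mulr_natl sinD2pi | exact: is_derive_sin | exact: continuous_cos].
Qed.

Lemma C1circle_cos : C1circle (@cos R) (fun y => - sin y).
Proof.
split=> [y|y|]; [by rewrite mulr_natl cosD2pi | exact: is_derive_cos | ].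
by apply: continuous_opp; exact: continuous_sin.
Qed.

Lemma C1circle_deriv_periodic (p p' : R -> R) : C1circle p p' -> periodic p' (2 * pi).
Proof.
move=> [pp dp _] y.
have : is_derive y 1 (p \o shift (2 * pi)) (p' (y + 2 * pi) * 1).
  exact: (@is_derive1_comp R p (shift (2 * pi)) y _ 1 (dp _) (is_derive_shift y 1 (2 * pi))).
have -> : p \o shift (2 * pi) = p by apply/funext => z; exact: pp.
by rewrite mulr1 => -[_ <-]; have [_ <-] := dp y.
Qed.

(** The second derivative of u is read off from the Helmholtz equation: b^2 u - w
    is continuous and equals the weak second derivative almost everywhere.  The
    relation between w and u is multiplied by u, u' and u'' to be
    true also of the default value u = 0. *)
Lemma helmholtz_profile (beta : R) f : H2 f -> 1 < beta ^+ 2 ->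
  exists w w' u u' u'' : bool -> R -> R,
  [/\ [/\ forall b, C1circle (w b) (w' b), forall b, C1circle (u b) (u' b) &
          forall b, C1circle (u' b) (u'' b)],
      [/\ forall b, ae_circle (component f b) (w b),
          forall b, ae_circle (component (helmholtz_inv beta f) b) (u b) &
          forall b, L2real (component (helmholtz_inv beta f) b)],
      forall b, real_weak_deriv (w' b) (component (dyy f) b) &
      forall b b' y, [/\
        (w b y - u b y - (beta ^+ 2 - 1) * u b y + u'' b y) * u b' y = 0,
        (w b y - u b y - (beta ^+ 2 - 1) * u b y + u'' b y) * u' b' y = 0 &
        (w b y - u b y - (beta ^+ 2 - 1) * u b y + u'' b y) * u'' b' y = 0]].
Proof.
move=> hf b1; have [w [w' [Cw fw _ ww]]] := H2_C1 _ hf.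
case: (helmholtz_inv_cases beta f) => [U0|[hU eU]].
  exists w, w', (fun _ _ => 0), (fun _ _ => 0), (fun _ _ => 0); split => //.
  - by split => // b; exact: C1circle_cst.
  - split => // b; rewrite U0; first by apply: aeW => y _; case: b.
    have -> : component (fun=> 0) b = fun=> 0 :> R by apply/funext => y; case: b.
    by apply: continuous_L2real; exact: continuous_const.
  - by move=> b b' y; rewrite !mulr0.
have [u [u' [Cu Uu gu wu]]] := H2_C1 _ hU.
have hUc b : L2real (component (helmholtz_inv beta f) b).
  by have [[l2U _] _] := hU; exact: L2_comp.
have hU2 b : L2real (component (dyy (helmholtz_inv beta f)) b).
  by have [h2g _] := H1_weak_deriv _ (proj2 hU); exact: L2_comp.
pose u'' b y := beta ^+ 2 * u b y - w b y.
have cu b := C1circle_cont _ _ (Cu b); have cw b := C1circle_cont _ _ (Cw b).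
have cu'' b : continuous (u'' b).
  apply: continuous_add; last exact: continuous_opp.
  by apply: continuous_mul => //; exact: continuous_const.
have Cu' b : C1circle (u' b) (u'' b).
  have ae2 : ae_circle (component (dyy (helmholtz_inv beta f)) b) (u'' b).
    move: eU (Uu b) (fw b); apply: filterS3; first exact: (ae_filter_ringOfSetsType mu).
    move=> y hy hu hw y2; by rewrite /component (part_helmholtz _ _ _ _ b hy) /u'' -hu// -hw.
  have pu'' : periodic (u'' b) (2 * pi).
    by move=> y; have [pu _ _] := Cu b; have [pw _ _] := Cw b; rewrite /u'' pu pw.
  have cu' := C1circle_deriv _ _ (Cu b).
  have pu' := C1circle_deriv_periodic _ _ (Cu b).
  have [F [CF uF]] := weak_C1 _ _ (continuous_circle_integrable _ cu') (cu'' b) pu''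
    (ae_weak_r _ _ _ (L2real_integrable _ (hU2 b)) (continuous_circle_integrable _ (cu'' b))
      ae2 (wu b)).
  have [pF _ _] := CF.
  by rewrite (ae_circle_eq _ _ cu' (C1circle_cont _ _ CF) pu' pF uF).
exists w, w', u, u', u''; split => // b b' y; rewrite /u''; split; ring.
Qed.

Lemma part_operator (a s l : R) (z x y : R[i]) b :
  part b (- a%:C%C * z + 'i%C * s%:C%C * x - 'i%C * l%:C%C * y) =
  - a * part b z - sg b * (s * part (~~ b) x - l * part (~~ b) y).
Proof. by case: b z x y => -[z1 z2] [x1 x2] [y1 y2] /=; ring. Qed.

Lemma part_sub (x y : R[i]) b : part b (x - y) = part b x - part b y.
Proof. by case: b x y => -[x1 x2] [y1 y2]. Qed.

(** b^2 = n / kf^2 for an integer n.  If kf < 1 then n >= 1 and b^2 >= kf^-2 > 1;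
    if kf = 1 then b^2 > 1 means n >= 2. *)
Lemma beta_gap (kf : R) : 0 < kf <= 1 -> exists k0 : R, 0 < k0 <= 1 /\
  forall k1 k3 : int, 1 < beta kf k1 k3 ^+ 2 -> k0 <= beta kf k1 k3 ^+ 2 - 1.
Proof.
move=> /andP[kf0 kf1].
have kf2 : 0 < kf ^+ 2 by rewrite exprn_gt0.
have betaE k1 k3 : beta kf k1 k3 ^+ 2 = (k1 ^+ 2 + k3 ^+ 2)%:~R / kf ^+ 2.
  rewrite /beta sqr_sqrtr; last by rewrite divr_ge0 ?addr_ge0 ?sqr_ge0.
  by rewrite intrD !rmorphXn.
have [kf_lt1|kf_ge1] := ltP kf 1.
  have i1 : 1 < (kf ^+ 2)^-1 by rewrite invf_gt1// exprn_ilt1// ltW.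
  exists (Num.min 1 ((kf ^+ 2)^-1 - 1)); split.
    by rewrite lt_min ltr01 subr_gt0 i1 ge_min lexx.
  move=> k1 k3; rewrite betaE; set n : int := k1 ^+ 2 + k3 ^+ 2 => hn.
  rewrite ltr_pdivlMr// mul1r in hn.
  have n1 : (1 : R) <= n%:~R.
    have n0 : 0 < n by rewrite -(ltr0z R); exact: lt_trans kf2 hn.
    have n1 : 1 <= n by lia.
    by move: n1; rewrite -(ler_int R).
  rewrite ge_min; apply/orP; right; rewrite lerB//.
  by rewrite ler_peMl// ltW// invr_gt0.
have kfE : kf = 1 by apply/eqP; rewrite eq_le kf1.
exists 1; split; first by rewrite ltr01 lexx.
move=> k1 k3; rewrite betaE kfE; set n : int := k1 ^+ 2 + k3 ^+ 2.
rewrite expr1n divr1 => hn.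
have n1 : 1 < n by rewrite -(ltr_int R).
have n2 : 2 <= n by lia.
by move: n2; rewrite -(ler_int R); lra.
Qed.

(** The weak form of the operator: the second derivative of f is integrated by
    parts, and f and its Helmholtz inverse are replaced by their continuous
    representatives. *)
Lemma oint2_operator (a s l : R) (F : R -> R[i]) f (beta : R)
  (w w' u p p' : bool -> R -> R) (g : R -> R) :
  continuous g ->
  (forall b y, component F b y = - a * component (dyy f) b y
     - sg b * (s * g y * (component f (~~ b) y - component (helmholtz_inv beta f) (~~ b) y)
               - l * component f (~~ b) y)) ->
  (forall b, L2real (component f b)) -> (forall b, L2real (component (helmholtz_inv beta f) b)) ->
  (forall b, L2real (component (dyy f) b)) ->
  (forall b, C1circle (w b) (w' b)) -> (forall b, continuous (u b)) ->
  (forall b, ae_circle (component f b) (w b)) ->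
  (forall b, ae_circle (component (helmholtz_inv beta f) b) (u b)) ->
  (forall b, real_weak_deriv (w' b) (component (dyy f) b)) ->
  (forall b, C1circle (p b) (p' b)) ->
  (forall b, L2real (component F b)) /\
  oint2 (fun b y => component F b y * p b y) =
  a * oint2 (fun b y => w' b y * p' b y)
  + oint2 (fun b y => sg b * (s * g y * (w b y - u b y) - l * w b y) * p (~~ b) y).
Proof.
move=> cg FE lf lU lh Cw cu fw Uu ww Cp.
have hF b : L2real (component F b).
  have -> : component F b = fun y => - a * component (dyy f) b y + 1 *
    (- sg b * s * (g y * (1 * component f (~~ b) y
       + -1 * component (helmholtz_inv beta f) (~~ b) y)) + sg b * l * component f (~~ b) y).
    by apply/funext => y; rewrite FE; ring.
  apply: L2real_lin => //; apply: L2real_lin => //; apply: L2real_mul => //.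
  exact: L2real_lin.
split => //.
have cw b := C1circle_cont _ _ (Cw b); have cp b := C1circle_cont _ _ (Cp b).
have cG b : continuous (fun y => s * g y * (w b y - u b y) - l * w b y).
  apply: continuous_add; last first.
    by apply: continuous_opp; apply: continuous_mul => //; exact: continuous_const.
  apply: continuous_mul; first by apply: continuous_mul => //; exact: continuous_const.
  by apply: continuous_add => //; exact: continuous_opp.
have main b : oint (fun y => component F b y * p b y) = a * oint (fun y => w' b y * p' b y)
   - sg b * oint (fun y => (s * g y * (w (~~ b) y - u (~~ b) y) - l * w (~~ b) y) * p b y).
  have hi := L2real_integrable _ (lh b).
  have Gi := continuous_circle_integrable _ (cG (~~ b)).
  have D : ae_circle (component F b) (fun y => - a * component (dyy f) b y
      - sg b * (s * g y * (w (~~ b) y - u (~~ b) y) - l * w (~~ b) y)).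
    move: (fw (~~ b)) (Uu (~~ b)); apply: filterS2; first exact: (ae_filter_ringOfSetsType mu).
    by move=> y h1 h2 y2; rewrite FE h1// h2.
  have Di : circle_integrable (fun y => - a * component (dyy f) b y
      - sg b * (s * g y * (w (~~ b) y - u (~~ b) y) - l * w (~~ b) y)).
    by apply: circle_integrableB; exact: circle_integrableZ.
  rewrite (ae_oint _ _ _ (L2real_integrable _ (hF b)) Di D (cp b)).
  have -> : (fun y => (- a * component (dyy f) b y
      - sg b * (s * g y * (w (~~ b) y - u (~~ b) y) - l * w (~~ b) y)) * p b y) =
    fun y => - a * (component (dyy f) b y * p b y)
      - sg b * ((s * g y * (w (~~ b) y - u (~~ b) y) - l * w (~~ b) y) * p b y).
    by apply/funext => y; ring.
  have hp : circle_integrable (fun y => component (dyy f) b y * p b y) by exact: integrable_mul.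
  have Gp : circle_integrable
      (fun y => (s * g y * (w (~~ b) y - u (~~ b) y) - l * w (~~ b) y) * p b y).
    exact: integrable_mul.
  rewrite ointB; [|exact: circle_integrableZ..].
  rewrite (ww b _ _ (Cp b)) /oint !RintegralZl//; ring.
rewrite /oint2 !main.
have e b : oint (fun y => sg b * (s * g y * (w b y - u b y) - l * w b y) * p (~~ b) y) =
    sg b * oint (fun y => (s * g y * (w b y - u b y) - l * w b y) * p (~~ b) y).
  rewrite -ointZ; last exact: continuous_mul.
  by congr oint; apply/funext => y; rewrite mulrA.
by rewrite !e /sg /=; ring.
Qed.

(** Rescaling.  With a = nu kf^2 and m the modulus of the advection coefficient,
    e^4 = a / m is at most nu^2 / gamma because kf <= 1 <= |k1|, and m a = |k1 gamma|
    accounts for the square root in the bound.  For k1 = 0 the bound is trivial. *)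
Lemma opL_bound (kf nu gamma lambda k0 L : R) (k1 k3 : int) f :
  0 < kf <= 1 -> 0 < k0 <= 1 -> 1 <= L -> 0 < nu -> (32 * L ^+ 2) ^+ 2 * nu ^+ 2 <= gamma ->
  1 < beta kf k1 k3 ^+ 2 -> k0 <= beta kf k1 k3 ^+ 2 - 1 -> H2 f ->
  norm_star (beta kf k1 k3) f = 1 ->
  resolvent_bound k0 L ->
  k0 / 2 / (64 * L ^+ 2) * Num.sqrt `|k1%:~R * gamma| * (1 - beta kf k1 k3 ^- 2) <=
  norm_star (beta kf k1 k3)
    (fun y => opL kf nu gamma k1 k3 f y - 'i%C * lambda%:C%C * f y).
Proof.
move=> /andP[kf0 kf1] /andP[k00 k01] L1 nu0 hg b1 hk hf n1 est.
have L0 : 0 < L by exact: lt_le_trans L1.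
have L20 : 0 < 64 * L ^+ 2 by rewrite mulr_gt0// exprn_gt0.
have nu2 : 0 < nu ^+ 2 by rewrite exprn_gt0.
have gamma0 : 0 < gamma.
  by apply: lt_le_trans hg; rewrite mulr_gt0// exprn_gt0// mulr_gt0// exprn_gt0.
have [->|k1n0] := eqVneq k1 0.
  by rewrite mul0r normr0 sqrtr0 mulr0 mul0r sqrtr_ge0.
set bt := beta kf k1 k3 in b1 hk n1 *.
have [w [w' [u [u' [u'' [[Cw Cu Cu'] [fw Uu lU] ww rel]]]]]] := helmholtz_profile _ _ hf b1.
pose a := nu * kf ^+ 2.
pose c1 := k1%:~R / kf ^+ 2 * (gamma / nu) : R.
pose m := `|c1|.
have k1R : (k1%:~R : R) != 0 by rewrite intr_eq0.
have c10 : c1 != 0.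
  apply: mulf_neq0; apply: mulf_neq0 => //; rewrite ?invr_neq0//.
  - by rewrite expf_neq0// gt_eqF.
  - by rewrite gt_eqF.
  - by rewrite gt_eqF.
have m0 : 0 < m by rewrite normr_gt0.
pose s := Num.sg c1.
have s2 : s ^+ 2 = 1 by rewrite /s sqr_sg c10.
have smE : s * m = c1 by rewrite /s /m -numEsg.
have a0 : 0 < a by rewrite mulr_gt0// exprn_gt0.
have am0 : 0 < a / m by rewrite divr_gt0.
pose e := Num.sqrt (Num.sqrt (a / m)).
have e0 : 0 < e by rewrite !sqrtr_gt0.
have e2 : e ^+ 2 = Num.sqrt (a / m) by rewrite sqr_sqrtr// sqrtr_ge0.
have e4 : e ^+ 4 = a / m by rewrite (exprM e 2 2) e2 sqr_sqrtr// ltW.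
have mE : m = `|k1%:~R| / kf ^+ 2 * (gamma / nu).
  rewrite /m /c1 !normrM (gtr0_norm gamma0) !normfV (gtr0_norm nu0).
  by rewrite (ger0_norm (sqr_ge0 kf)).
have k1ge1 : 1 <= `|k1%:~R : R|.
  by rewrite -intr_norm -[1]/(1%:~R) ler_int -gtz0_ge1 normr_gt0.
have am : a / m <= nu ^+ 2 / gamma.
  have kf2 : 0 < kf ^+ 2 by rewrite exprn_gt0.
  have kf4 : kf ^+ 2 * kf ^+ 2 <= 1 by rewrite -expr2 -exprM exprn_ile1// ltW.
  rewrite ler_pdivrMr// /a mE.
  rewrite (_ : nu ^+ 2 / gamma * _ = nu * `|k1%:~R| / kf ^+ 2); last first.
    by field; rewrite !gt_eqF.
  rewrite ler_pdivlMr// -mulrA ler_pM2l//; exact: le_trans k1ge1.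
have small : 32 * L ^+ 2 * e ^+ 2 <= 1.
  have l0 : 0 < 32 * L ^+ 2 by rewrite mulr_gt0// exprn_gt0.
  have e20 : 0 < e ^+ 2 by rewrite exprn_gt0.
  have le0 : 0 <= 32 * L ^+ 2 * e ^+ 2 by rewrite ltW// mulr_gt0.
  rewrite -(ler_pXn2r (n:=2))// ?nnegrE ?ler01// expr1n.
  have -> : (32 * L ^+ 2 * e ^+ 2) ^+ 2 = (32 * L ^+ 2) ^+ 2 * (a / m) by rewrite -e4; ring.
  have lg : nu ^+ 2 / gamma <= ((32 * L ^+ 2) ^+ 2)^-1.
    by rewrite ler_pdivrMr// ler_pdivlMl// exprn_gt0.
  apply: (@le_trans _ _ ((32 * L ^+ 2) ^+ 2 * ((32 * L ^+ 2) ^+ 2)^-1)).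
    by rewrite ler_pM2l ?exprn_gt0//; exact: le_trans lg.
  by rewrite divff// gt_eqF// exprn_gt0.
pose F y := opL kf nu gamma k1 k3 f y - 'i%C * lambda%:C%C * f y.
pose v b y := w b y - u b y; pose v' b y := w' b y - u' b y.
have lf b : L2real (component f b) by have [[l2f _] _] := hf; exact: L2_comp.
have lh b : L2real (component (dyy f) b).
  by have [h2g _] := H1_weak_deriv _ (proj2 hf); exact: L2_comp.
have cu b := C1circle_cont _ _ (Cu b).
have FE b y : component F b y = - a * component (dyy f) b y
     - sg b * (c1 * sin y * (component f (~~ b) y - component (helmholtz_inv bt f) (~~ b) y)
               - lambda * component f (~~ b) y).
  by rewrite /component /F /opL part_operator part_sub.
have op p p' (Cp : forall b, C1circle (p b) (p' b)) :=
  oint2_operator _ _ _ _ _ _ _ _ _ _ _ _ (@continuous_sin R) FE lf lU lh Cw cu fw Uu ww Cp.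
have hF b : L2real (component F b).
  by have [+ _] := op (fun _ _ => 0) (fun _ _ => 0) (fun b => C1circle_cst 0); exact.
pose N := sqnorm (component F).
have N0 : 0 <= N by exact: sqnorm_ge0.
have tst : tested (fun y => s * sin y) (lambda / m) v v' u u' (e ^+ 4) (N / m ^+ 2).
  move=> p p' Cp t t0; have [_ opE] := op p p' Cp.
  have cp b := continuous_L2real _ (C1circle_cont _ _ (Cp b)).
  have tm0 : 0 < t / m by rewrite divr_gt0.
  have := oint2_young_L2 _ _ _ tm0 hF cp; rewrite opE -/N.
  have -> : oint2 (fun b y => (v' b y + u' b y) * p' b y) = oint2 (fun b y => w' b y * p' b y).
    by congr oint2; apply/funext => b; apply/funext => y; rewrite /v' subrK.
  have -> : (fun b y => sg b * (c1 * sin y * (w b y - u b y) - lambda * w b y) * p (~~ b) y) =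
    fun b y => m * (sg b * inviscid (fun y => s * sin y) (lambda / m) v u b y * p (~~ b) y).
    apply/funext => b; apply/funext => y; rewrite /inviscid /v -smE; field; by rewrite gt_eqF.
  have cGp : cont2 (fun b y =>
      sg b * inviscid (fun y => s * sin y) (lambda / m) v u b y * p (~~ b) y).
    have csin := @continuous_sin R; have cu2 : cont2 u := cu.
    have cp2 : cont2 p by move=> b; exact: C1circle_cont (Cp b).
    have cw2 : cont2 w by move=> b; exact: C1circle_cont (Cw b).
    by rewrite /inviscid /v; prove_cont2.
  rewrite oint2Z//.
  rewrite e4; set P1 := oint2 _; set P2 := oint2 _ => h.
  have mi : 0 < m^-1 by rewrite invr_gt0.
  have := ler_wpM2l (ltW mi) h.
  rewrite (_ : m^-1 * (2 * _) = 2 * (a / m * P1 + P2)); last by field; rewrite gt_eqF.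
  by rewrite (_ : m^-1 * _ = t * (N / m ^+ 2) + t^-1 * sqnorm p)//; field; rewrite !gt_eqF.
have CS : C1circle (fun y => s * sin y) (fun y => s * cos y).
  have -> : (fun y => s * cos y) = fun y => 0 * sin y + s * cos y.
    by apply/funext => y; rewrite mul0r add0r.
  by apply: C1circleM; [exact: C1circle_cst | exact: C1circle_sin].
have CC : C1circle (fun y => s * cos y) (fun y => - (s * sin y)).
  have -> : (fun y => - (s * sin y)) = fun y => 0 * cos y + s * - sin y.
    by apply/funext => y; rewrite mul0r add0r mulrN.
  by apply: C1circleM; [exact: C1circle_cst | exact: C1circle_cos].
have Cv b : C1circle (v b) (v' b) by apply: C1circleD => //; apply: C1circleN.
have r0 b b' y : (v b y - (bt ^+ 2 - 1) * u b y + u'' b y) * u b' y = 0 by have [] := rel b b' y.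
have r1 b b' y : (v b y - (bt ^+ 2 - 1) * u b y + u'' b y) * u' b' y = 0 by have [] := rel b b' y.
have r2 b b' y : (v b y - (bt ^+ 2 - 1) * u b y + u'' b y) * u'' b' y = 0 by have [] := rel b b' y.
have main := est _ _ (bt ^+ 2 - 1) (lambda / m) v v' u u' u'' e (N / m ^+ 2) CS CC
  _ Cv Cu Cu' r0 r1 r2 hk e0 small _ tst.
have {}main : e ^+ 4 * sqnorm v / (64 * L ^+ 2) ^+ 2 <= N / m ^+ 2.
  apply: main; last by rewrite divr_ge0// sqr_ge0.
  by move=> y; rewrite !exprMn s2 !mul1r addrC cos2Dsin2.
have B0 : 0 < bt ^+ 2 by apply: lt_trans b1.
(* 1 = |v|^2 + |u'|^2 + k |u|^2, where k times the last two terms is at most |v|^2 *)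
have V1 : k0 / 2 <= sqnorm v.
  have lfU b : L2real (component (fun y => f y - helmholtz_inv bt f y) b).
    have -> : component (fun y => f y - helmholtz_inv bt f y) b =
        fun y => 1 * component f b y + -1 * component (helmholtz_inv bt f) b y.
      by apply/funext => y; rewrite /component part_sub; ring.
    exact: L2real_lin.
  have cv2 : cont2 v by move=> b; exact: C1circle_cont (Cv b).
  have cu2 : cont2 u := cu.
  have ipE : complex.Re (inner f (fun y => f y - helmholtz_inv bt f y)) =
      sqnorm v + energy (bt ^+ 2 - 1) u u'.
    rewrite Re_inner// -(oint2_vu _ _ _ _ _ _ Cv Cu Cu' r0).
    have wv : oint2 (fun b y => w b y * v b y) = sqnorm v + oint2 (fun b y => v b y * u b y).
      have cw2 : cont2 w by move=> b; exact: C1circle_cont (Cw b).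
      rewrite (_ : sqnorm v + _ = oint2_lincomb [:: (1, fun b y => v b y ^+ 2);
        (1, fun b y => v b y * u b y)]); last by rewrite /sqnorm /=; ring.
      apply: oint2_eq_lincomb; [prove_cont2|prove_cont2|move=> b y /=].
      by rewrite (_ : w b y = v b y + u b y); [ring | rewrite /v subrK].
    have per b : oint (fun y => component f b y *
          component (fun y => f y - helmholtz_inv bt f y) b y) = oint (fun y => w b y * v b y).
      have cwv : continuous (fun y => w b y * v b y).
        by apply: continuous_mul; [exact: C1circle_cont (Cw b) | exact: C1circle_cont (Cv b)].
      rewrite /oint /Rintegral; congr fine; apply: ae_eq_integral => //.
      - by have := L2real_prod _ _ (lf b) (lfU b); apply: measurable_int.
      - by have := continuous_circle_integrable _ cwv; apply: measurable_int.
      move: (fw b) (Uu b); apply: filterS2; first exact: (ae_filter_ringOfSetsType mu).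
      by move=> y h1 h2 y2; rewrite /v -h1// -h2// /component part_sub.
    by rewrite -wv /oint2 !per.
  have ip1 : complex.Re (inner f (fun y => f y - helmholtz_inv bt f y)) = 1.
    have p0 : 0 <= complex.Re (inner f (fun y => f y - helmholtz_inv bt f y)).
      apply: le_trans (norm_star_ge bt f b1 lf); apply: mulr_ge0; last exact: sqnorm_ge0.
      by rewrite subr_ge0 invf_le1// ltW.
    by rewrite -(sqr_sqrtr p0) -/(norm_star bt f) n1 expr1n.
  have := sqnorm_v_ge _ _ _ _ _ _ Cv Cu Cu' r0 r2.
  have := sqnorm_ge0 u; have := sqnorm_ge0 u'; have := sqnorm_ge0 u''.
  move: ipE; rewrite ip1 /energy.
  move: hk k00 k01; clear; set k := _ - 1; set V := sqnorm v.
  set U0 := sqnorm u; set U1 := sqnorm u'; set U2 := sqnorm u'' => hk k00 k01 E p2 p1 p0 h.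
  have k_gt0 : 0 < k by lra.
  rewrite leNgt; apply/negP => lt.
  have h1 : (k + 1) * V < (k + 1) * (k0 / 2) by rewrite ltr_pM2l//; lra.
  have h2 : k * k0 <= k by rewrite ler_piMr// ltW.
  have h3 : k = k * V + (k * U1 + k ^+ 2 * U0) by rewrite -[LHS]mulr1 E; ring.
  have h4 : 0 <= k * U1 by rewrite mulr_ge0// ltW.
  lra.
have B1 : 0 <= 1 - bt ^- 2 <= 1.
  by rewrite subr_ge0 invf_le1// ltW//= lerBlDr lerDl invr_ge0 ltW.
have B2 : k0 / 2 <= 1 - bt ^- 2.
  rewrite -(ler_pM2r B0) mulrBl mul1r mulVf ?gt_eqF//.
  have hk' : k0 * k0 <= k0 by rewrite ler_piMl// ltW.
  have hB : k0 / 2 * bt ^+ 2 <= bt ^+ 2 - 1.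
    have := ler_wpM2l (ltW k00) hk; move: hk k00 k01; clear; nra.
  by move: hB; clear; lra.
have mam : m * a = `|k1%:~R * gamma|.
  by rewrite mE /a normrM (gtr0_norm gamma0); field; rewrite !gt_eqF.
have Nm : (k0 / 2) * `|k1%:~R * gamma| / (64 * L ^+ 2) ^+ 2 <= N.
  rewrite ler_pdivlMr ?exprn_gt0// in main.
  have h1 : m ^+ 2 * (e ^+ 4 * sqnorm v / (64 * L ^+ 2) ^+ 2) <= N by rewrite mulrC.
  apply: le_trans h1; rewrite e4 (_ : m ^+ 2 * _ = sqnorm v * (m * a) / (64 * L ^+ 2) ^+ 2).
    by rewrite mam ler_pM2r ?invr_gt0 ?exprn_gt0// ler_wpM2r.
  by field; rewrite !gt_eqF.
have Nlow := norm_star_ge bt _ b1 hF; rewrite -/N in Nlow.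
rewrite /norm_star -/F.
apply: (@le_trans _ _ (k0 / 2 / (64 * L ^+ 2) * Num.sqrt `|k1%:~R * gamma|)).
  rewrite -[leRHS]mulr1 ler_wpM2l//; last by have /andP[] := B1.
  by rewrite mulr_ge0 ?sqrtr_ge0// divr_ge0 ?divr_ge0 ?ltW.
have q0 : 0 <= k0 / 2 / (64 * L ^+ 2) by rewrite divr_ge0 ?divr_ge0 ?ltW.
rewrite -(ger0_norm q0) -sqrtr_sqr -sqrtrM ?sqr_ge0//; apply: ler_wsqrtr.
apply: le_trans Nlow.
apply: (@le_trans _ _ (k0 / 2 * (k0 / 2 * `|k1%:~R * gamma| / (64 * L ^+ 2) ^+ 2))).
  by rewrite le_eqVlt; apply/orP; left; apply/eqP; field; rewrite gt_eqF.
have k020 : 0 <= k0 / 2 by rewrite divr_ge0// ltW.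
apply: ler_pM => //.
by apply: divr_ge0; [rewrite mulr_ge0 | rewrite sqr_ge0].
Qed.

End operator.

Theorem lemma4p2 (R : realType) (kf : R) (hkf : 0 < kf <= 1) :
  exists K c : R, 0 < K /\ 0 < c /\
    forall (nu gamma : R) (k1 k3 : int),
      0 < nu -> K * nu ^+ 2 <= gamma -> 1 < beta kf k1 k3 ^+ 2 ->
      ((c * Num.sqrt `|k1%:~R * gamma| * (1 - (beta kf k1 k3) ^- 2))%:E
         <= Psi kf nu gamma k1 k3)%E.
Proof.
have [k0 [k01 gap]] := beta_gap _ hkf; have /andP[k00 _] := k01.
have [L [L1 est]] := resolvent_estimate k0 k01.
have L2 : 0 < L ^+ 2 by rewrite exprn_gt0// (lt_le_trans ltr01).
exists ((32 * L ^+ 2) ^+ 2), (k0 / 2 / (64 * L ^+ 2)); split; last split.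
- by rewrite exprn_gt0// mulr_gt0.
- by rewrite !divr_gt0// mulr_gt0.
move=> nu gamma k1 k3 nu0 hg b1; apply: le_ereal_inf_tmp => _ [f [lambda [hf n1 ->]]].
rewrite lee_fin; apply: opL_bound => //; exact: gap.
Qed.
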